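(* Let $J=[j_1,\dots,j_r]$ and $K$ be compositions of $n$, and assume that $Q$ is invertible in the coefficient ring of $\mathcal{H}_n$. Then $$\Bigl(\sum_{w\in\mathfrak{S}_n/\mathfrak{S}_J}T_w\,E_J(z_1,\dots,z_r)\,,\,L[K]\Bigr)=\Bigl(\mathcal{N}_J\bigl(E_J^{\xi}(z_1,\dots,z_r)\bigr)\,,\,\zeta_K\Bigr)\,Q^{\ell(K)-n},$$ and this polynomial in $z_1,\dots,z_r$ is equal to the coefficient of the monomial function $m_K$ in the expansion of the product of symmetric functions $$\prod_{a=1}^{r}\bigl(S_{1^{j_a}}+z_a S_{2,1^{j_a-2}}+\cdots+z_a^{j_a-1}S_{j_a}\bigr)=\prod_{a=1}^{r}\Bigl(\sum_{i=0}^{j_a-1}z_a^{i}\,S_{(i+1,1^{j_a-1-i})}\Bigr).$$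
   Context: The coefficient ring $\mathbb{K}$ is a commutative ring containing an invertible element $q$; $Q=q-q^{-1}$. $\mathcal{H}_n$ is the $\mathbb{K}$-algebra generated by $T_1,\dots,T_{n-1}$ with relations $T_iT_{i+1}T_i=T_{i+1}T_iT_{i+1}$, $T_iT_j=T_jT_i$ for $|i-j|>1$, $T_i^2=QT_i+1$. For $w\in\mathfrak{S}_n$ with reduced word $s_{a_1}\cdots s_{a_l}$, $T_w=T_{a_1}\cdots T_{a_l}$. Permutations are written $[w_1,\dots,w_n]$ in one-line notation, and $ws_i$ is obtained from $w$ by exchanging the entries in positions $i,i+1$. The scalar product on $\mathcal{H}_n$ is the bilinear form with $(T_w,T_v)=\delta_{w,v}$, extended linearly to polynomials in the commuting indeterminates $z_1,\dots,z_r$ (which also commute with $\mathcal{H}_n$). A composition of $n$ is a vector of positive integers of sum $n$; $\ell(K)$ is the number of parts of $K$. For $J=[j_1,\dots,j_r]$, $\mathfrak{S}_J=\mathfrak{S}_{j_1}\times\cdots\times\mathfrak{S}_{j_r}\subset\mathfrak{S}_n$ is the Young subgroup and $\mathcal{H}(\mathfrak{S}_J)\cong\mathcal{H}_{j_1}\otimes\cdots\otimes\mathcal{H}_{j_r}$ is the span in $\mathcal{H}_n$ of the $T_w$, $w\in\mathfrak{S}_J$; the direct product $h_1\times\cdots\times h_r$ of $h_a\in\mathcal{H}_{j_a}$ is the corresponding element of $\mathcal{H}(\mathfrak{S}_J)$ (indices of generators in the $a$-th factor are shifted by $j_1+\cdots+j_{a-1}$). Sums over $w\in\mathfrak{S}_n/\mathfrak{S}_J$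 are over the minimal length representatives of the left cosets $w\mathfrak{S}_J$, and $\mathcal{N}_J(h)=\sum_{w\in\mathfrak{S}_n/\mathfrak{S}_J}T_w\,h\,T_{w^{-1}}$ for $h\in\mathcal{H}(\mathfrak{S}_J)$. $\zeta_m=T_{m-1}\cdots T_2T_1\in\mathcal{H}_m$, and $\zeta_K=\zeta_{k_1}\times\zeta_{k_2}\times\cdots$ for $K=[k_1,k_2,\dots]$. $L[K]$ is the sum of all $T_w$, $w\in\mathfrak{S}_n$, such that $w$ is of maximal length in its coset $\mathfrak{S}_K\,w$. $\xi_1=1$, $\xi_i=T_{i-1}\cdots T_1T_1\cdots T_{i-1}$ for $i\ge2$. In $\mathcal{H}_m[z]$ put $$E_m(z)=(1+zT_1)(1+zT_2T_1)\cdots(1+zT_{m-1}\cdots T_1),\qquad E_m^\xi(z)=(1+z\xi_2)(1+z\xi_3)\cdots(1+z\xi_m)$$ (both equal to $1$ for $m=1$), and set $E_J(z_1,\dots,z_r)=E_{j_1}(z_1)\times\cdots\times E_{j_r}(z_r)$, $E_J^\xi(z_1,\dots,z_r)=E^\xi_{j_1}(z_1)\times\cdots\times E^\xi_{j_r}(z_r)$. $S_\lambda$ are Schur functions, and $m_K$ is the monomial symmetric function indexed by the partition obtained by reordering $K$. *)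

(* Defs.v *)
From HB Require Import structures.
From mathcomp Require Import all_boot all_order all_fingroup all_algebra.
From mathcomp Require Import mpoly.
From mathcomp Require Import zify ring.

Set Implicit Arguments.
Unset Strict Implicit.
Unset Printing Implicit Defensive.

Import GRing.Theory.
Local Open Scope ring_scope.

Section Permutations.
Variable n : nat.
Implicit Types (u v w : 'S_n) (a b c d : 'I_n).

(* One-line notation reads w as the map k |-> w_k, and products of permutations
   are composed accordingly: (u o v) k = u (v k). This is the opposite of the
   group law of 'S_n. *)
Definition pcomp u v : 'S_n := (v * u)%g.

(* s_i, for 1 <= i < n, exchanges i and i+1; as 'I_n starts at 0 these are the
   ordinals i-1 and i. The other indices, which are never used, give 1. *)
Definition adjp (i : nat) : 'S_n :=
  if (insub i.-1 : option 'I_n, insub i : option 'I_n) is (Some a, Some b)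
  then tperm a b else 1%g.

(* The length of w, as its number of inversions: by plen_wprod_le and reduced_ex
   it is the least length of a word for w. *)
Definition plen w : nat :=
  #|[set p : 'I_n * 'I_n | (p.1 < p.2)%N && (w p.2 < w p.1)%N]|.

Lemma adj_lt a b x y : b = a.+1 :> nat -> (x, y) != (a, b) ->
  (x < y)%N -> (tperm a b x < tperm a b y)%N.
Proof.
move=> Hb; rewrite xpair_eqE => Hn Hxy.
case: tpermP => [Ex|Ex|/eqP Nxa /eqP Nxb];
  case: tpermP => [Ey|Ey|/eqP Nya /eqP Nyb]; subst=> //; rewrite ?eqxx in Hn;
  rewrite -?(inj_eq val_inj) /= in Hn *; try lia.
Qed.

Lemma plen_asc w a b : b = a.+1 :> nat -> (w a < w b)%N ->
  plen (tperm a b * w) = (plen w).+1.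
Proof.
move=> Hb Hw; set s := tperm a b.
have sK : involutive s by move=> x; rewrite /s tpermK.
rewrite /plen (cardsD1 (a, b)) inE /= !permM tpermL tpermR Hw andbT.
have -> : (a < b)%N by lia.
congr _.+1; pose f (p : 'I_n * 'I_n) := (s p.1, s p.2).
have fK : involutive f by case=> x y; rewrite /f /= !sK.
rewrite -[RHS](card_imset _ (inv_inj fK)); apply/eq_card=> -[x y].
rewrite -[(x, y) in RHS]fK (mem_imset _ _ (inv_inj fK)) !inE /= !permM.
apply/idP/idP => [/and3P[Nxy xy ->]|/andP[xy Hyx]].
  by rewrite andbT; apply: adj_lt.
have Nab : (s x, s y) != (a, b).
  by apply/eqP=> -[Ex Ey]; move: Hyx; rewrite Ex Ey; lia.
have := adj_lt Hb Nab xy; rewrite -/s !sK Hyx => ->; rewrite !andbT.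
apply/eqP=> -[Ex Ey]; move: xy; rewrite Ex Ey /s tpermL tpermR; lia.
Qed.

Lemma plenV w : plen w^-1 = plen w.
Proof.
pose f (p : 'I_n * 'I_n) := (w p.2, w p.1).
have If : injective f by case=> x y [x' y'] [] /perm_inj -> /perm_inj ->.
pose g (p : 'I_n * 'I_n) := ((w^-1)%g p.2, (w^-1)%g p.1).
have fgK : cancel g f by case=> x y; rewrite /f /g /= !permKV.
rewrite /plen -[RHS](card_imset _ If); apply/eq_card=> -[x y].
by rewrite -[(x, y) in RHS]fgK (mem_imset _ _ If) !inE /= !permKV andbC.
Qed.

Lemma plen_lasc w a b : b = a.+1 :> nat ->
  ((w^-1)%g a < (w^-1)%g b)%N -> plen (w * tperm a b) = (plen w).+1.
Proof.
by move=> Hb Hw; rewrite -plenV invMg tpermV plen_asc ?plenV.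
Qed.

Lemma plen_ldes w a b : b = a.+1 :> nat ->
  ((w^-1)%g b < (w^-1)%g a)%N -> plen w = (plen (w * tperm a b)).+1.
Proof.
move=> Hb Hw; rewrite -(plen_lasc (a := a) (b := b)) //.
  by rewrite -mulgA tperm2 mulg1.
by rewrite invMg tpermV !permM tpermL tpermR.
Qed.

Lemma plen1 : plen 1 = 0%N.
Proof.
apply/eqP; rewrite cards_eq0; apply/eqP/setP=> -[x y].
by rewrite !inE !perm1 /=; lia.
Qed.

Lemma no_ldes w :
  (forall a b, b = a.+1 :> nat -> ((w^-1)%g a < (w^-1)%g b)%N) -> w = 1%g.
Proof.
move=> H; apply: invg_inj; rewrite invg1; move: (w^-1)%g H => {}w H.
have ge (a : 'I_n) : (a <= w a)%N.
  case: a => k; elim: k => // k IH Hk /=.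
  have Hk' : (k < n)%N by apply: ltnW.
  by apply: leq_ltn_trans (IH Hk') _; apply: H.
apply/permP=> a; rewrite perm1; apply/eqP/negPn/negP=> Na.
have : (\sum_(i < n) i < \sum_(i < n) w i)%N.
  rewrite (bigD1 a) //= [X in (_ < X)%N](bigD1 a) //= -addSn leq_add //.
    by rewrite ltn_neqAle ge eq_sym andbT.
  by apply: leq_sum=> i _; apply: ge.
rewrite -(reindex_inj (h := w) (P := predT) (F := fun i : 'I_n => i : nat)) /= ?ltnn //.
exact: perm_inj.
Qed.

(* s_i o u = u o s_j if s_i does not preserve the order of the entries of u in
   positions j, j+1. *)
Lemma exch w a b c d : b = a.+1 :> nat -> d = c.+1 :> nat ->
  (w * tperm a b)%g <> (tperm c d * w)%g ->
  (((w * tperm a b)%g d < (w * tperm a b)%g c) = (w d < w c))%N.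
Proof.
move=> Hb Hd Hne; rewrite !permM.
have Hcd : c != d by rewrite -(inj_eq val_inj) /=; lia.
have Nwcd : w c != w d by rewrite (inj_eq perm_inj).
have N1 : (w c, w d) != (a, b).
  apply/eqP=> -[Ec Ed]; apply: Hne; apply/permP=> x; rewrite !permM.
  by rewrite -Ec -Ed; case: (tpermP c d x) => [->|->|/eqP Nc /eqP Nd];
     rewrite ?tpermL ?tpermR // tpermD // (inj_eq perm_inj) eq_sym.
have N2 : (w d, w c) != (a, b).
  apply/eqP=> -[Ed Ec]; apply: Hne; apply/permP=> x; rewrite !permM.
  by rewrite -Ec -Ed tpermC; case: (tpermP c d x) => [->|->|/eqP Nc /eqP Nd];
     rewrite ?tpermL ?tpermR // tpermD // (inj_eq perm_inj) eq_sym.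
apply/idP/idP => H; last exact: adj_lt H.
case: (ltngtP (w d) (w c)) => // [H'|/val_inj/eqP H'].
  by have := ltn_trans H (adj_lt Hb N1 H'); rewrite ltnn.
by rewrite eq_sym H' in Nwcd.
Qed.

Lemma desc_eq w a b c d : b = a.+1 :> nat -> d = c.+1 :> nat ->
  (w * tperm a b)%g = (tperm c d * w)%g ->
  (((w^-1)%g b < (w^-1)%g a) = (w d < w c))%N.
Proof.
move=> Hb Hd E.
have Ncd : c != d by rewrite -(inj_eq val_inj) /=; lia.
have Nab : a != b by rewrite -(inj_eq val_inj) /=; lia.
have K4 := plen_asc (w := w) Hd; have K3 := plen_asc (w := tperm c d * w) Hd.
have K2 := plen_lasc (w := w) Hb; have K1 := plen_ldes (w := w) Hb.
rewrite mulgA tperm2 mul1g !permM tpermL tpermR in K3; rewrite E in K1 K2.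
case: (ltngtP (w d) (w c)) => [Hw|Hw|/val_inj/perm_inj/eqP];
  last by rewrite eq_sym (negbTE Ncd).
  case: (ltngtP ((w^-1)%g b) ((w^-1)%g a)) => // Hw'.
    by have := K2 Hw'; have := K3 Hw; lia.
  by move/val_inj/perm_inj/eqP: Hw'; rewrite eq_sym (negbTE Nab).
apply/negP=> Hw'; have := K1 Hw'; have := K4 Hw; lia.
Qed.

End Permutations.

(* The Hecke algebra H_n with quadratic relation T_i^2 = Q T_i + 1, realized on
   the free module with basis T_w (Tw below), h w being the coefficient of T_w in
   h. T_sqr, T_comm, T_braid and hecke_universal show that it is the algebra
   presented by the generators T_i, and Tw_reduced that T_w is the product of
   the T_i along any reduced word of w. *)
Definition hecke (R : comNzRingType) (Q : R) (n : nat) : Type :=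
  {ffun 'S_n -> R}.

Section HeckeModule.
Variables (R : comNzRingType) (Q : R) (n : nat).
Local Notation H := (hecke Q n).
Implicit Types (h g : H) (u v w : 'S_n) (a b c d : 'I_n) (p : 'I_n * 'I_n).

HB.instance Definition _ := GRing.Zmodule.copy H {ffun 'S_n -> R}.

Definition hscale (x : R) h : H := [ffun w => x * h w].

Lemma hscaleA x y h : hscale x (hscale y h) = hscale (x * y) h.
Proof. by apply/ffunP=> w; rewrite !ffunE mulrA. Qed.
Lemma hscale1 : left_id 1 hscale.
Proof. by move=> h; apply/ffunP=> w; rewrite !ffunE mul1r. Qed.
Lemma hscaleDr : right_distributive hscale +%R.
Proof. by move=> x h g; apply/ffunP=> w; rewrite !ffunE mulrDr. Qed.
Lemma hscaleDl h : {morph hscale^~ h : x y / x + y}.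
Proof. by move=> x y; apply/ffunP=> w; rewrite !ffunE mulrDl. Qed.

HB.instance Definition _ :=
  GRing.Zmodule_isLmodule.Build R H hscaleA hscale1 hscaleDr hscaleDl.

Definition Tw w : H := [ffun v => (v == w)%:R].

Lemma hscaleE x h w : (x *: h) w = x * h w.
Proof. by rewrite ffunE. Qed.

Lemma hsumE (I : Type) (r : seq I) (P : pred I) (F : I -> H) w :
  (\sum_(i <- r | P i) F i) w = \sum_(i <- r | P i) F i w.
Proof. by elim/big_rec2: _ => [|i y x _ <-]; rewrite ffunE. Qed.

Lemma hexpand h : h = \sum_w h w *: Tw w.
Proof.
apply/ffunP=> v; rewrite hsumE (bigD1 v) //= hscaleE ffunE eqxx mulr1.
rewrite big1 ?addr0 // => w; rewrite eq_sym => /negbTE Nw.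
by rewrite hscaleE ffunE Nw mulr0.
Qed.

(* Left and right multiplication by T_i, the pair p being (i-1, i); they act on
   the basis by lmulT and rmulT. *)
Definition lmul p h : H :=
  [ffun v : 'S_n => h (v * tperm p.1 p.2)%g
            + (if ((v^-1)%g p.2 < (v^-1)%g p.1)%N then Q * h v else 0)].
Definition rmul p h : H :=
  [ffun v : 'S_n => h (tperm p.1 p.2 * v)%g
            + (if (v p.2 < v p.1)%N then Q * h v else 0)].

Lemma lmul_linear p : linear (lmul p).
Proof.
move=> x h g; apply/ffunP=> v; rewrite !(ffunE, hscaleE) /=.
by case: ifP => _; rewrite ?ffunE /=; ring.
Qed.
HB.instance Definition _ p := GRing.isLinear.Build R H H *:%R (lmul p) (lmul_linear p).

Lemma rmul_linear p : linear (rmul p).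
Proof.
move=> x h g; apply/ffunP=> v; rewrite !(ffunE, hscaleE) /=.
by case: ifP => _; rewrite ?ffunE /=; ring.
Qed.
HB.instance Definition _ p := GRing.isLinear.Build R H H *:%R (rmul p) (rmul_linear p).

Definition adj p := p.2 == p.1.+1 :> nat.
Definition ldes p v := ((v^-1)%g p.2 < (v^-1)%g p.1)%N.

Lemma lmul_rmulC p q h : adj p -> adj q ->
  lmul p (rmul q h) = rmul q (lmul p h).
Proof.
case: p q => [a b] [c d] /eqP /= Hb /eqP /= Hd; apply/ffunP=> v.
rewrite !ffunE /= mulgA.
have [E|NE] := eqVneq (v * tperm a b)%g (tperm c d * v)%g; last first.
  rewrite (exch Hb Hd); last exact/eqP.
  have -> : (((tperm c d * v)^-1)%g b < ((tperm c d * v)^-1)%g a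
           = ((v^-1)%g b < (v^-1)%g a))%N.
    rewrite invMg tpermV; apply: exch => // E; case/eqP: NE.
    by apply: invg_inj; rewrite !invMg !tpermV E.
  by case: ifP => _; case: ifP => _; rewrite ?mulrDr; ring.
have E' : (tperm c d * v * tperm a b = tperm c d * (tperm c d * v))%g.
  by rewrite mulgA tperm2 mul1g -E -mulgA tperm2 mulg1.
rewrite (desc_eq Hb Hd E) E (desc_eq Hb Hd E') !permM tpermL tpermR.
case: (ltngtP (v d) (v c)) => Hv; try ring.
Qed.

Lemma lmulT p w : lmul p (Tw w) =
  Tw (w * tperm p.1 p.2) + (if ldes p w then Q *: Tw w else 0).
Proof.
apply/ffunP=> v; rewrite !ffunE.
rewrite (can2_eq (mulgK (tperm p.1 p.2)) (mulgKV _)) tpermV.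
congr (_ + _); rewrite /ldes.
have [->|Nvw] := eqVneq v w; first by case: ifP; rewrite !ffunE ?eqxx.
by case: ifP; case: ifP; rewrite !ffunE /= ?(negbTE Nvw) ?mulr0.
Qed.

Lemma rmulT p w : rmul p (Tw w) =
  Tw (tperm p.1 p.2 * w) + (if (w p.2 < w p.1)%N then Q *: Tw w else 0).
Proof.
apply/ffunP=> v; rewrite !ffunE.
rewrite (can2_eq (mulKg (tperm p.1 p.2)) (mulKVg _)) tpermV.
congr (_ + _).
have [->|Nvw] := eqVneq v w; first by case: ifP; rewrite !ffunE ?eqxx.
by case: ifP; case: ifP; rewrite !ffunE /= ?(negbTE Nvw) ?mulr0.
Qed.

(* lword w is a reduced word of w, found by removing left descents. *)
Fixpoint lword_rec k w : seq ('I_n * 'I_n) :=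
  if k is k'.+1 then
    if [pick p | adj p && ldes p w] is Some p
    then p :: lword_rec k' (w * tperm p.1 p.2)%g else [::]
  else [::].
Definition lword w := lword_rec (plen w) w.

Lemma lword1 : lword 1 = [::].
Proof. by rewrite /lword plen1. Qed.

Lemma lword_ind (P : 'S_n -> seq ('I_n * 'I_n) -> Prop) :
    P 1%g [::] ->
    (forall w p (w' := (w * tperm p.1 p.2)%g), adj p -> ldes p w ->
       P w' (lword w') -> P w (p :: lword w')) ->
  forall w, P w (lword w).
Proof.
move=> P1 PS w; rewrite /lword; move: {2}(plen w) (erefl (plen w)) => k.
elim: k w => [|k IH] w Hk; rewrite Hk /=.
  suff -> : w = 1%g by [].
  apply: no_ldes => a b Hb; case: ltngtP => // Hw.
    by have := plen_ldes Hb Hw; rewrite Hk.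
  by move/val_inj/perm_inj/(congr1 val): Hw => /= Hw; lia.
case: pickP => [p /andP[ap dp]|Hp].
  have E : plen (w * tperm p.1 p.2) = k.
    by have := plen_ldes (eqP ap) dp; rewrite Hk => -[].
  by have := PS w p ap dp; rewrite /lword E; apply; have := IH _ E; rewrite E.
suff -> : w = 1%g by [].
apply: no_ldes => a b Hb; have := Hp (a, b); rewrite /adj /ldes /= Hb eqxx /=.
case: ltngtP => // /val_inj/perm_inj/(congr1 val) /= Hw; lia.
Qed.

Lemma ldesN p w : adj p -> ldes p w -> ~~ ldes p (w * tperm p.1 p.2).
Proof.
by move=> ap; rewrite /ldes invMg tpermV !permM tpermL tpermR -leqNgt => /ltnW.
Qed.

Lemma lwordT w : foldr lmul (Tw 1) (lword w) = Tw w.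
Proof.
elim/lword_ind: w / (lword w) => [|w p w' ap dp IH] //=.
by rewrite IH lmulT (negbTE (ldesN ap dp)) addr0 /w' -mulgA tperm2 mulg1.
Qed.

Definition hmul h g : H := \sum_w h w *: foldr lmul g (lword w).

Lemma hmul_linear h : linear (hmul h).
Proof.
move=> x g g'; rewrite /hmul scaler_sumr -big_split; apply: eq_bigr => w _ /=.
rewrite scalerA mulrC -scalerA -scalerDr; congr (_ *: _).
by elim: (lword w) => //= p s ->; rewrite linearP.
Qed.
HB.instance Definition _ h :=
  GRing.isLinear.Build R H H *:%R (hmul h) (hmul_linear h).

Lemma hmul_rmul h g p : adj p -> hmul h (rmul p g) = rmul p (hmul h g).
Proof.
move=> ap; rewrite /hmul linear_sum; apply: eq_bigr => w _ /=.
rewrite linearZ; congr (_ *: _).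
elim/lword_ind: w / (lword w) => [|w p' w' ap' _ IH] //=; rewrite IH.
by rewrite lmul_rmulC.
Qed.

Lemma hmulT1 h : hmul h (Tw 1) = h.
Proof. by rewrite [RHS]hexpand; apply: eq_bigr => w _; rewrite lwordT. Qed.

Lemma hmul1T h : hmul (Tw 1) h = h.
Proof.
rewrite /hmul (bigD1 1%g) //= lword1 ffunE eqxx scale1r big1 ?addr0 // => w.
by rewrite ffunE => /negbTE->; rewrite scale0r.
Qed.

Lemma linear_ext (f g : {linear H -> H}) :
    (forall p, adj p -> forall h, f (rmul p h) = rmul p (f h)) ->
    (forall p, adj p -> forall h, g (rmul p h) = rmul p (g h)) ->
  f (Tw 1) = g (Tw 1) -> f =1 g.
Proof.
move=> Hf Hg E h; rewrite [h]hexpand !linear_sum; apply: eq_bigr => w _.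
rewrite !linearZ; congr (_ *: _); move: {2}(plen w) (erefl (plen w)) => k.
elim: k w => [|k IH] w Hk.
  suff -> : w = 1%g by [].
  apply: no_ldes => a b Hb; case: ltngtP => // Hw.
    by have := plen_ldes Hb Hw; rewrite Hk.
  by move/val_inj/perm_inj/(congr1 val): Hw => /= Hw; lia.
have [p /andP[ap dp]|Hp] := pickP (fun p => adj p && (w p.2 < w p.1)%N); last first.
  suff E1 : w = 1%g by rewrite E1 plen1 in Hk.
  apply: invg_inj; rewrite invg1; apply: no_ldes => a b Hb; rewrite invgK.
  have := Hp (a, b); rewrite /adj /= Hb eqxx /=.
  by case: ltngtP => // /val_inj/perm_inj/(congr1 val) /= Hw; lia.
have Lw : plen (tperm p.1 p.2 * w) = k.
  have := plen_asc (w := tperm p.1 p.2 * w) (eqP ap).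
  by rewrite !permM tpermL tpermR mulgA tperm2 mul1g Hk => /(_ dp) [].
have -> : Tw w = rmul p (Tw (tperm p.1 p.2 * w)).
  rewrite rmulT !permM tpermL tpermR mulgA tperm2 mul1g ltnNge ltnW //=.
  by rewrite addr0.
by rewrite Hf // Hg // IH.
Qed.

Lemma hmulA : associative hmul.
Proof.
move=> h g k; rewrite -[LHS]/((hmul h \o hmul g) k).
apply: (@linear_ext (hmul h \o hmul g) (hmul (hmul h g))) => [p ap x|p ap x|] /=.
- by rewrite !hmul_rmul.
- by rewrite hmul_rmul.
by rewrite !hmulT1.
Qed.

Lemma hmulDl : left_distributive hmul +%R.
Proof.
move=> h g k; rewrite /hmul -big_split; apply: eq_bigr => w _ /=.
by rewrite ffunE scalerDl.
Qed.

Lemma hmulDr : right_distributive hmul +%R.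
Proof. by move=> h g k; rewrite linearD. Qed.

Lemma Tw1_neq0 : Tw 1 != 0.
Proof.
by apply/eqP=> /ffunP/(_ 1%g)/eqP; rewrite !ffunE eqxx oner_eq0.
Qed.

HB.instance Definition _ := GRing.Zmodule_isNzRing.Build H
  hmulA hmul1T hmulT1 hmulDl hmulDr Tw1_neq0.

Lemma hscaleAl (x : R) (h g : H) : x *: (h * g) = (x *: h) * g.
Proof.
rewrite scaler_sumr; apply: eq_bigr => w _.
by rewrite scalerA hscaleE.
Qed.
HB.instance Definition _ := GRing.Lmodule_isLalgebra.Build R H hscaleAl.

Lemma hscaleAr (x : R) (h g : H) : x *: (h * g) = h * (x *: g).
Proof. by rewrite -[h * (x *: g)]/(hmul h (x *: g)) linearZ. Qed.
HB.instance Definition _ := GRing.Lalgebra_isAlgebra.Build R H hscaleAr.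

Lemma Tw1 : Tw 1 = 1.
Proof. by []. Qed.

Lemma mul_Tadj p h : adj p -> Tw (tperm p.1 p.2) * h = lmul p h.
Proof.
move=> ap; rewrite -[LHS]/(hmul _ h); apply: (@linear_ext (hmul (Tw _)) (lmul p)) => [q aq x|q aq x|] /=.
- by rewrite hmul_rmul.
- by rewrite lmul_rmulC.
rewrite hmulT1 lmulT mul1g /ldes invg1 !perm1 (eqP ap).
by rewrite ltnNge leqnSn /= addr0.
Qed.


Definition T (i : nat) : H := Tw (adjp n i).

Lemma adjpP i : (0 < i < n)%N ->
  exists p, [/\ adj p, val p.2 = i & adjp n i = tperm p.1 p.2].
Proof.
move=> Hi; have Hi1 : (i.-1 < n)%N by lia.
have Hi2 : (i < n)%N by lia.
exists (Ordinal Hi1, Ordinal Hi2); split=> //=; first by rewrite /adj /=; lia.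
by rewrite /adjp !insubT.
Qed.

Lemma adjp_adj p : adj p -> adjp n p.2 = tperm p.1 p.2.
Proof.
move=> ap; have /adjpP[[a b] [/eqP /= Hb Eb ->]] : (0 < p.2 < n)%N.
  by rewrite ltn_ord (eqP ap).
have Eb' : b = p.2 by apply: val_inj.
by rewrite Eb' (_ : a = p.1) //; apply: val_inj => /=; move: (eqP ap); lia.
Qed.

Lemma mul_T p h : adj p -> T p.2 * h = lmul p h.
Proof. by move=> ap; rewrite /T adjp_adj // mul_Tadj. Qed.

Lemma mul_T_Tw p w : adj p -> T p.2 * Tw w =
  Tw (w * tperm p.1 p.2) + (if ldes p w then Q *: Tw w else 0).
Proof. by move=> ap; rewrite mul_T // lmulT. Qed.

Lemma ldes_sw p w : adj p -> ldes p (w * tperm p.1 p.2) = ~~ ldes p w.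
Proof.
move=> ap; rewrite /ldes invMg tpermV !permM tpermL tpermR.
by case: ltngtP => // /val_inj/perm_inj/(congr1 val) /=; rewrite (eqP ap); lia.
Qed.

Lemma plen_sw p w : adj p -> plen (w * tperm p.1 p.2) =
  if ldes p w then (plen w).-1 else (plen w).+1.
Proof.
move=> ap; case: ifP => dp; first by rewrite [in RHS](plen_ldes (eqP ap) dp).
have := ldes_sw w ap; rewrite dp => /(plen_ldes (eqP ap)) ->.
by rewrite -mulgA tperm2 mulg1.
Qed.

Definition wprod (s : seq nat) : 'S_n :=
  foldr (fun i w => pcomp (adjp n i) w) 1%g s.

Lemma plen_wprod_le s : all (fun i => 0 < i < n)%N s ->
  (plen (wprod s) <= size s)%N.
Proof.
elim: s => [|i s IH] /=; first by rewrite plen1.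
case/andP=> /adjpP[p [ap _ ->]] /IH; rewrite /pcomp plen_sw //.
by case: ifP; lia.
Qed.

Lemma Tw_reduced s : all (fun i => 0 < i < n)%N s ->
  plen (wprod s) = size s -> Tw (wprod s) = \prod_(i <- s) T i.
Proof.
elim: s => [|i s IH] /=; first by rewrite big_nil.
case/andP=> /adjpP[p [ap Ei ->]] As; rewrite /pcomp plen_sw // big_cons -Ei.
have Ls := plen_wprod_le As; case: ifP => [_|Np [Hs]]; first lia.
by rewrite -IH // mul_T_Tw // Np addr0.
Qed.

Lemma reduced_ex w : exists s,
  [/\ all (fun i => 0 < i < n)%N s, wprod s = w & plen w = size s].
Proof.
elim/lword_ind: w / (lword w) => [|w p w' ap dp [s [As Es Ls]]].
  by exists [::]; rewrite plen1.
exists (val p.2 :: s); split=> /=; first by rewrite As ltn_ord (eqP ap).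
  by rewrite Es adjp_adj // /pcomp -mulgA tperm2 mulg1.
by rewrite -Ls plen_sw // dp (plen_ldes (eqP ap) dp).
Qed.

Lemma T_sqr i : (0 < i < n)%N -> T i * T i = Q *: T i + 1.
Proof.
case/adjpP=> p [ap Ei Es]; rewrite -{1}Ei mul_T_Tw // Es tperm2 addrC.
by rewrite /ldes tpermV tpermL tpermR (eqP ap) leqnn /T Es Tw1.
Qed.

Lemma T_comm i j : (0 < i < n)%N -> (0 < j < n)%N -> (i.+1 < j)%N ->
  T i * T j = T j * T i.
Proof.
move=> /adjpP[[a b] [ap Ei Es]] /adjpP[[c d] [aq Ej Es']] Hij.
rewrite /= in Ei Ej Es Es'; have [/eqP /= Hb /eqP /= Hd] := (ap, aq).
have Ma h : Tw (tperm a b) * h = lmul (a, b) h := mul_Tadj h ap.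
have Mc h : Tw (tperm c d) * h = lmul (c, d) h := mul_Tadj h aq.
rewrite /T Es Es' Ma Mc !lmulT /ldes /= !tpermV.
have N (x y : 'I_n) : val x != val y -> x != y by rewrite (inj_eq val_inj).
have J : (tperm c d ^ tperm a b = tperm c d)%g.
  by rewrite tpermJ !tpermD //; apply: N => /=; lia.
rewrite conjgC J; congr (_ + _).
rewrite !(@tpermD _ a b) ?(@tpermD _ c d) //; try (apply: N => /=; lia).
by rewrite Hb Hd !ltnNge !leqnSn.
Qed.

Lemma perm_braid a b c : a != b -> b != c -> a != c ->
  (tperm a b * tperm b c * tperm a b = tperm b c * tperm a b * tperm b c)%g.
Proof.
move=> ab bc ac; rewrite -{1}(tpermV a b) -mulgA -conjgE.
rewrite -{2}(tpermV b c) -mulgA -conjgE !tpermJ tpermR tpermL !tpermD //;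
  by rewrite eq_sym.
Qed.

Lemma T_braid i : (0 < i)%N -> (i.+1 < n)%N ->
  T i * T i.+1 * T i = T i.+1 * T i * T i.+1.
Proof.
move=> Hi Hi1; have /adjpP[[a b] [ap Ei Es]] : (0 < i < n)%N by lia.
have /adjpP[[b' c] [aq Ej Es']] : (0 < i.+1 < n)%N by lia.
rewrite /= in Ei Ej Es Es'; have [/eqP /= Hb /eqP /= Hc] := (ap, aq).
have Eb : b' = b by apply: val_inj => /=; lia.
rewrite {}Eb {b'} in aq Es' Hc *.
have N (x y : 'I_n) : val x != val y -> x != y by rewrite (inj_eq val_inj).
have [ab bc ac] : [/\ a != b, b != c & a != c] by split; apply: N => /=; lia.
have [ba cb ca] : [/\ b != a, c != b & c != a] by rewrite (eq_sym b a) (eq_sym c b) (eq_sym c a).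
have Ma w : ~~ ldes (a, b) w -> Tw (tperm a b) * Tw w = Tw (w * tperm a b).
  by move=> /negbTE H0; rewrite (mul_Tadj _ ap) lmulT H0 addr0.
have Mb w : ~~ ldes (b, c) w -> Tw (tperm b c) * Tw w = Tw (w * tperm b c).
  by move=> /negbTE H0; rewrite (mul_Tadj _ aq) lmulT H0 addr0.
rewrite -!mulrA /T Es Es'.
have Dc := tpermD ac bc; have Da := tpermD ba ca.
rewrite [Tw (tperm b c) * Tw (tperm a b)]Mb; last first.
  by rewrite /ldes /= tpermV tpermR Dc; lia.
rewrite [Tw (tperm a b) * Tw (tperm b c)]Ma; last first.
  by rewrite /ldes /= tpermV tpermL Da; lia.
rewrite Ma ?Mb ?perm_braid // /ldes /= invMg !tpermV !permM;
  by rewrite !(Dc, Da, tpermL, tpermR); lia.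
Qed.


Section Universal.
Variables (A : algType R) (t : nat -> A).
Hypothesis t_sqr : forall i, (0 < i < n)%N -> t i * t i = Q *: t i + 1.
Hypothesis t_comm : forall i j, (0 < i < n)%N -> (0 < j < n)%N ->
  (i.+1 < j)%N -> t i * t j = t j * t i.
Hypothesis t_braid : forall i, (0 < i)%N -> (i.+1 < n)%N ->
  t i * t i.+1 * t i = t i.+1 * t i * t i.+1.

Let f w : A := \prod_(p <- lword w) t (p : 'I_n * 'I_n).2.

Lemma adj_rng p : adj p -> (0 < p.2 < n)%N.
Proof. by move=> ap; rewrite ltn_ord (eqP ap). Qed.

Lemma lwordP w : w = 1%g \/ exists p,
  [/\ adj p, ldes p w & lword w = p :: lword (w * tperm p.1 p.2)].
Proof.
by elim/lword_ind: w / (lword w) => [|w p w' ap dp _]; [left | right; exists p].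
Qed.

Lemma f_des w p : adj p -> ldes p w -> f w = t p.2 * f (w * tperm p.1 p.2).
Proof.
move: {2}(plen w) (leqnn (plen w)) => k; elim: k w p => [|k IH] w p Hk ap dp.
  by have := plen_ldes (eqP ap) dp; lia.
have Lsw p' : adj p' -> ldes p' w -> (plen (w * tperm p'.1 p'.2) <= k)%N.
  by move=> ap' dp'; have := plen_ldes (eqP ap') dp'; lia.
suff G p1 p2 : adj p1 -> ldes p1 w -> adj p2 -> ldes p2 w -> (p1.2 <= p2.2)%N ->
    t p1.2 * f (w * tperm p1.1 p1.2) = t p2.2 * f (w * tperm p2.1 p2.2).
  have [w1|[p' [ap' dp' E]]] := lwordP w.
    by move: dp; rewrite w1 /ldes invg1 !perm1 (eqP ap) ltnNge leqnSn.
  rewrite {1}/f E big_cons -/(f _).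
  by have [L|/ltnW L] := leqP p.2 p'.2; [rewrite (G p p') | rewrite (G p' p)].
case: p1 p2 => [a b] [c d] ap1 dp1 ap2 dp2.
have L1 := Lsw _ ap1 dp1; have L2 := Lsw _ ap2 dp2; rewrite /= in L1 L2 *.
have [/eqP /= Hb /eqP /= Hd] := (ap1, ap2); rewrite /ldes /= in dp1 dp2.
have N (x y : 'I_n) : val x != val y -> x != y by rewrite (inj_eq val_inj).
rewrite leq_eqVlt => /orP[/eqP bd|bd].
  have -> : b = d by apply: val_inj.
  by have -> : a = c by apply: val_inj => /=; lia.
have [bd'|bd'] := ltnP b.+1 d.
  have da : ldes (c, d) (w * tperm a b).
    by rewrite /ldes /= invMg tpermV !permM !tpermD //; apply: N => /=; lia.
  have db : ldes (a, b) (w * tperm c d).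
    by rewrite /ldes /= invMg tpermV !permM !tpermD //; apply: N => /=; lia.
  rewrite (IH _ _ L1 ap2 da) (IH _ _ L2 ap1 db) /= !mulrA.
  rewrite (t_comm (adj_rng ap1) (adj_rng ap2)) //; congr (_ * f _).
  rewrite -!mulgA; congr (_ * _)%g; rewrite conjgC tpermJ !tpermD //;
  by apply: N => /=; lia.
have cb : c = b by apply: val_inj => /=; lia.
rewrite {}cb {c bd bd'} in ap2 L2 dp2 Hd *.
have [ab bd ad] : [/\ a != b, b != d & a != d] by split; apply: N => /=; lia.
have [ba db da] : [/\ b != a, d != b & d != a].
  by rewrite (eq_sym b a) (eq_sym d b) (eq_sym d a).
have Dd := tpermD ad bd; have Da := tpermD ba da.
have S := (Dd, Da, tpermL, tpermR).
have d1 : ldes (b, d) (w * tperm a b).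
  by rewrite /ldes /= invMg !tpermV !permM !S (ltn_trans dp2 dp1).
have d2 : ldes (a, b) (w * tperm b d).
  by rewrite /ldes /= invMg !tpermV !permM !S (ltn_trans dp2 dp1).
have d1' : ldes (a, b) (w * tperm a b * tperm b d).
  by rewrite /ldes /= !invMg !tpermV !permM !S.
have d2' : ldes (b, d) (w * tperm b d * tperm a b).
  by rewrite /ldes /= !invMg !tpermV !permM !S.
have L1' : (plen (w * tperm a b * tperm b d) <= k)%N.
  by apply: ltnW; rewrite -(plen_ldes Hd d1).
have L2' : (plen (w * tperm b d * tperm a b) <= k)%N.
  by apply: ltnW; rewrite -(plen_ldes Hb d2).
rewrite (IH _ _ L1 ap2 d1) (IH _ _ L2 ap1 d2) /= (IH _ _ L1' ap1 d1').
rewrite (IH _ _ L2' ap2 d2') /= !mulrA.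
have -> : (d : nat) = b.+1 by [].
rewrite t_braid //; last by rewrite -Hd.
  by rewrite -!mulgA [(_ * (_ * tperm a b))%g]mulgA perm_braid // !mulgA.
by rewrite Hb.
Qed.

Let F h : A := \sum_w h w *: f w.

Lemma F_linear : linear F.
Proof.
move=> x h g; rewrite /F scaler_sumr -big_split; apply: eq_bigr => w _ /=.
by rewrite ffunE hscaleE scalerDl scalerA.
Qed.
HB.instance Definition _ := GRing.isLinear.Build R H A *:%R F F_linear.

Lemma F_Tw w : F (Tw w) = f w.
Proof.
rewrite /F (bigD1 w) //= ffunE eqxx scale1r big1 ?addr0 // => v Nv.
by rewrite ffunE (negbTE Nv) scale0r.
Qed.

Lemma F_lmul p h : adj p -> F (lmul p h) = t p.2 * F h.
Proof.
move=> ap; rewrite [h in LHS]hexpand linear_sum /= linear_sum /=.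
rewrite mulr_sumr; apply: eq_bigr => w _.
rewrite linearZ /= linearZ /= -scalerAr; congr (_ *: _).
rewrite lmulT linearD /= F_Tw; case: ifP => dp.
  rewrite linearZ /= F_Tw (f_des ap dp) mulrA t_sqr; last exact: adj_rng.
  by rewrite mulrDl mul1r -scalerAl addrC.
rewrite linear0 addr0.
rewrite (@f_des (w * tperm p.1 p.2) p) ?ldes_sw ?dp // -mulgA tperm2 mulg1.
by [].
Qed.

Lemma F_mul : {morph F : h g / h * g}.
Proof.
move=> h g; rewrite -[h * g]/(hmul h g) /hmul linear_sum mulr_suml.
apply: eq_bigr => w _; rewrite linearZ /= -scalerAl; congr (_ *: _).
rewrite /f; elim/lword_ind: w / (lword w) => [|w p w' ap _ IH].
  by rewrite big_nil mul1r.
by rewrite /= F_lmul // IH big_cons mulrA.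
Qed.

Lemma F_1 : F 1 = 1.
Proof. by rewrite -Tw1 F_Tw /f lword1 big_nil. Qed.

HB.instance Definition _ := GRing.isMonoidMorphism.Build H A F (conj F_1 F_mul).

Theorem hecke_universal : exists g : {lrmorphism H -> A},
  (forall i, (0 < i < n)%N -> g (T i) = t i) /\
  (forall g' : {lrmorphism H -> A},
     (forall i, (0 < i < n)%N -> g' (T i) = t i) -> g' =1 g).
Proof.
have HF i : (0 < i < n)%N -> F (T i) = t i.
  move=> /adjpP[p [ap <- _]].
  by rewrite -[T _]mulr1 mul_T // F_lmul // F_1 mulr1.
exists F; split=> // g' Hg' h; rewrite [h]hexpand !linear_sum.
apply: eq_bigr => w _; rewrite !linearZ; congr (_ *: _).
have [s [As <- Ls]] := reduced_ex w; rewrite Tw_reduced ?Ls // {Ls}.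
rewrite !rmorph_prod !big_seq; apply: eq_bigr => i /(allP As) /= Hi.
by rewrite Hg' // HF.
Qed.

End Universal.

End HeckeModule.

Section ScalarProduct.
Variables (R : comNzRingType) (Q : R) (n : nat).

Definition hform (h g : hecke Q n) : R := \sum_w h w * g w.

Lemma hform_Tw (w v : 'S_n) : hform (Tw Q w) (Tw Q v) = (w == v)%:R.
Proof.
rewrite /hform (bigD1 w) //= !ffunE eqxx mul1r big1 ?addr0 // => u Nu.
by rewrite ffunE (negbTE Nu) mul0r.
Qed.

(* The extension of the scalar product to H_n[z_1, ..., z_r], for a second
   argument in H_n. *)
Definition hformz r (P : {mpoly (hecke Q n)[r]}) (g : hecke Q n) : {mpoly R[r]} :=
  map_mpoly (hform^~ g) P.

End ScalarProduct.

Definition composition (n : nat) (J : seq nat) : bool :=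
  all (ltn 0) J && (sumn J == n).

Section Young.
Variables (n : nat) (J : seq nat).

(* reshape_index J k is the index of the block of J that contains k. *)
Definition young : {set 'S_n} :=
  [set w : 'S_n | [forall k, reshape_index J (w k) == reshape_index J k]].

(* The elements of minimal length of the left cosets w S_J: one for each coset. *)
Definition min_reps : {set 'S_n} :=
  [set w : 'S_n | [forall u in young, plen w <= plen (pcomp w u)]%N].

(* The elements of maximal length of the right cosets S_J w. *)
Definition max_reps : {set 'S_n} :=
  [set w : 'S_n | [forall u in young, plen (pcomp u w) <= plen w]%N].

End Young.

(* Elements of H_m are given by expressions in a family t of generators, with
   t i in the role of T_i. *)
Section Words.
Variables (A : nzRingType) (t : nat -> A).

(* tdown m = t_m ... t_2 t_1 and tup m = t_1 t_2 ... t_m. *)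
Definition tdown (m : nat) : A := \prod_(k <- rev (iota 1 m)) t k.
Definition tup (m : nat) : A := \prod_(k <- iota 1 m) t k.

Definition zeta (m : nat) : A := tdown m.-1.
Definition xi (i : nat) : A := tdown i.-1 * tup i.-1.
Definition Epol (z : A) (m : nat) : A := \prod_(1 <= k < m) (1 + z * tdown k).
Definition Exi (z : A) (m : nat) : A := \prod_(2 <= i < m.+1) (1 + z * xi i).

End Words.

(* The direct product h_1 x ... x h_r: the generators of the a-th factor are
   those of H_n with indices shifted by j_1 + ... + j_(a-1). *)
Definition dirprod (A : nzRingType) (t : nat -> A) (J : seq nat)
    (h : 'I_(size J) -> (nat -> A) -> nat -> A) : A :=
  \prod_(a < size J) h a (fun i => t (sumn (take a J) + i)%N) (nth 0%N J a).

Section Elements.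
Variables (R : comNzRingType) (Q : R) (n : nat).
Local Notation H := (hecke Q n).

Definition zetaJ (K : seq nat) : H :=
  dirprod (T Q n) (fun (a : 'I_(size K)) t m => zeta t m).

Definition Lsum (K : seq nat) : H := \sum_(w in max_reps n K) Tw Q w.

Definition EJ (J : seq nat) : {mpoly H[size J]} :=
  dirprod (fun i => (T Q n i)%:MP) (fun (a : 'I_(size J)) t m => Epol t 'X_a m).

Definition ExiJ (J : seq nat) : {mpoly H[size J]} :=
  dirprod (fun i => (T Q n i)%:MP) (fun (a : 'I_(size J)) t m => Exi t 'X_a m).

Definition coset_sum (J : seq nat) r (h : {mpoly H[r]}) : {mpoly H[r]} :=
  \sum_(w in min_reps n J) (Tw Q w)%:MP * h.

Definition norm (J : seq nat) r (h : {mpoly H[r]}) : {mpoly H[r]} :=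
  \sum_(w in min_reps n J) (Tw Q w)%:MP * h * (Tw Q w^-1)%:MP.

End Elements.

(* A symmetric function over R is represented by its specializations to N
   variables, for all N; identities are required for every N. *)
Section SymmetricFunctions.
Variable R : comNzRingType.

Definition complete (k N : nat) : {mpoly R[N]} :=
  \sum_(m : 'X_{1..N < k.+1} | mdeg m == k) 'X_[m].

(* Schur functions by the Jacobi-Trudi determinant of the S_{l_i - i + j}. *)
Definition schur (l : seq nat) (N : nat) : {mpoly R[N]} :=
  \det (\matrix_(i < size l, j < size l)
          if (i <= nth 0 l i + j)%N then complete (nth 0 l i + j - i)%N N else 0).

(* m_K, for K in any order: the sum of the distinct monomials whose nonzero
   exponents are, up to order, the parts of K. *)
Definition monomial (K : seq nat) (N : nat) : {mpoly R[N]} :=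
  \sum_(m : 'X_{1..N < (sumn K).+1} |
          perm_eq [seq e <- multinom_val m | e != 0%N] K) 'X_[m].

Definition partition_seq (l : seq nat) : bool := sorted geq l && all (ltn 0) l.

(* x is the coefficient of m_K in the expansion of f in the basis of monomial
   functions; by is_monomial_coefE it is unique when K has positive parts. *)
Definition is_monomial_coef (f : forall N, {mpoly R[N]}) (K : seq nat) (x : R) :=
  exists (s : seq (seq nat)) (c : seq nat -> R),
    [/\ uniq s && all partition_seq s, forall l, l \notin s -> c l = 0,
        forall N, f N = \sum_(l <- s) c l *: monomial l N & x = c (sort geq K)].

Lemma is_monomial_coefE f K x : all (ltn 0) K -> is_monomial_coef f K x ->
  x = (f (size K))@_[multinom nth 0 K i | i < size K].
Proof.
move=> Kpos [s [c [/andP[Us Ps] c0 fE ->]]]; rewrite fE linear_sum /=.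
set m := [multinom _ | _ < _]; set k := sort geq K.
have mK : multinom_val m = K :> seq nat.
  apply: (@eq_from_nth _ 0%N) => [|i]; rewrite size_tuple // => Hi.
  by have := mnmE (fun i : 'I_(size K) => nth 0%N K i) (Ordinal Hi);
     rewrite /fun_of_multinom (tnth_nth 0%N).
have pk : perm_eq K k by rewrite perm_sym perm_sort.
have mdm : mdeg m = sumn K by rewrite mdegE sumnE (big_nth 0%N) big_mkord;
  apply: eq_bigr => i _; rewrite mnmE.
have E l : partition_seq l -> (monomial l (size K))@_m = (l == k)%:R.
  move=> /andP[Sl Pl]; have -> : (l == k) = perm_eq K l.
    apply/eqP/idP => [->//|KL]; apply: (@sorted_eq _ geq) => //.
    - by move=> a b d /= ab bd; apply: leq_trans bd ab.
    - by move=> a b /= /andP[ab ba]; apply/eqP; rewrite eqn_leq; apply/andP.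
    - by apply: sort_sorted => a b; apply: leq_total.
    by apply: perm_trans pk; rewrite perm_sym.
  have fK : [seq e <- K | e != 0%N] = K.
    by apply/all_filterP/(sub_all _ Kpos) => e /=; rewrite lt0n.
  rewrite linear_sum /=; case: (boolP (perm_eq K l)) => KL.
    have Hm : (mdeg m < (sumn l).+1)%N by rewrite mdm ltnS (perm_sumn KL).
    rewrite (bigD1 (BMultinom Hm)) /= ?mK ?fK // mcoeffX eqxx.
    rewrite big1 ?addr0 // => m' /andP[_]; rewrite -(inj_eq val_inj) /= mcoeffX.
    by move=> /negbTE->.
  rewrite big1 // => m' Hm'; rewrite mcoeffX; case: eqP => // Em.
  by move: Hm' KL; rewrite Em mK fK => ->.
rewrite big_seq (eq_bigr (fun l => c l * (l == k)%:R)); last first.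
  by move=> l /(allP Ps) Pl; rewrite mcoeffZ E.
rewrite -big_seq; have [ks|ks] := boolP (k \in s).
  rewrite (bigD1_seq k) //= eqxx mulr1 big1 ?addr0 // => l /negbTE->.
  by rewrite mulr0.
rewrite c0 // big1_seq // => l /= ls; case: eqP => [E'|_]; last by rewrite mulr0.
by rewrite -E' ls in ks.
Qed.

End SymmetricFunctions.

(* Main.v *)
Require Import Defs.
From HB Require Import structures.
From mathcomp Require Import all_boot all_fingroup all_algebra.
From mathcomp Require Import mpoly.
From mathcomp Require Import zify ring.

(** Why the theorem holds.  Write D for the set of minimal representatives of
    the cosets w S_J, and encode w in D by the word whose i-th letter is the
    block of J that contains the position of the value i in w.  Call w block
    decreasing when its letters weakly decrease along every block of K, and call
    a repeat two equal consecutive letters inside one block of K.  As w is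
    increasing on the blocks of J, the two values of a repeat stand in
    consecutive positions k-1, k of one block a of J.  Let weight(w) be the
    product, over the positions k that are not first in their block a of J, of
    z_a if k carries a repeat and of 1 + z_a otherwise; weight_sum is the sum of
    weight(w) over the block decreasing w in D.  The polynomials in z are treated
    as scalars: the base change from H_n[z] to the Hecke algebra over R[z] is
    compatible with the scalar product (hform_base_change).

    The first pairing is weight_sum (hform_coset_sum).  For v in S_J one has
    T_w T_v = T_(w v), and w v is maximal in its coset S_K w v if and only if w
    is block decreasing and v^-1 descends at every repeat of w (level_dsc_mul).
    Peeling off the factors of E_J from the last one, the sum over the v in E_J
    with these descents is weight(w), because E_J contains each set of left
    descents exactly once (descent_form_E).

    The second pairing is Q^(n - l(K)) weight_sum (hform_norm).  By adjunction
    (T_w h T_(w^-1), zeta_K) = (T_w h, zeta_K T_w).  Letting the generators of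
    zeta_K act one after the other on T_w, a generator that changes the word
    changes a letter that no later generator can restore, so only diagonal terms
    contribute: a strict descent of the word gives Q, a repeat gives a generator
    of H(S_J) on the right of T_w, and an ascent gives 0 (hform_word).  What is
    left is the pairing of E^xi_J with a product of distinct generators.  This
    pairing has the Markov property, a consequence of the fact that the
    projection of xi_p onto the smaller Hecke algebra is 1, and that of xi_p
    times its last generator is Q; each position contributes z_a Q or 1 + z_a
    (hform_Exi_word).  The number of strict descents plus the number of repeats
    is n - l(K).

    Finally, expanding the Jacobi-Trudi determinant of a hook along its first
    column gives S_(a,1^b) = h_a e_b - S_(a+1,1^(b-1)), so the coefficient in
    S_(a,1^b) of a monomial with l distinct variables is the binomial coefficient
    of l-1 and b; hence its coefficient in the sum over the hooks of size j is
    z^(j-l) (1+z)^(l-1) (mcoeff_hook_sum).  The coefficient of x^K in the product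
    is then a sum over matrices with row sums J and column sums K, and these
    matrices correspond to the block decreasing w in D, by counting the values of
    each block of K in each block of J (cell_inj, cell_exists); the weights agree
    (weight_cells).  As the product is symmetric and inserting empty parts in K
    leaves weight_sum unchanged, this coefficient is that of m_K (hook_prod_monomial). *)

Set Implicit Arguments.
Unset Strict Implicit.
Unset Printing Implicit Defensive.

Import GRing.Theory.
Local Open Scope ring_scope.

(** * Parabolic subgroups given by a monotone labelling of the positions *)

Section Parabolic.
Variables (n : nat) (f : nat -> nat).
Hypothesis f_mono : {homo f : x y / (x <= y)%N}.
Implicit Types (u v w : 'S_n) (a b k : 'I_n).

Definition parabolic : {set 'S_n} := [set w : 'S_n | [forall k, f (w k) == f k]].

Lemma parabolicP w : reflect (forall k, f (w k) = f k) (w \in parabolic).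
Proof. by rewrite inE; apply: (iffP forallP) => H k; apply/eqP/H. Qed.

Lemma parabolic1 : 1%g \in parabolic.
Proof. by apply/parabolicP=> k; rewrite perm1. Qed.

Lemma parabolicM u v : u \in parabolic -> v \in parabolic -> (u * v)%g \in parabolic.
Proof. by move=> /parabolicP Hu /parabolicP Hv; apply/parabolicP=> k;
  rewrite permM Hv. Qed.

Lemma parabolicV u : (u^-1%g \in parabolic) = (u \in parabolic).
Proof.
suff H w : w \in parabolic -> (w^-1)%g \in parabolic by apply/idP/idP => /H //;
  rewrite invgK.
by move=> /parabolicP Hw; apply/parabolicP=> k; rewrite -[in RHS](permKV w k) Hw.
Qed.

Lemma parabolic_tperm a b : f a = f b -> tperm a b \in parabolic.
Proof. by move=> E; apply/parabolicP=> k; case: tpermP => // ->. Qed.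

Lemma parabolicMl u v : u \in parabolic -> ((u * v)%g \in parabolic) = (v \in parabolic).
Proof.
move=> Hu; apply/idP/idP; last exact: parabolicM.
by move=> H; rewrite -[v](mulKg u); apply: parabolicM => //; rewrite parabolicV.
Qed.

Lemma parabolicMr u v : v \in parabolic -> ((u * v)%g \in parabolic) = (u \in parabolic).
Proof.
move=> Hu; apply/idP/idP; last by move=> H; apply: parabolicM.
by move=> H; rewrite -[u](mulgK v); apply: parabolicM => //; rewrite parabolicV.
Qed.

Lemma label_lt a b : (f a < f b)%N -> (a < b)%N.
Proof. by rewrite !ltnNge; apply: contra => /f_mono. Qed.

Definition inversions w : {set 'I_n * 'I_n} :=
  [set p : 'I_n * 'I_n | (p.1 < p.2)%N && (w p.2 < w p.1)%N].

Definition same_level : {set 'I_n * 'I_n} :=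
  [set p : 'I_n * 'I_n | f p.1 == f p.2].

Lemma plen_level w :
  plen w = (#|inversions w :&: same_level| + #|inversions w :\: same_level|)%N.
Proof. by rewrite cardsID. Qed.

(** As u permutes each level and levels are intervals, it preserves the order of two
    positions from different levels and merely relabels the inversions between
    levels. *)
Lemma inversions_cross u w : u \in parabolic ->
  #|inversions (u * w)%g :\: same_level| = #|inversions w :\: same_level|.
Proof.
move=> Hu; have /parabolicP fu := Hu.
pose g (p : 'I_n * 'I_n) := (u p.1, u p.2).
have Ig : injective g by case=> x y [x' y'] [] /perm_inj -> /perm_inj ->.
rewrite -(card_imset _ Ig); apply/eq_card=> -[x y].
rewrite -[x](permKV u) -[y](permKV u) -/(g ((u^-1)%g x, (u^-1)%g y)).
rewrite (mem_imset _ _ Ig) !inE /= !fu !permM !permKV.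
set x' := (u^-1)%g x; set y' := (u^-1)%g y.
case: (ltngtP (f x') (f y')) => //= H.
  by rewrite (label_lt H) (@label_lt x y) // -[x](permKV u) -[y](permKV u) !fu.
have xy : (y < x)%N by apply: label_lt; rewrite -[x](permKV u) -[y](permKV u) !fu.
by rewrite [in LHS]ltnNge [in RHS]ltnNge (ltnW xy) (ltnW (label_lt H)).
Qed.

Definition level_asc w := forall a b, (a < b)%N -> f a = f b -> (w a < w b)%N.
Definition level_dsc w := forall a b, (a < b)%N -> f a = f b -> (w b < w a)%N.

(** Consecutive positions suffice, because all positions between two positions of
    one level lie on that level. *)
Lemma level_chain (r : rel nat) (w : 'I_n -> nat) : transitive r ->
    (forall a b, b = a.+1 :> nat -> f a = f b -> r (w a) (w b)) ->
  forall a b, (a < b)%N -> f a = f b -> r (w a) (w b).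
Proof.
move=> r_tr H a b; move: {2}(nat_of_ord b) (erefl (nat_of_ord b)) => m.
elim: m b => [|m IH] b Eb; first by rewrite Eb.
rewrite [X in (_ < X)%N]Eb ltnS leq_eqVlt => /orP[/eqP ab|ab] E; first by apply: H;
  rewrite // Eb ab.
have Hm : (m < n)%N by rewrite -Eb ltnW.
have := f_mono (ltnW ab); have := @f_mono m b; rewrite Eb leqnSn -Eb => /(_ isT).
move=> mb am; have Em : f a = f m by apply/eqP; rewrite eqn_leq am E.
apply: (r_tr (w (Ordinal Hm))); first exact: IH.
by apply: H => //=; rewrite -Em.
Qed.

Lemma inversions_level_asc w : level_asc w -> inversions w :&: same_level = set0.
Proof.
move=> Hw; apply/setP=> -[a b]; rewrite !inE /=; apply/negP.
case/andP=> /andP[ab wba] /eqP E; have := Hw _ _ ab E; lia.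
Qed.

Lemma inversions_cross_parabolic u : u \in parabolic ->
  inversions u :\: same_level = set0.
Proof.
move=> Hu; apply/eqP; rewrite -cards_eq0 -[u]mulg1 inversions_cross // cards_eq0.
by apply/eqP/setP=> -[a b]; rewrite !inE !perm1 /=; lia.
Qed.

(** The inversions of u * w (which is u followed by w) inside the levels are those
    of u, and those between the levels are counted by w. *)
Lemma plen_mul_asc u w : level_asc w -> u \in parabolic ->
  plen (u * w) = (plen w + plen u)%N.
Proof.
move=> Hw Hu; rewrite [plen (u * w)]plen_level inversions_cross // (plen_level w).
rewrite (inversions_level_asc Hw) cards0 add0n addnC (plen_level u)
  (inversions_cross_parabolic Hu).
rewrite cards0 addn0; congr (_ + _)%N; apply/eq_card=> -[a b].
rewrite !inE /= !permM; have [ab|//] := ltnP a b; have [E|_] := eqVneq (f a) (f b).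
  2: by rewrite !andbF.
have /parabolicP fu := Hu; rewrite !andbT /=.
case: (ltngtP (u a) (u b)) => H.
- by rewrite ltnNge ltnW //; apply: Hw; rewrite ?fu.
- by apply: Hw; rewrite ?fu.
by move/val_inj/perm_inj: H ab => ->; rewrite ltnn.
Qed.

Lemma plen_mul_dsc u w : level_dsc w -> u \in parabolic ->
  (plen (u * w) <= plen w)%N.
Proof.
move=> Hw Hu; rewrite !plen_level inversions_cross // leq_add2r.
apply/subset_leq_card/subsetP=> -[a b]; rewrite !inE /= => /andP[/andP[ab _] /eqP E].
by rewrite ab E eqxx Hw.
Qed.

Lemma parabolic_asc1 u : u \in parabolic -> level_asc u -> u = 1%g.
Proof.
move=> Hu Au; apply: no_ldes => a b ab.
case: (ltngtP ((u^-1)%g a) ((u^-1)%g b)) => // H.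
  have Ef : f a = f b.
    have := Hu; rewrite -parabolicV => /parabolicP fu.
    have le_ab : (f a <= f b)%N by apply: f_mono; rewrite ab.
    by apply/eqP; rewrite eqn_leq le_ab -[f a]fu -[f b]fu f_mono // ltnW.
  have : (u ((u^-1)%g b) < u ((u^-1)%g a))%N.
    by apply: Au => //; have := Hu; rewrite -parabolicV => /parabolicP fu; rewrite !fu.
  by rewrite !permKV ab ltnNge leqnSn.
by move/val_inj/perm_inj/(congr1 val): H; rewrite /= ab => /eqP;
  rewrite eqn_leq ltnn andbF.
Qed.

Lemma plen_min_asc w :
  (forall u, u \in parabolic -> (plen w <= plen (u * w))%N) -> level_asc w.
Proof.
move=> H; apply: (level_chain (r := ltn)) => [x y z|a b ab E /=]; first exact: ltn_trans.
case: (ltngtP (w a) (w b)) => // Hw.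
  have := plen_asc (w := tperm a b * w) ab.
  rewrite !permM tpermL tpermR mulgA tperm2 mul1g => /(_ Hw) E1.
  by have := H _ (parabolic_tperm E); rewrite E1 ltnn.
by move/val_inj/perm_inj/(congr1 val): Hw => /= /eqP; rewrite ab eqn_leq ltnn andbF.
Qed.

Lemma plen_max_dsc w :
  (forall u, u \in parabolic -> (plen (u * w) <= plen w)%N) -> level_dsc w.
Proof.
move=> H; apply: (level_chain (r := fun x y => (y < x)%N)) => [x y z|a b ab E /=].
  by move=> yx xz; apply: ltn_trans xz yx.
case: (ltngtP (w b) (w a)) => // Hw.
  have := plen_asc ab Hw => E1.
  by have := H _ (parabolic_tperm E); rewrite E1 ltnn.
by move/val_inj/perm_inj/(congr1 val): Hw => /= /eqP; rewrite ab eqn_leq ltnn.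
Qed.

(** Take an element of minimal length in the coset. *)
Lemma level_asc_rep w : exists2 u, u \in parabolic & level_asc (u * w)%g.
Proof.
have [u Hu Hmin] := arg_minnP (fun u => plen (u * w)) parabolic1.
exists u => //; apply: plen_min_asc => v Hv; rewrite mulgA; apply: Hmin.
exact: parabolicM.
Qed.

Lemma level_asc_inj w w' : level_asc w -> level_asc w' ->
  (w * w'^-1)%g \in parabolic -> w = w'.
Proof.
move=> Aw Aw' Hu; set u := (w * w'^-1)%g in Hu.
have Ew : w = (u * w')%g by rewrite /u mulgKV.
have Au : level_asc u.
  move=> a b ab E; case: (ltngtP (u a) (u b)) => // H.
    have /parabolicP fu := Hu; have := Aw' _ _ H; rewrite !fu => /(_ (esym E)).
    rewrite -!(permM u w') -Ew; have := Aw _ _ ab E; lia.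
  by move/val_inj/perm_inj: H ab => ->; rewrite ltnn.
by rewrite Ew (parabolic_asc1 Hu Au) mul1g.
Qed.

End Parabolic.

Section MinMax.
Variables (n : nat) (J : seq nat).
Local Notation f := (reshape_index J).

Lemma reshape_index_cons k sh i : reshape_index (k :: sh) i =
  if (i < k)%N then 0%N else (reshape_index sh (i - k)).+1.
Proof.
rewrite /reshape_index /= subn_eq0; case: ltnP => // ki; congr _.+1.
by rewrite subSn.
Qed.

Lemma reshape_index_mono : {homo f : x y / (x <= y)%N}.
Proof.
elim: J => [|k sh IH] x y xy; first by rewrite /reshape_index.
rewrite !reshape_index_cons; case: (ltnP x k) => // kx.
by rewrite [(y < k)%N]ltnNge (leq_trans kx xy) /= ltnS; apply: IH; rewrite leq_sub2r.
Qed.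

Lemma min_repsE (w : 'S_n) : w \in min_reps n J <-> level_asc f w.
Proof.
rewrite inE; split=> [/forallP H|Aw].
  by apply: plen_min_asc reshape_index_mono _ _ => u Hu; have := H u; rewrite Hu.
apply/forallP=> u; apply/implyP=> Hu; rewrite /Defs.pcomp.
by rewrite (plen_mul_asc reshape_index_mono Aw Hu) leq_addr.
Qed.

Lemma max_repsE (w : 'S_n) : w \in max_reps n J <-> level_dsc f (w^-1)%g.
Proof.
rewrite inE; split=> [/forallP H|Dw].
  apply: plen_max_dsc reshape_index_mono _ _ => u Hu; have := H (u^-1)%g.
  rewrite (parabolicV f u : (u^-1%g \in young n J) = _) Hu /= /Defs.pcomp => Hw.
  by rewrite plenV -plenV invMg invgK.
apply/forallP=> u; apply/implyP=> Hu;
  rewrite /Defs.pcomp -plenV -[X in (_ <= X)%N]plenV invMg.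
by apply: plen_mul_dsc reshape_index_mono _ _ Dw _; rewrite parabolicV.
Qed.

End MinMax.

(** * The scalar product and the adjoints of multiplications *)

Section HeckeTools.
Variables (R : comNzRingType) (Q : R) (n : nat).
Local Notation H := (hecke Q n).
Local Notation T := (T Q n).
Local Notation Tw := (Tw Q).
Implicit Types (h g x y : H) (u v w : 'S_n) (p : 'I_n * 'I_n).

(** Reduced words of w and u concatenate to a word of u * w, which is reduced because
    the lengths add up. *)
Lemma Tw_mul_add u w : plen (u * w) = (plen w + plen u)%N ->
  Tw w * Tw u = Tw (u * w).
Proof.
have [s [As Es Ls]] := reduced_ex w; have [t [At Et Lt]] := reduced_ex u.
have E : wprod n (s ++ t) = (u * w)%g.
  elim: s w {As Ls} Es => [|i s IH] w /=; first by move=> <-; rewrite mulg1.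
  by move=> <-; rewrite (IH (wprod n s)) // /Defs.pcomp mulgA.
move=> L; rewrite -E Tw_reduced ?all_cat ?As ?At //; last first.
  by rewrite E L size_cat Ls Lt.
by rewrite big_cat -Es -Et !Tw_reduced // ?Es ?Et.
Qed.

Lemma hform_addl h h' g : hform (h + h') g = hform h g + hform h' g.
Proof.
by rewrite /hform -big_split; apply: eq_bigr => w _; rewrite ffunE mulrDl.
Qed.

Lemma hform_scalel (c : R) h g : hform (c *: h) g = c * hform h g.
Proof.
rewrite /hform mulr_sumr; apply: eq_bigr => w _.
by rewrite hscaleE mulrA.
Qed.

Lemma hformC h g : hform h g = hform g h.
Proof. by apply: eq_bigr => w _; rewrite mulrC. Qed.

Lemma hform_addr h g g' : hform h (g + g') = hform h g + hform h g'.
Proof. by rewrite hformC hform_addl !(hformC h). Qed.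

Lemma hform_scaler (c : R) h g : hform h (c *: g) = c * hform h g.
Proof. by rewrite hformC hform_scalel hformC. Qed.

Lemma hform0l g : hform (0 : H) g = 0.
Proof. by rewrite -(scale0r 0) hform_scalel mul0r. Qed.

Lemma hform0r h : hform h (0 : H) = 0.
Proof. by rewrite hformC hform0l. Qed.

Lemma hform_suml (I : Type) (r : seq I) (P : pred I) (F : I -> H) g :
  hform (\sum_(i <- r | P i) F i) g = \sum_(i <- r | P i) hform (F i) g.
Proof.
by elim/big_rec2: _ => [|i a b _ <-]; rewrite ?hform0l ?hform_addl.
Qed.

Lemma hform_sumr (I : Type) (r : seq I) (P : pred I) (F : I -> H) g :
  hform g (\sum_(i <- r | P i) F i) = \sum_(i <- r | P i) hform g (F i).
Proof. by rewrite hformC hform_suml; apply: eq_bigr => i _; apply: hformC. Qed.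

Lemma hform_Twl w g : hform (Tw w) g = g w.
Proof.
rewrite /hform (bigD1 w) //= ffunE eqxx mul1r big1 ?addr0 // => v.
by rewrite ffunE => /negbTE ->; rewrite mul0r.
Qed.

Lemma hform1l g : hform 1 g = g 1%g.
Proof. exact: hform_Twl. Qed.

Lemma hform_orth (D : pred 'S_n) h g : (forall w, ~~ D w -> h w = 0) ->
  (forall w, D w -> g w = 0) -> hform h g = 0.
Proof.
move=> Hh Hg; rewrite /hform big1 // => w _; case: (boolP (D w)) => Dw.
  by rewrite Hg ?mulr0.
by rewrite Hh ?mul0r.
Qed.

Lemma mul_T_r p h : adj p -> h * T p.2 = rmul p h.
Proof.
move=> ap; have -> : T p.2 = rmul p 1.
  rewrite /Defs.T adjp_adj // -Tw1 rmulT mulg1 !perm1 ltnNge.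
  by rewrite ltnW /= ?addr0 // (eqP ap).
by rewrite -[LHS]/(hmul h _) hmul_rmul // -[hmul h 1]/(h * 1) mulr1.
Qed.

Lemma hform_Tl i h g : (0 < i < n)%N -> hform (T i * h) g = hform h (T i * g).
Proof.
case/adjpP=> p [ap <- _]; rewrite !mul_T //.
have E h' g' : hform (lmul p h') g'
    = \sum_v h' (v * tperm p.1 p.2)%g * g' v
      + \sum_(v : 'S_n) (if ldes p v then Q * h' v * g' v else 0).
  rewrite /hform -big_split; apply: eq_bigr => v _ /=.
  by rewrite ffunE mulrDl -/(ldes p v); case: (ldes p v); rewrite ?mul0r.
rewrite [RHS]hformC !E; congr (_ + _).
  rewrite (reindex_inj (mulIg (tperm p.1 p.2))) /=; apply: eq_bigr => v _.
  by rewrite -mulgA tperm2 mulg1 mulrC.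
by apply: eq_bigr => v _; rewrite mulrAC.
Qed.

Lemma hform_Tr i h g : (0 < i < n)%N -> hform (h * T i) g = hform h (g * T i).
Proof.
case/adjpP=> p [ap <- _]; rewrite !mul_T_r //.
have E h' g' : hform (rmul p h') g'
    = \sum_v h' (tperm p.1 p.2 * v)%g * g' v
      + \sum_(v : 'S_n) (if (v p.2 < v p.1)%N then Q * h' v * g' v else 0).
  rewrite /hform -big_split; apply: eq_bigr => v _ /=.
  by rewrite ffunE mulrDl; case: (v p.2 < v p.1)%N; rewrite ?mul0r.
rewrite [RHS]hformC !E; congr (_ + _).
  rewrite (reindex_inj (mulgI (tperm p.1 p.2))) /=; apply: eq_bigr => v _.
  by rewrite mulgA tperm2 mul1g mulrC.
by apply: eq_bigr => v _; rewrite mulrAC.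
Qed.

Lemma wprod_rev s : (wprod n (rev s) = (wprod n s)^-1)%g.
Proof.
have E t t' : wprod n (t ++ t') = (wprod n t' * wprod n t)%g.
  by elim: t => [|i t IH] /=; rewrite ?mulg1 // IH /Defs.pcomp mulgA.
elim: s => [|i s IH]; first by rewrite invg1.
rewrite rev_cons -cats1 E IH /= /Defs.pcomp invMg; rewrite /Defs.pcomp mul1g;
  congr (_ * _)%g.
rewrite /adjp; case: (insub i.-1 : option 'I_n) => [a|]; rewrite ?invg1 //.
by case: (insub i : option 'I_n) => [b|]; rewrite ?tpermV ?invg1.
Qed.

Lemma TwV_word w s : all (fun i => 0 < i < n)%N s -> wprod n s = w ->
  plen w = size s -> Tw w^-1 = \prod_(i <- rev s) T i.
Proof.
move=> As <- L; rewrite -wprod_rev Tw_reduced ?all_rev //.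
by rewrite wprod_rev plenV L size_rev.
Qed.

Lemma hform_Twml w h g : hform (Tw w * h) g = hform h (Tw w^-1 * g).
Proof.
have [s [As Es Ls]] := reduced_ex w; rewrite (TwV_word As Es Ls).
rewrite -Es Tw_reduced ?Es //; clear Es Ls.
elim: s As g => [|i s IH] /= As g; first by rewrite /= !big_nil !mul1r.
move: As => /andP[Hi As]; rewrite big_cons rev_cons -cats1 big_cat big_seq1 /=.
by rewrite -!mulrA hform_Tl // IH.
Qed.

Lemma hform_Twmr w h g : hform (h * Tw w) g = hform h (g * Tw w^-1).
Proof.
have [s [As Es Ls]] := reduced_ex w; rewrite (TwV_word As Es Ls).
rewrite -Es Tw_reduced ?Es //; clear Es Ls.
elim: s As h => [|i s IH] /= As h; first by rewrite /= !big_nil !mulr1.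
move: As => /andP[Hi As]; rewrite big_cons rev_cons -cats1 big_cat big_seq1 /=.
by rewrite !mulrA IH // hform_Tr // -!mulrA.
Qed.

(** The anti-automorphism with T_w |-> T_(w^-1), which describes the adjoints of left
    and right multiplications. *)
Definition star h : H := [ffun w => h (w^-1)%g].

Lemma starE h : star h = \sum_w h w *: Tw w^-1.
Proof.
apply/ffunP=> v; rewrite ffunE hsumE (bigD1 (v^-1)%g) //= hscaleE ffunE invgK.
rewrite eqxx mulr1 big1 ?addr0 // => w Nw; rewrite hscaleE ffunE.
by rewrite -(inj_eq invg_inj) invgK eq_sym (negbTE Nw) mulr0.
Qed.

Lemma hform_ml x h g : hform (x * h) g = hform h (star x * g).
Proof.
rewrite starE {1}[x]hexpand !mulr_suml hform_suml hform_sumr.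
apply: eq_bigr => w _.
by rewrite -!scalerAl hform_scalel hform_scaler hform_Twml.
Qed.

Section Support.
Variable f : nat -> nat.
Hypothesis f_mono : {homo f : x y / (x <= y)%N}.

(** The subalgebra H(parabolic n f), as the span of its T_w. *)
Definition supported h := forall w, w \notin parabolic n f -> h w = 0.

Lemma supp0 : supported 0. Proof. by move=> w _; rewrite ffunE. Qed.

Lemma suppD h g : supported h -> supported g -> supported (h + g).
Proof. by move=> Hh Hg w Hw; rewrite ffunE Hh // Hg // addr0. Qed.

Lemma suppZ (c : R) h : supported h -> supported (c *: h).
Proof. by move=> Hh w Hw; rewrite hscaleE Hh // mulr0. Qed.

Lemma supp_sum (I : Type) (r : seq I) (P : pred I) (F : I -> H) :
  (forall i, P i -> supported (F i)) -> supported (\sum_(i <- r | P i) F i).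
Proof. by move=> HF; elim/big_rec: _ => [|i x Pi]; [exact: supp0 | apply/suppD/HF]. Qed.

Lemma supp_Tw w : w \in parabolic n f -> supported (Tw w).
Proof. by move=> Hw v; rewrite ffunE; case: eqP => // ->; rewrite Hw. Qed.

Lemma supp1 : supported 1.
Proof. exact/supp_Tw/parabolic1. Qed.

Lemma parabolic_adjp i : (0 < i < n)%N -> f i.-1 = f i -> adjp n i \in parabolic n f.
Proof.
case/adjpP=> p [ap /= Ei ->] E; apply: parabolic_tperm.
by rewrite Ei -E -Ei (eqP ap).
Qed.

Lemma supp_T i : (0 < i < n)%N -> f i.-1 = f i -> supported (T i).
Proof. by move=> Hi E; apply/supp_Tw/parabolic_adjp. Qed.

Lemma supp_star h : supported h -> supported (star h).
Proof. by move=> Hh w Hw; rewrite ffunE Hh // parabolicV. Qed.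

Lemma supp_lmul p h : f p.1 = f p.2 -> supported h -> supported (lmul p h).
Proof.
move=> E Hh w Hw; rewrite ffunE Hh; last by rewrite parabolicMr ?parabolic_tperm.
by rewrite Hh // mulr0 if_same addr0.
Qed.

Lemma parabolic_ldes p w : adj p -> ldes p w -> w \in parabolic n f -> f p.1 = f p.2.
Proof.
move=> ap dp; rewrite -parabolicV => /parabolicP fw.
have le12 : (f p.1 <= f p.2)%N by apply: f_mono; rewrite (eqP ap).
by apply/eqP; rewrite eqn_leq le12 -[f p.1]fw -[f p.2]fw f_mono // ltnW.
Qed.

(** A left descent of an element of the parabolic subgroup exchanges two values of one
    level, so a reduced word of such an element only involves generators of the
    subgroup. *)
Lemma suppM h g : supported h -> supported g -> supported (h * g).
Proof.
move=> Hh Hg; rewrite -[h * g]/(hmul h g) /hmul; apply: supp_sum => w _.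
case: (boolP (w \in parabolic n f)) => Hw; last first.
  by rewrite Hh // scale0r; apply: supp0.
apply: suppZ; elim/lword_ind: w / (lword w) Hw => [|w p w' ap dp IH] //= Hw.
have E := parabolic_ldes ap dp Hw.
by apply: supp_lmul => //; apply: IH; rewrite /w' parabolicMr ?parabolic_tperm.
Qed.

Lemma supp_prod (I : Type) (r : seq I) (P : pred I) (F : I -> H) :
  (forall i, P i -> supported (F i)) -> supported (\prod_(i <- r | P i) F i).
Proof. by move=> HF; elim/big_rec: _ => [|i x Pi]; [exact: supp1 | apply/suppM/HF]. Qed.

Lemma Tw_mul_asc u w : level_asc f w -> u \in parabolic n f -> Tw w * Tw u = Tw (u * w).
Proof. by move=> Aw Hu; apply/Tw_mul_add/(plen_mul_asc f_mono). Qed.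

Lemma supp_expand h : supported h -> h = \sum_(u in parabolic n f) h u *: Tw u.
Proof.
move=> Hh; rewrite {1}[h]hexpand (bigID (mem (parabolic n f))) /=.
by rewrite [X in _ + X]big1 ?addr0 // => u Hu; rewrite Hh // scale0r.
Qed.

Lemma Tw_asc_expand w h : level_asc f w -> supported h ->
  Tw w * h = \sum_(u in parabolic n f) h u *: Tw (u * w).
Proof.
move=> Aw Hh; rewrite {1}(supp_expand Hh) mulr_sumr; apply: eq_bigr => u Hu.
by rewrite -scalerAr Tw_mul_asc.
Qed.

Lemma hform_asc w h g : level_asc f w -> supported h -> supported g ->
  hform (Tw w * h) (Tw w * g) = hform h g.
Proof.
move=> Aw Hh Hg; rewrite (Tw_asc_expand Aw Hh) hform_suml.
rewrite [in RHS](supp_expand Hh) hform_suml; apply: eq_bigr => u Hu.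
rewrite !hform_scalel !hform_Twl (Tw_asc_expand Aw Hg) hsumE (bigD1 u) //=.
rewrite hscaleE ffunE eqxx mulr1 big1 ?addr0 // => v /andP[_ Nv].
by rewrite hscaleE ffunE (inj_eq (mulIg w)) eq_sym (negbTE Nv) mulr0.
Qed.

End Support.
End HeckeTools.

(** * Jucys-Murphy elements and their projections *)

Section JucysMurphy.
Variables (A : nzRingType) (t : nat -> A) (m : nat).
Hypothesis t_comm : forall i j, (0 < i)%N -> (i.+1 < j)%N -> (j <= m)%N ->
  t i * t j = t j * t i.
Hypothesis t_braid : forall i, (0 < i)%N -> (i < m)%N ->
  t i * t i.+1 * t i = t i.+1 * t i * t i.+1.

Lemma xi1 : xi t 1 = 1.
Proof. by rewrite /xi /tdown /tup !big_nil mulr1. Qed.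

Lemma xiS k : xi t k.+2 = t k.+1 * xi t k.+1 * t k.+1.
Proof.
have E : iota 1 k.+1 = iota 1 k ++ [:: k.+1] by rewrite -{1}(addn1 k) iotaD.
rewrite /xi /tdown /tup -[k.+2.-1]/k.+1 -[k.+1.-1]/k E rev_cat big_cat /= big_seq1
  big_cat /= big_seq1.
by rewrite -!mulrA.
Qed.

Lemma comm_xi x k : (forall i, (0 < i <= k)%N -> GRing.comm x (t i)) ->
  GRing.comm x (xi t k.+1).
Proof.
move=> H; rewrite /xi /tdown /tup /=; apply: commrM.
  by rewrite big_seq; apply: commr_prod => i; rewrite mem_rev mem_iota => Hi;
    apply: H; lia.
by rewrite big_seq; apply: commr_prod => i; rewrite mem_iota => Hi; apply: H; lia.
Qed.

(** Induction through xiS; the only case that needs more than far commutation is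
    i = k - 1, where the braid relation is used on both sides of xi t k.-1. *)
Lemma xi_comm i k : (0 < i < k)%N -> (k <= m)%N -> GRing.comm (t i) (xi t k.+1).
Proof.
elim: k => [|k IH] Hi Hk; first lia.
rewrite xiS; have [ik|ki] := ltnP i k.
  have C : GRing.comm (t i) (t k.+1) by apply: t_comm; lia.
  by apply: commrM => //; apply: commrM => //; apply: IH; lia.
case: k i Hi Hk IH ki => [|k] i Hi Hk _ ki; first lia.
have -> : i = k.+1 by lia.
rewrite xiS /GRing.comm.
have B : t k.+1 * t k.+2 * t k.+1 = t k.+2 * t k.+1 * t k.+2 by apply: t_braid; lia.
have C : xi t k.+1 * t k.+2 = t k.+2 * xi t k.+1.
  by apply/esym/comm_xi => j Hj; apply/esym/t_comm; lia.
move: (xi t k.+1) C => x C; rewrite !mulrA B -!mulrA; congr (_ * (_ * _)).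
by rewrite !mulrA -C -!mulrA; congr (_ * _); rewrite !mulrA B.
Qed.

End JucysMurphy.

(** The positions below p share the label p and every other position is alone on its
    level: the parabolic subgroup is S_p, fixing all positions from p on, and the
    elements supported on it form H_p. *)
Definition low (p i : nat) : nat := maxn p i.+1.

Lemma low_mono p : {homo low p : x y / (x <= y)%N}.
Proof. by move=> x y; rewrite /low; lia. Qed.

Section Local.
Variables (R : comNzRingType) (Q : R) (n : nat).
Local Notation H := (hecke Q n).
Local Notation T := (T Q n).
Local Notation Tw := (Tw Q).
Implicit Types (h g x y : H) (u v w : 'S_n) (p q : nat).

Lemma low_fix p w (k : 'I_n) : w \in parabolic n (low p) -> (p <= k)%N -> w k = k.
Proof.
by move=> /parabolicP /(_ k) E pk; apply: val_inj => /=; move: E; rewrite /low; lia.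
Qed.

Lemma low_lt p w (k : 'I_n) : w \in parabolic n (low p) -> (k < p)%N -> (w k < p)%N.
Proof. by move=> /parabolicP /(_ k); rewrite /low; lia. Qed.

Lemma lowP p w : (forall k : 'I_n, (p <= k)%N -> w k = k) -> w \in parabolic n (low p).
Proof.
move=> Hw; apply/parabolicP=> k; have [kp|/Hw -> //] := ltnP k p.
suff : (w k < p)%N by rewrite /low; lia.
rewrite ltnNge; apply/negP=> pw; have /perm_inj E := Hw _ pw.
by move: pw; rewrite E; lia.
Qed.

Lemma low_sub p w : w \in parabolic n (low p) -> w \in parabolic n (low p.+1).
Proof. by move=> Hw; apply: lowP => k pk; apply: (low_fix Hw); apply: ltnW. Qed.

Lemma supp_lowS p h : supported (low p) h -> supported (low p.+1) h.
Proof. by move=> Hh w Hw; apply: Hh; apply: contra Hw; apply: low_sub. Qed.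

Lemma supp_low_T p i : (0 < i < n)%N -> (i < p)%N -> supported (low p) (T i).
Proof. by move=> Hi ip; apply: supp_T => //; rewrite /low; lia. Qed.

(** Multiplication by s_p lengthens every element of S_p, so there is no term in Q. *)
Lemma low_mulr p h v (a b : 'I_n) : supported (low p) h -> b = p :> nat ->
  b = a.+1 :> nat ->
  (h * T p) v = h (tperm a b * v)%g.
Proof.
move=> Hh Eb Hb; have ap : adj (a, b) by rewrite /adj /= Hb.
have -> : T p = T (a, b).2 by rewrite /= -Eb.
rewrite mul_T_r // ffunE /=; case: ifP => [vba|_]; last by rewrite addr0.
rewrite [h v]Hh ?mulr0 ?addr0 //; apply/negP=> Hv.
have vb : v b = b by apply: (low_fix Hv); rewrite Eb.
have va : (v a < p)%N by apply: (low_lt Hv); rewrite -Eb Hb.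
by move: vba va; rewrite vb Eb; lia.
Qed.

Lemma low_mull p h v (a b : 'I_n) : supported (low p) h -> b = p :> nat ->
  b = a.+1 :> nat ->
  (T p * h) v = h (v * tperm a b)%g.
Proof.
move=> Hh Eb Hb; have ap : adj (a, b) by rewrite /adj /= Hb.
have -> : T p = T (a, b).2 by rewrite /= -Eb.
rewrite mul_T // ffunE /=; case: ifP => [vba|_]; last by rewrite addr0.
rewrite [h v]Hh ?mulr0 ?addr0 //; rewrite -parabolicV; apply/negP=> Hv.
have vb : (v^-1)%g b = b by apply: (low_fix Hv); rewrite Eb.
have va : ((v^-1)%g a < p)%N by apply: (low_lt Hv); rewrite -Eb Hb.
by move: vba va; rewrite vb Eb; lia.
Qed.

(** The orthogonal projection of x, an element of H_(p+1), onto H_p is 1. *)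
Definition mean_one p x := supported (low p.+1) x /\
  forall y, supported (low p) y -> hform x y = y 1%g.

Lemma ord_pair p : (0 < p < n)%N -> exists a b : 'I_n, b = a.+1 :> nat /\ b = p :> nat.
Proof.
by case/(@adjpP n) => -[a b] [/eqP ab Eb _]; exists a, b.
Qed.

Lemma mean_one1 p : mean_one p 1.
Proof. by split=> [|y Hy]; [apply: supp1 | rewrite hform1l]. Qed.

(** For y in H_(p+1) the pairing is that of x T_(p+1) with T_(p+1) y.  If u, v in
    S_(p+1) satisfy u s_(p+1) = s_(p+1) v then u = v lies in S_p, so this is the
    pairing of x with the projection of y onto H_p. *)
Lemma mean_oneS p x : (p.+1 < n)%N -> mean_one p x -> mean_one p.+1 (T p.+1 * x * T p.+1).
Proof.
move=> Hp [Hx Ex]; split.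
  have HT : supported (low p.+2) (T p.+1) by apply: supp_low_T; lia.
  have HM := suppM (@low_mono p.+2).
  by apply: (HM _ _ _ _ _ _ HT); apply: (HM _ _ _ _ _ HT); apply: supp_lowS.
move=> y Hy; have [a [b [ab Eb]]] : exists a b : 'I_n, b = a.+1 :> nat /\ b = p.+1 :> nat.
  by apply: ord_pair; lia.
rewrite -mulrA hform_Tl; last lia.
pose y' : H := [ffun u => if u \in parabolic n (low p) then y u else 0].
have Hy' : supported (low p) y' by move=> w /negbTE Hw; rewrite ffunE Hw.
transitivity (hform x y'); last by rewrite Ex // ffunE parabolic1.
rewrite /hform (reindex_inj (mulgI (tperm a b))); apply: eq_bigr => u _.
rewrite (low_mulr _ Hx Eb ab) mulgA tperm2 mul1g (low_mull _ Hy Eb ab) ffunE.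
case: (boolP (u \in parabolic n (low p))) => Hu.
  congr (_ * y _); have ua : u a = a by apply: (low_fix Hu); rewrite -ltnS -Eb /= ab.
  have ub : u b = b by apply: (low_fix Hu); rewrite -[p]/(p.+1.-1) -Eb leq_pred.
  rewrite -{2}[u]mulg1 -(tperm2 a b) [RHS]mulgA; congr (_ * _)%g.
  apply/permP=> k; rewrite !permM; case: (tpermP a b k) => [->|->|/eqP ka /eqP kb].
  - by rewrite ua ub tpermL.
  - by rewrite ua ub tpermR.
  have Na : a != u k by rewrite -{1}ua (inj_eq perm_inj) eq_sym.
  have Nb : b != u k by rewrite -{1}ub (inj_eq perm_inj) eq_sym.
  by rewrite tpermD.
case: (boolP (u \in parabolic n (low p.+1))) => Hu1; last by rewrite Hx ?mul0r.
rewrite Hy ?mulr0 //; apply/negP=> Hs; case/negP: Hu; apply: lowP => k pk.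
move: pk; rewrite leq_eqVlt => /orP[/eqP Ek|]; last exact: low_fix.
have -> : k = a by apply: val_inj => /=; move: Eb; rewrite /= ab; lia.
have := low_fix Hs (k := b); rewrite -Eb leqnn => /(_ isT).
rewrite !permM tpermR => Ea; rewrite -[u a](tpermK a b) Ea tpermR //.
Qed.

(** By the quadratic relation the left factor is Q T x T + T x, and T x is supported
    outside S_(p+1). *)
Lemma hform_TxTT p x y : (p.+1 < n)%N -> mean_one p x -> supported (low p.+1) y ->
  hform (T p.+1 * x * T p.+1 * T p.+1) y = Q * y 1%g.
Proof.
move=> Hp Cx Hy; have [_ Ex] := mean_oneS Hp Cx; have [Hx _] := Cx.
rewrite -mulrA T_sqr; last lia.
rewrite mulrDr mulr1 -scalerAr hform_addl hform_scalel Ex // (_ : hform (T p.+1 * x) y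
  = 0) ?addr0 //.
have [a [b [ab Eb]]] : exists a b : 'I_n, b = a.+1 :> nat /\ b = p.+1 :> nat.
  by apply: ord_pair; lia.
apply: (hform_orth (D := fun w => w \notin parabolic n (low p.+1))) => w.
  rewrite negbK => Hw; rewrite (low_mull _ Hx Eb ab) Hx // parabolicMl //.
  apply/negP=> Hs; have := low_fix Hs (k := b).
  by rewrite Eb leqnn tpermR => /(_ isT)/(congr1 val) /=; lia.
exact: Hy.
Qed.

(** First half of the Markov property: a factor whose generator does not occur in the
    other argument contributes 1 + z. *)
Lemma hform_xi_out p h g x (z : R) : mean_one p x -> supported (low p) h ->
  supported (low p) g ->
  hform (h * (1 + z *: x)) g = (1 + z) * hform h g.
Proof.
move=> [_ Ex] Hh Hg; rewrite mulrDr mulr1 -scalerAr hform_addl hform_scalel.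
rewrite hform_ml Ex; last by apply: (suppM (@low_mono p)) => //; apply: supp_star.
have -> : (star h * g) 1%g = hform h g by rewrite -[LHS]hform1l -hform_ml mulr1.
by rewrite mulrDl mul1r.
Qed.

Lemma starK h : star (star h) = h.
Proof. by apply/ffunP=> w; rewrite !ffunE invgK. Qed.

(** Second half of the Markov property: if the last generator occurs, the factor
    contributes z Q. *)
Lemma hform_xi_in p h x (z : R) : (p.+1 < n)%N -> mean_one p x ->
  supported (low p.+1) h ->
  hform (h * (1 + z *: (T p.+1 * x * T p.+1))) (T p.+1) = z * Q * h 1%g.
Proof.
move=> Hp Cx Hh; rewrite mulrDr mulr1 -scalerAr hform_addl hform_scalel.
rewrite hform_ml -hform_Tr; last lia.
rewrite hform_TxTT //; last exact: supp_star.
rewrite ffunE invg1 (_ : hform h (T p.+1) = 0) ?add0r ?mulrA //.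
rewrite hformC hform_Twl Hh //.
have [a [b [ab Eb]]] : exists a b : 'I_n, b = a.+1 :> nat /\ b = p.+1 :> nat.
  by apply: ord_pair; lia.
have ap : adj (a, b) by rewrite /adj /= ab.
rewrite -Eb (adjp_adj ap); apply/negP=> Hs; have := low_fix Hs (k := b).
by rewrite Eb leqnn tpermR => /(_ isT)/(congr1 val) /=; lia.
Qed.

Lemma hform_wordr s h g : all (fun i => 0 < i < n)%N s ->
  hform h (g * \prod_(i <- s) T i) = hform (h * \prod_(i <- rev s) T i) g.
Proof.
elim: s g h => [|i s IH] g h /=; first by rewrite !big_nil !mulr1.
case/andP=> Hi Hs; rewrite big_cons rev_cons -cats1 big_cat big_seq1 !mulrA.
by rewrite IH // -hform_Tr.
Qed.

End Local.

(** * Markov property of the product of the factors 1 + z xi *)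

Section Blocks.
Variables (R : comNzRingType) (Q : R) (n : nat) (f c : nat -> nat) (z : nat -> R).
Hypothesis f_mono : {homo f : x y / (x <= y)%N}.
Hypothesis start_spec : forall i q, (i <= q)%N -> (q < n)%N ->
  (f i == f q) = (c q <= i)%N.
Local Notation H := (hecke Q n).
Local Notation T := (T Q n).
Local Notation Tw := (Tw Q).
Implicit Types (h g x y : H) (u v w : 'S_n) (p q : nat).

Lemma start_le q : (q < n)%N -> (c q <= q)%N.
Proof. by move=> Hq; rewrite -start_spec ?eqxx. Qed.

(** For q in a block of f, the number c q is the first position of this block; so q is
    inner if and only if T_q belongs to the parabolic subalgebra. *)
Definition inner_index q := (c q < q)%N.

Lemma inner_indexE q : (0 < q < n)%N -> inner_index q = (f q.-1 == f q).
Proof. by move=> Hq; rewrite start_spec ?leq_pred /inner_index; lia. Qed.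

Lemma segment_label q i : (q < n)%N -> (c q < i <= q)%N -> f i.-1 = f i.
Proof.
move=> Hq Hi; have /eqP -> : f i == f q by rewrite start_spec; lia.
by apply/eqP; rewrite start_spec; lia.
Qed.

Definition shifted_T q i : H := T (c q + i).

(** The factors of E_J and of E^xi_J are indexed by the inner positions, the other
    positions getting the factor 1.  This turns E_J and E^xi_J into products over an
    interval of positions, which can be peeled off one position at a time. *)
Definition E_factor q : H :=
  if inner_index q then 1 + z (f q) *: tdown (shifted_T q) (q - c q) else 1.
Definition Exi_factor q : H :=
  if inner_index q then 1 + z (f q) *: xi (shifted_T q) (q - c q).+1 else 1.

Lemma supp_shifted_T F q i : {homo F : x y / (x <= y)%N} ->
  (forall j, (c q < j <= q)%N -> F j.-1 = F j) ->
  (q < n)%N -> (0 < i <= q - c q)%N -> supported F (shifted_T q i).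
Proof. by move=> Fm HF Hq Hi; apply: supp_T; [lia | apply: HF; lia]. Qed.

Lemma supp_factor F q : {homo F : x y / (x <= y)%N} ->
    (forall j, (c q < j <= q)%N -> F j.-1 = F j) -> (q < n)%N ->
  supported F (E_factor q) /\ supported F (Exi_factor q).
Proof.
move=> Fm HF Hq; rewrite /E_factor /Exi_factor; case: ifP => Iq; last by split;
  apply: supp1.
have S i : i \in iota 1 (q - c q) -> supported F (shifted_T q i).
  by rewrite mem_iota => Hi; apply: supp_shifted_T => //; lia.
split; (apply: suppD; first exact: supp1); apply: suppZ.
  by rewrite /tdown big_seq; apply: supp_prod => // i; rewrite mem_rev; apply: S.
apply: suppM => //; rewrite /tdown /tup big_seq; apply: supp_prod => // i.
by rewrite mem_rev; apply: S.
Qed.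

Lemma supp_factor_label q : (q < n)%N ->
  supported f (E_factor q) /\ supported f (Exi_factor q).
Proof. by move=> Hq; apply: supp_factor => // j /(segment_label Hq). Qed.

Lemma supp_factor_low p q : (q < p)%N -> (q < n)%N ->
  supported (low p) (E_factor q) /\ supported (low p) (Exi_factor q).
Proof. by move=> qp Hq; apply: supp_factor => // [|j Hj];
  [exact: low_mono | rewrite /low; lia]. Qed.

Definition E_prefix p : H := \prod_(1 <= q < p) E_factor q.
Definition Exi_prefix p : H := \prod_(1 <= q < p) Exi_factor q.

Lemma supp_E F p : {homo F : x y / (x <= y)%N} -> (p <= n)%N ->
    (forall q, (q < p)%N -> supported F (E_factor q) /\ supported F (Exi_factor q)) ->
  supported F (E_prefix p) /\ supported F (Exi_prefix p).
Proof.
move=> Fm Hp HF; rewrite /E_prefix /Exi_prefix !big_nat.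
by split; apply: supp_prod => // q /andP[_ Hq]; have [] := HF q Hq.
Qed.

Lemma supp_E_label p : (p <= n)%N ->
  supported f (E_prefix p) /\ supported f (Exi_prefix p).
Proof.
by move=> Hp; apply: supp_E => // q Hq; apply: supp_factor_label; apply: leq_trans Hp.
Qed.

Lemma supp_E_low p : (p <= n)%N ->
  supported (low p) (E_prefix p) /\ supported (low p) (Exi_prefix p).
Proof.
move=> Hp; apply: supp_E => // [|q Hq]; first exact: low_mono.
by apply: supp_factor_low => //; apply: leq_trans Hp.
Qed.

Lemma mean_one_xi q k : (c q + k < n)%N -> mean_one (c q + k) (xi (shifted_T q) k.+1).
Proof.
elim: k => [|k IH] Hk; first by rewrite xi1; apply: mean_one1.
rewrite addnS in Hk *; rewrite xiS -[shifted_T q k.+1]/(T (c q + k.+1)) addnS.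
by apply: mean_oneS => //; apply: IH; apply: ltnW.
Qed.

(** Either s lies in the block of q, or the block of s ends before that of q, and then
    T_s commutes with all the generators occurring in the Jucys-Murphy element. *)
Lemma comm_xi_inner q s : (q < n)%N -> (0 < s < q)%N -> inner_index s ->
  GRing.comm (T s) (xi (shifted_T q) (q - c q).+1).
Proof.
move=> Hq Hs Is; have [sc|cs] := leqP s (c q).
  have sc' : (s < c q)%N.
    rewrite ltn_neqAle sc andbT; apply/eqP => E.
    have := inner_indexE (q := s); rewrite Is => /(_ _)/esym/eqP E1.
    have Eq : f s = f q by apply/eqP; rewrite start_spec; lia.
    have : f s.-1 == f q by rewrite E1 ?Eq //; lia.
    by rewrite start_spec; lia.
  by apply: comm_xi => i Hi; apply: T_comm; lia.
have -> : T s = shifted_T q (s - c q) by rewrite /shifted_T subnKC // ltnW.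
apply: (xi_comm (m := q - c q)); last by lia.
- by move=> i j Hi Hij Hj; apply: T_comm; lia.
- by move=> i Hi Him; rewrite /shifted_T addnS; apply: T_braid; lia.
by lia.
Qed.

(** The pairing of E^xi with a product of distinct generators, in any order.  Peel off
    the last factor.  If its generator T_p occurs in the word, the letters on both
    sides of T_p are moved to the other argument by adjunction; those on the right of
    T_p commute with the Jucys-Murphy element, so that the Markov property applies. *)
Lemma hform_Exi_word p s : (p <= n)%N -> uniq s ->
    all (fun i => (0 < i < p)%N && inner_index i) s ->
  hform (Exi_prefix p) (\prod_(i <- s) T i) = \prod_(1 <= q < p)
    (if inner_index q then (if q \in s then z (f q) * Q else 1 + z (f q)) else 1).
Proof.
elim: p s => [|p IH] s Hp Us As.
  case: s Us As => [|i s] _; last by rewrite /= ltn0 andbF.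
  by rewrite /Exi_prefix !big_nil hform1l ffunE eqxx.
have [p0|p_gt0] := posnP p.
  case: s Us As => [|i s] _; last by rewrite /= p0; case: i.
  by rewrite /Exi_prefix p0 !big_nil hform1l ffunE eqxx.
rewrite /Exi_prefix !big_nat_recr //= -/(Exi_prefix p).
have Hpn : (p <= n)%N by exact: ltnW.
have in_s i : i \in s -> (0 < i < p.+1)%N && inner_index i by move/(allP As).
have word_low s' : {subset s' <= s} -> p \notin s' ->
    supported (low p) (\prod_(i <- s') T i).
  move=> ss Ns; rewrite big_seq; apply: supp_prod => [|i Hi]; first exact: low_mono.
  have Hip : i != p by apply: contra Ns => /eqP <-.
  by have := in_s i (ss _ Hi) => /andP[Hi' _]; apply: supp_low_T; lia.
have [_ SE] := supp_E_low Hpn.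
case: (boolP (p \in s)) => ps; last first.
  have As' : all (fun i => (0 < i < p)%N && inner_index i) s.
    apply/allP=> i Hi; have /andP[Hi' ->] := in_s _ Hi; rewrite andbT.
    have : i != p by apply: contra ps => /eqP <-.
    by lia.
  rewrite {1}/Exi_factor; case: ifP => Ip; last by rewrite !mulr1; apply: IH.
  rewrite (@hform_xi_out _ _ _ p) //; last 2 first.
  - by have := @mean_one_xi p (p - c p); rewrite subnKC ?start_le //; apply.
  - exact: word_low.
  by rewrite IH // mulrC.
have /andP[_ Ip] := in_s _ ps; rewrite Ip /Exi_factor Ip.
case/splitPr: ps Us As in_s word_low => s1 s2 Us As in_s word_low.
have [Us' N1 N2] : [/\ uniq (s1 ++ s2), p \notin s1 & p \notin s2].
  move: Us; rewrite -cat1s uniq_catCA cat_uniq has_cat negb_or /= => /andP[/andP[A B] ->].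
  by move: A B => /hasPn A /hasPn B; split=> //; apply/negP; [move=> /A | move=> /B];
    rewrite inE eqxx.
have As' : all (fun i => (0 < i < p)%N && inner_index i) (s1 ++ s2).
  apply/allP=> i Hi; have Hi2 : i \in s1 ++ p :: s2.
    by move: Hi; rewrite !mem_cat inE => /orP[] ->; rewrite ?orbT.
  have /andP[Hi' ->] := in_s _ Hi2; rewrite andbT.
  have : i != p by apply/eqP=> E; move: Hi; rewrite E mem_cat (negbTE N1) (negbTE N2).
  by lia.
rewrite big_cat big_cons /= mulrA.
have rng : all (fun i => 0 < i < n)%N s2.
  apply/allP=> i Hi; have : i \in s1 ++ s2 by rewrite mem_cat Hi orbT.
  by move/(allP As'); lia.
have sub1 : {subset s1 <= s1 ++ p :: s2} by move=> i Hi; rewrite mem_cat Hi.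
have sub2 : {subset s2 <= s1 ++ p :: s2} by move=> i Hi; rewrite mem_cat inE Hi !orbT.
set x := xi _ _; set X := \prod_(i <- s1) _; set E := Exi_prefix p.
rewrite hform_wordr //; set Y := \prod_(i <- rev s2) _.
have SX : supported (low p) X by apply: word_low.
have SY : supported (low p) Y.
  by apply: word_low; rewrite ?mem_rev // => i; rewrite mem_rev; apply: sub2.
have CY : Y * (1 + z (f p) *: x) = (1 + z (f p) *: x) * Y.
  apply/esym/commr_sym; rewrite /GRing.comm mulrDr mulrDl mulr1 mul1r.
  rewrite -scalerAl -scalerAr; congr (_ + _ *: _); apply/commr_sym.
  rewrite /Y big_seq; apply: commr_prod => i; rewrite mem_rev => Hi.
  have : i \in s1 ++ s2 by rewrite mem_cat Hi orbT.
  by move/(allP As')=> /andP[Hi' Ii]; apply/commr_sym/comm_xi_inner.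
(* By adjunction the second argument becomes T_p alone. *)
rewrite -mulrA -CY mulrA -[X]starK -hform_ml mulrA.
have xE : exists x', mean_one p.-1 x' /\ x = T p.-1.+1 * x' * T p.-1.+1.
  have [k Ek] : exists k, (p - c p = k.+1)%N.
    by exists (p - c p).-1; move: Ip; rewrite /inner_index; lia.
  have Ep : (c p + k.+1 = p)%N by move: Ip; rewrite /inner_index; lia.
  exists (xi (shifted_T p) k.+1);
    rewrite /x Ek xiS prednK // -[shifted_T p k.+1]/(T (c p + k.+1)) Ep.
  by split=> //; rewrite -[p in p.-1]Ep addnS; apply: mean_one_xi; lia.
case: xE => x' [Cx' ->]; have -> : T p = T p.-1.+1 by rewrite prednK.
rewrite hform_xi_in ?prednK //; last first.
  by do 2?[apply: (suppM (@low_mono p))] => //; apply: supp_star.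
(* Undo the adjunctions, the letter T_p being gone. *)
rewrite mulrC; congr (_ * _); rewrite -hform1l hformC hform_ml starK mulr1.
rewrite -hform_wordr // -big_cat IH //; apply: eq_big_nat => q Hq.
by rewrite !mem_cat inE (_ : q == p = false) //; lia.
Qed.

End Blocks.

(** * Left descents of the permutations occurring in E_J *)

Section Descents.
Variables (n : nat).
Implicit Types (v w : 'S_n) (S : pred nat).

Definition descends_at S v := [forall a : 'I_n, forall b : 'I_n,
  (b == a.+1 :> nat) && S b ==> ((v^-1)%g b < (v^-1)%g a)%N].

Lemma descends_atP S v : reflect
  (forall a b : 'I_n, b = a.+1 :> nat -> S b -> ((v^-1)%g b < (v^-1)%g a)%N)
  (descends_at S v).
Proof.
apply: (iffP forallP) => [H a b ab Sb|H a].
  by have /forallP/(_ b) := H a; rewrite ab eqxx -ab Sb.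
by apply/forallP=> b; apply/implyP=> /andP[/eqP ab Sb]; apply: H.
Qed.

End Descents.

Section DescentForm.
Variables (R : comNzRingType) (Q : R) (n : nat) (f c : nat -> nat) (z : nat -> R).
Hypothesis f_mono : {homo f : x y / (x <= y)%N}.
Hypothesis start_spec : forall i q, (i <= q)%N -> (q < n)%N ->
  (f i == f q) = (c q <= i)%N.
Local Notation H := (hecke Q n).
Local Notation T := (T Q n).
Local Notation Tw := (Tw Q).
Implicit Types (h g x y : H) (u v w : 'S_n) (p q : nat) (S : pred nat).

(** Each generator moves the value p one step to the left, past a smaller value, so
    every step is length increasing; the smaller values keep their relative order. *)
Lemma Tw_mul_down v p j (b : 'I_n) : b = p :> nat -> (j <= p)%N ->
  v \in parabolic n (low p) -> exists v',
    [/\ Tw v * \prod_(i <- rev (iota (p - j).+1 j)) T i = Tw v',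
        (v'^-1)%g b = (p - j)%N :> nat
      & forall k : 'I_n, (k < p)%N -> (v'^-1)%g k = bump (p - j) ((v^-1)%g k) :> nat].
Proof.
move=> Eb jp Hv; have HvV : (v^-1)%g \in parabolic n (low p) by rewrite parabolicV.
elim: j jp => [|j IH] jp.
  exists v; rewrite big_nil mulr1 subn0; split=> // [|k kp].
    by rewrite (low_fix HvV) ?Eb.
  by have := low_lt HvV kp; rewrite /bump; lia.
have [v' [Ev vb vk]] := IH (ltnW jp).
have Ej : (p - j = (p - j.+1).+1)%N by lia.
rewrite /= rev_cons -cats1 big_cat /= big_seq1 mulrA -Ej Ev.
have [a [d [ad Ed]]] : exists a d : 'I_n, d = a.+1 :> nat /\ d = (p - j)%N :> nat.
  by apply: ord_pair; have := ltn_ord b; lia.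
have Ea : a = (p - j.+1)%N :> nat by lia.
have ap : adj (a, d) by rewrite /adj /= ad.
exists (tperm a d * v')%g; have -> : T (p - j) = T (a, d).2 by rewrite -Ed.
have v'd : v' d = b by rewrite -[b](permKV v'); congr (v' _); apply: val_inj;
  rewrite /= vb.
have Lva : (v a < p)%N by apply: (low_lt Hv); rewrite Ea; lia.
have v'a : v' a = v a.
  rewrite -[RHS](permKV v'); congr (v' _); apply: val_inj => /=.
  by rewrite vk // permK /bump Ej Ea; lia.
split.
- by rewrite mul_T_r // rmulT /= v'd v'a Eb ltnNge (ltnW Lva) addr0.
- by rewrite invMg tpermV permM (_ : (v'^-1)%g b = d) ?tpermR //; apply: val_inj;
  rewrite /= vb.
move=> k kp; rewrite invMg tpermV permM; have E := vk k kp.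
have Nd : (v'^-1)%g k != d.
  by apply/eqP=> E1; have := permKV v' k; rewrite E1 v'd => E2; move: kp;
    rewrite -E2 Eb ltnn.
have [E1|Na] := eqVneq ((v'^-1)%g k) a.
  by rewrite E1 tpermL; move: E; rewrite E1 Ed Ea /bump; lia.
rewrite tpermD 1?eq_sym //; move: E Na Nd; rewrite -!(inj_eq val_inj) /= Ed Ea /bump.
by move: ((v'^-1)%g k) ((v^-1)%g k) => [y ?] [x ?] /=; lia.
Qed.

(** With S the set of repeats of a block decreasing w, this is the linear form on H(S_J)
    given by the pairing of T_w h with L[K]. *)
Definition descent_form S h := \sum_(v : 'S_n) h v * (descends_at S v)%:R.

Lemma descent_formD S h g : descent_form S (h + g) = descent_form S h + descent_form S g.
Proof. by rewrite /descent_form -big_split; apply: eq_bigr => w _;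
  rewrite ffunE mulrDl. Qed.

Lemma descent_formZ S (a : R) h : descent_form S (a *: h) = a * descent_form S h.
Proof. by rewrite /descent_form mulr_sumr; apply: eq_bigr => w _;
  rewrite hscaleE mulrA. Qed.

Lemma descent_form_sum S (I : Type) (r : seq I) (P : pred I) (F : I -> H) :
  descent_form S (\sum_(i <- r | P i) F i) = \sum_(i <- r | P i) descent_form S (F i).
Proof.
elim/big_rec2: _ => [|i a b _ <-]; rewrite ?descent_formD //.
by rewrite /descent_form big1 // => w _; rewrite ffunE mul0r.
Qed.

Lemma descent_form_Tw S v : descent_form S (Tw v) = (descends_at S v)%:R.
Proof.
rewrite /descent_form (bigD1 v) //= ffunE eqxx mul1r big1 ?addr0 // => w.
by rewrite ffunE => /negbTE ->; rewrite mul0r.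
Qed.

Definition below S p : pred nat := fun i => S i && (i < p)%N.

Lemma supported_expand2 F G h : supported F h -> supported G h ->
  h = \sum_(v | (v \in parabolic n F) && (v \in parabolic n G)) h v *: Tw v.
Proof.
move=> HF HG; rewrite {1}[h]hexpand (bigID (fun v =>
  (v \in parabolic n F) && (v \in parabolic n G))) /=.
rewrite [X in _ + X]big1 ?addr0 // => v; rewrite negb_and.
by case/orP=> [/HF|/HG] ->; rewrite scale0r.
Qed.

(** For v in S_p the value p stands to the right of p - 1 in v, whereas multiplication by
    T_p ... T_(c+1) moves it to the beginning of its block, to the left of p - 1, without
    changing the other left descents.  So the first term of 1 + z T_p ... T_(c+1)
    contributes if and only if p is not required to be a descent, and the second
    always. *)
Lemma descent_form_step S p h : (0 < p < n)%N -> inner_index c p ->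
  supported (low p) h -> supported f h ->
  descent_form (below S p.+1) (h * (1 + z (f p) *: tdown (shifted_T Q n c p) (p - c p)))
  = (if S p then z (f p) else 1 + z (f p)) * descent_form (below S p) h.
Proof.
move=> Hp Ip Hl Hf; rewrite (supported_expand2 Hl Hf) mulr_suml !descent_form_sum
  mulr_sumr.
apply: eq_bigr => v /andP[Vl Vf]; rewrite -scalerAl !descent_formZ mulrCA; congr (_ * _).
have [a [b [ab Eb]]] : exists a b : 'I_n, b = a.+1 :> nat /\
  b = p :> nat by apply: ord_pair.
have [|v' [Ev vb vk]] := @Tw_mul_down v p (p - c p) b Eb _ Vl; first exact: leq_subr.
have Ec : (p - (p - c p) = c p)%N by move: Ip; rewrite /inner_index; lia.
rewrite Ec in Ev vb vk.
have -> : Tw v * (1 + z (f p) *: tdown (shifted_T Q n c p) (p - c p))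
  = Tw v + z (f p) *: Tw v'.
  rewrite mulrDr mulr1 -scalerAr -Ev; congr (_ + _ *: (_ * _)); rewrite /tdown.
  have -> : iota (c p).+1 (p - c p) = [seq (c p + i)%N | i <- iota 1 (p - c p)].
    by rewrite -iotaDl addn1.
  by rewrite -map_rev big_map.
rewrite descent_formD descent_formZ !descent_form_Tw.
have VlV : (v^-1)%g \in parabolic n (low p) by rewrite parabolicV.
have VfV : (v^-1)%g \in parabolic n f by rewrite parabolicV.
have Ev' : descends_at (below S p.+1) v' = descends_at (below S p) v.
  apply/descends_atP/descends_atP => Hd x y xy /andP[Sy yp].
    have := Hd x y xy; rewrite /below Sy ltnW // => /(_ isT).
    by rewrite !vk // ?ltnNge ?leq_bump2 //; lia.
  move: yp; rewrite ltnS leq_eqVlt => /orP[/eqP yp|yp].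
    have -> : y = b by apply: val_inj; rewrite /= yp Eb.
    have Ex : x = a by apply: val_inj => /=; lia.
    rewrite vb Ex vk; last by rewrite -Eb ab.
    have /parabolicP/(_ a) fa := VfV.
    have := @start_spec a p; have := @start_spec ((v^-1)%g a) p;
      have := low_lt VlV (k := a).
    rewrite fa; have -> : (a <= p)%N by rewrite -Eb ab.
    have -> : (a < p)%N by rewrite -Eb ab.
    move=> /(_ isT) L1; rewrite (ltnW L1); have /andP[_ ->] := Hp.
    move=> /(_ isT isT) -> /(_ isT isT); move: Ip; rewrite /inner_index /bump; lia.
  have := Hd x y xy; rewrite /below Sy yp => /(_ isT).
  by rewrite !vk // ?ltnNge ?leq_bump2 //; lia.
have E : descends_at (below S p.+1) v = ~~ S p && descends_at (below S p) v.
  apply/descends_atP/andP => [Hd|[NS /descends_atP Hd] x y xy /andP[Sy yp]].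
    split.
      apply/negP=> Sp; have := Hd a b ab; rewrite /below Eb Sp ltnSn => /(_ isT).
      by rewrite (low_fix VlV) ?Eb // ltnNge ltnW // (low_lt VlV) // -Eb ab.
    apply/descends_atP=> x y xy /andP[Sy yp]; apply: Hd => //.
    by rewrite /below Sy ltnW.
  apply: Hd => //; rewrite /below Sy; move: yp; rewrite ltnS leq_eqVlt.
  by case/orP=> // /eqP yp; rewrite -yp Sy in NS.
by rewrite E Ev'; case: (S p) => /=; case: (descends_at _ v);
  rewrite /= ?mulr0 ?mulr1 ?add0r ?addr0.
Qed.

Lemma descent_form_E S p : (forall q, S q -> inner_index c q) -> (p <= n)%N ->
  descent_form (below S p) (E_prefix Q n f c z p) = \prod_(1 <= q < p)
    (if inner_index c q then (if S q then z (f q) else 1 + z (f q)) else 1).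
Proof.
move=> SI; elim: p => [|p IH] Hp; last have [p0|p_gt0] := posnP p.
- rewrite /E_prefix !big_nil -[1]/(Tw 1) descent_form_Tw;
  case: descends_atP => // -[] a b ab.
  by rewrite /below ltn0 andbF.
- rewrite /E_prefix p0 !big_nil -[1]/(Tw 1) descent_form_Tw;
  case: descends_atP => // -[] a b ab.
  by rewrite /below ab andbF.
rewrite /E_prefix !big_nat_recr //= -/(E_prefix Q n f c z p) -IH; last exact: ltnW.
have [SA _] := supp_E_label Q z f_mono start_spec (ltnW Hp).
have [SL _] := supp_E_low Q f c z (ltnW Hp).
rewrite {1}/E_factor; case: ifP => Ip.
  by rewrite descent_form_step // ?p_gt0 // mulrC.
rewrite !mulr1 /descent_form; apply: eq_bigr => v _; congr (_ * (nat_of_bool _)%:R).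
apply/descends_atP/descends_atP => Hd x y xy /andP[Sy yp]; apply: Hd => //;
  rewrite /below Sy.
  exact: ltnW.
move: yp; rewrite ltnS leq_eqVlt => /orP[/eqP yp|//].
by have := SI _ Sy; rewrite yp Ip.
Qed.

End DescentForm.

(** * The word of a coset representative *)

Section Words.
Variables (n : nat) (f g : nat -> nat).
Hypothesis f_mono : {homo f : x y / (x <= y)%N}.
Hypothesis g_mono : {homo g : x y / (x <= y)%N}.
Implicit Types (u v w : 'S_n) (a b : 'I_n).

(** The word of w.  For w increasing on the levels of f it determines w (letter_inj). *)
Definition letter w b : nat := f ((w^-1)%g b).

Definition block_decreasing w := [forall a : 'I_n, forall b : 'I_n,
  (b == a.+1 :> nat) && (g a == g b) ==> (letter w b <= letter w a)%N].

(** If w increases on the levels of f and g numbers the blocks of K, these are the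
    positions q such that some generator of zeta_K acts on T_w as the right
    multiplication by T_q. *)
Definition repeat_at w (q : nat) := [exists a : 'I_n, exists b : 'I_n,
  [&& b == a.+1 :> nat, g a == g b, letter w a == letter w b & (w^-1)%g b == q :> nat]].

Lemma block_decreasingP w : reflect
  (forall a b, b = a.+1 :> nat -> g a = g b ->
    (letter w b <= letter w a)%N) (block_decreasing w).
Proof.
apply: (iffP forallP) => [H a b ab E|H a].
  by have /forallP/(_ b) := H a; rewrite E ab !eqxx.
by apply/forallP=> b; apply/implyP=> /andP[/eqP ab /eqP E]; apply: H.
Qed.

Lemma repeat_atP w q : reflect (exists a b, [/\ b = a.+1 :> nat, g a = g b,
  letter w a = letter w b & (w^-1)%g b = q :> nat]) (repeat_at w q).
Proof.
apply: (iffP existsP) => [[a /existsP[b /and4P[/eqP ? /eqP ? /eqP ? /eqP ?]]]|].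
  by exists a, b.
case=> a [b [ab gab letter_ab E]]; exists a; apply/existsP; exists b.
by rewrite gab letter_ab E ab !eqxx.
Qed.

(** A position strictly between those of a and b would lie in the same block, hence carry
    a value strictly between a and b. *)
Lemma level_asc_adj w a b : level_asc f w -> b = a.+1 :> nat -> letter w a = letter w b ->
  (w^-1)%g b = ((w^-1)%g a).+1 :> nat.
Proof.
move=> Aw ab; rewrite /letter; set x := (w^-1)%g a; set y := (w^-1)%g b => E.
have wx : w x = a by rewrite permKV.
have wy : w y = b by rewrite permKV.
have xy : (x < y)%N.
  case: (ltngtP x y) => // [yx|/val_inj xy].
    by have := Aw _ _ yx (esym E); rewrite wx wy ab; lia.
  by move: ab; rewrite -wx -wy xy; lia.
apply/eqP; rewrite eqn_leq xy andbT leqNgt; apply/negP=> lt.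
pose k := Ordinal (leq_trans lt (ltnW (ltn_ord y))).
have xk : (f x <= f k)%N by apply: f_mono => /=.
have ky : (f k <= f y)%N by apply: f_mono => /=; rewrite ltnW.
have Ek : f x = f k by apply/eqP; rewrite eqn_leq xk E.
have := Aw x k; have := Aw k y; rewrite /= lt ltnSn wx wy -Ek E ab.
by move=> /(_ isT erefl) A1 /(_ isT erefl); lia.
Qed.

(** In w v the positions of two consecutive values of a block of g are compared by their
    letters, unless these are equal; then the two positions in w are consecutive and v
    decides. *)
Lemma level_dsc_mul w v : level_asc f w -> v \in parabolic n f ->
  level_dsc g ((v * w)^-1)%g <-> block_decreasing w /\ descends_at (repeat_at w) v.
Proof.
move=> Aw; rewrite -parabolicV invMg => /parabolicP Hv;
  split=> [Hd|[/block_decreasingP Ho /descends_atP Hd]].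
  split.
    apply/block_decreasingP=> a b ab E;
      rewrite /letter -[f ((w^-1)%g b)]Hv -[f ((w^-1)%g a)]Hv f_mono //.
    have lt_ab : (a < b)%N by rewrite ab.
    by apply: ltnW; have := Hd a b lt_ab E; rewrite !permM.
  apply/descends_atP=> x y xy /repeat_atP[a [b [ab gab letter_ab Ey]]].
  have Ey' : y = (w^-1)%g b by apply: val_inj.
  have Ex : x = (w^-1)%g a.
    by apply: val_inj => /=; have := level_asc_adj Aw ab letter_ab; rewrite Ey xy => -[].
  have lt_ab : (a < b)%N by rewrite ab.
  by have := Hd a b lt_ab gab; rewrite !permM -Ex -Ey'.
apply: (level_chain g_mono (r := fun x y => (y < x)%N)) => [x y z'|a b ab E /=].
  by move=> yx xz; apply: ltn_trans xz yx.
rewrite !permM; have := Ho a b ab E; rewrite leq_eqVlt => /orP[/eqP Eab|lt].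
  apply: Hd; first exact: level_asc_adj.
  by apply/repeat_atP; exists a, b.
by apply: (label_lt f_mono); rewrite !Hv.
Qed.

Lemma level_asc_swap w a b : b = a.+1 :> nat -> level_asc f w ->
  letter w a != letter w b ->
  level_asc f (w * tperm a b).
Proof.
move=> ab Aw N x y xy E; rewrite !permM; apply: adj_lt => //; last exact: Aw.
apply/eqP=> -[Ex Ey]; case/eqP: N; rewrite /letter -Ex -Ey !permK.
exact: E.
Qed.

End Words.

(** * Contribution of one coset representative *)

Section Sums.
Variables (R : comNzRingType) (Q : R) (n : nat) (f c g : nat -> nat) (z : nat -> R).
Hypothesis f_mono : {homo f : x y / (x <= y)%N}.
Hypothesis g_mono : {homo g : x y / (x <= y)%N}.
Hypothesis start_spec : forall i q, (i <= q)%N -> (q < n)%N ->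
  (f i == f q) = (c q <= i)%N.
Local Notation H := (hecke Q n).
Local Notation T := (T Q n).
Local Notation Tw := (Tw Q).
Implicit Types (h x y : H) (u v w : 'S_n) (a b : 'I_n).

Lemma repeat_at_inner w q : level_asc f w -> repeat_at f g w q -> inner_index c q.
Proof.
move=> Aw /repeat_atP[a [b [ab gab letter_ab <-]]];
  have E := level_asc_adj f_mono Aw ab letter_ab.
have Hq : (0 < (w^-1)%g b < n)%N by rewrite ltn_ord E.
by rewrite (inner_indexE start_spec Hq) {1}E; apply/eqP.
Qed.

Lemma hform_E_coset w (L : H) :
  level_asc f w -> (forall v, v \in parabolic n f ->
    L (v * w)%g = (block_decreasing f g w && descends_at (repeat_at f g w) v)%:R) ->
  hform (Tw w * E_prefix Q n f c z n) L
    = if block_decreasing f g w then \prod_(1 <= q < n)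
    (if inner_index c q then (if repeat_at f g w q then z (f q) else 1 + z (f q)) else
      1) else 0.
Proof.
move=> Aw HL; have [SE _] := supp_E_label Q z f_mono start_spec (leqnn n).
rewrite (Tw_asc_expand f_mono Aw SE) hform_suml.
rewrite (eq_bigr (fun v => E_prefix Q n f c z n v * (block_decreasing f g w &&
  descends_at (repeat_at f g w) v)%:R)); last first.
  by move=> v Hv; rewrite hform_scalel hform_Twl HL.
case: ifP => Hok; last by rewrite big1 // => v _; rewrite mulr0.
rewrite -(descent_form_E Q z f_mono start_spec) //; last by move=> q;
  apply: repeat_at_inner.
rewrite /descent_form [RHS](bigID (mem (parabolic n f))) /= [X in _
  = _ + X]big1 ?addr0; last first.
  by move=> v Hv; rewrite SE ?mul0r.
apply: eq_bigr => v _; congr (_ * (nat_of_bool _)%:R).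
apply/descends_atP/descends_atP => Hd x y xy; last by move=> Sy; apply: Hd;
  rewrite // /below Sy ltn_ord.
by case/andP=> Sy _; apply: Hd.
Qed.

Definition letter_supp a (l : nat) h := forall u, h u != 0 -> letter f u a = l.

Lemma letter_supp_T a l j h : (0 < j < n)%N -> j != a.+1 -> j != a ->
  letter_supp a l h -> letter_supp a l (T j * h).
Proof.
move=> Hj N1 N2 Hh u; case/adjpP: Hj N1 N2 => p [ap /= <- _] N1 N2.
rewrite mul_T // ffunE => N; have [E|/Hh <-] := eqVneq (h (u * tperm p.1 p.2)%g) 0.
  move: N; rewrite E add0r; case: ifP => _; last by rewrite eqxx.
  by move=> N; apply: Hh; apply: contraNneq N => ->; rewrite mulr0.
rewrite /letter invMg tpermV permM tpermD //; apply/eqP=> Ea.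
by move: N1; rewrite -Ea (eqP ap) eqxx.
Qed.

Lemma letter_supp_asc w a h : level_asc f w -> supported f h ->
  letter_supp a (letter f w a) (Tw w * h).
Proof.
move=> Aw Hh u; rewrite (Tw_asc_expand f_mono Aw Hh) hsumE.
have [/existsP[v /andP[Hv /eqP ->]] _|N] :=
    boolP [exists v, (v \in parabolic n f) && (u == v * w)%g].
  by rewrite /letter invMg permM; have := Hv; rewrite -parabolicV => /parabolicP ->.
rewrite big1 ?eqxx // => v Hv; rewrite hscaleE ffunE; case: eqP => [E|_];
  last by rewrite mulr0.
by case/existsP: N; exists v; rewrite Hv E eqxx.
Qed.

Lemma letter_supp_orth a l l' h h' : letter_supp a l h -> letter_supp a l' h' ->
  l != l' -> hform h h' = 0.
Proof.
move=> Hh Hh' N; rewrite /hform big1 // => u _.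
have [->|/Hh E] := eqVneq (h u) 0; first by rewrite mul0r.
have [->|/Hh' E'] := eqVneq (h' u) 0; first by rewrite mulr0.
by rewrite -E -E' eqxx in N.
Qed.

Definition position w (i : nat) : nat :=
  if insub i is Some b then (w^-1)%g (b : 'I_n) else 0%N.

Lemma positionE w b : position w b = (w^-1)%g b.
Proof. by rewrite /position valK. Qed.

(** T_j acts on the values j - 1 and j, so this says that T_j does not move the value
    i - 1. *)
Definition separated (j i : nat) := (j != i) && (j != i.-1).

(** The generators of the word act on T_w from the right end of the word.  If T_i exchanges
    two different letters, the letter at the value i - 1 becomes wrong, and by separated
    the generators still to come do not move this value; so the resulting term is
    orthogonal to T_w h.  There remain Q T_w if the letters descend, nothing if they
    ascend, and T_w T_k if they are equal, k being the position of the value i. *)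
Lemma hform_word w h G s : level_asc f w -> supported f h -> supported f G ->
    all (fun i => 0 < i < n)%N s -> pairwise separated s ->
  hform (Tw w * h) (\prod_(i <- s) T i * (Tw w * G)) =
  if all (fun i => f (position w i) <= f (position w i.-1))%N s then
    Q ^+ count (fun i => f (position w i) < f (position w i.-1))%N s
    * hform h (\prod_(i <- s | f (position w i) == f (position w i.-1)) T (position w
      i) * G)
  else 0.
Proof.
move=> Aw Hh; elim/last_ind: s G => [|s i IH] G HG.
  by move=> _ _; rewrite /= !big_nil expr0 !mul1r (hform_asc f_mono Aw).
rewrite all_rcons => /andP[Hi Hs]; rewrite pairwise_rcons => /andP[Si Ss].
rewrite -cats1 !big_cat all_cat count_cat /= !big_cons !big_nil !mulr1 andbT addn0.
have [a [b [ab Eb]]] : exists a b : 'I_n, b = a.+1 :> nat /\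
  b = i :> nat by apply: ord_pair.
have ap : adj (a, b) by rewrite /adj /= ab.
have Ea : a = i.-1 :> nat by rewrite -Eb ab.
rewrite -Ea -Eb !positionE -/(letter f w a) -/(letter f w b) -mulrA [T b * _]mulrA.
have -> : T b * Tw w = Tw (w * tperm a b) + (if ldes (a, b) w then Q *: Tw w else 0).
  exact: (mul_T_Tw Q w ap).
have vanish : letter f w a != letter f w b ->
    hform (Tw w * h) (\prod_(j <- s) T j * (Tw (w * tperm a b) * G)) = 0.
  move=> N; apply: (letter_supp_orth (a := a) _ _ N); first exact: letter_supp_asc.
  have -> : letter f w b = letter f (w * tperm a b) a.
    by rewrite /letter invMg tpermV permM tpermL.
  have : letter_supp a (letter f (w * tperm a b) a) (Tw (w * tperm a b) * G).
    by apply: letter_supp_asc => //; apply: (level_asc_swap ab Aw N).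
  move: (Tw _ * G) => x; elim: s Hs Si {IH Ss} => [|j s IH] /=;
    first by rewrite big_nil mul1r.
  case/andP=> Hj Hs /andP[/andP[N1 N2] Si] Hx; rewrite big_cons -mulrA.
  by apply: letter_supp_T; [| rewrite -ab Eb | rewrite Ea | apply: IH].
rewrite mulrDl mulrDr hform_addr; case: (ltngtP (letter f w b) (letter f w a)) => L.
- have -> : ldes (a, b) w by apply: (label_lt f_mono).
  rewrite vanish ?gtn_eqF // add0r -scalerAl -scalerAr hform_scaler IH // andbT mulr1.
  by case: ifP => _; rewrite ?mulr0 // addnC exprS mulrA.
- rewrite andbF vanish ?ltn_eqF // add0r; case: ifP => [D|_];
  last by rewrite mul0r mulr0 hform0r.
  by have := f_mono (ltnW D); rewrite leqNgt L.
have E := level_asc_adj f_mono Aw ab (esym L).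
have -> : ldes (a, b) w = false by rewrite /ldes /= E; lia.
rewrite mul0r mulr0 hform0r addr0 andbT addn0.
(* Equal letters: s_i w = w s_k with k the position of b. *)
have par_k : adjp n ((w^-1)%g b) \in parabolic n f.
  by apply: parabolic_adjp; rewrite E ?ltn_ord //= -?E.
have -> : Tw (w * tperm a b) = Tw w * T ((w^-1)%g b).
  rewrite /Defs.T (Tw_mul_asc Q f_mono Aw par_k); congr (Defs.Tw _ _).
  rewrite (adjp_adj (p := ((w^-1)%g a, (w^-1)%g b))) /adj /= ?E //.
  by rewrite -tpermJ conjgE invgK mulgA mulgKV.
rewrite -[Tw w * _ * G]mulrA IH //; first by rewrite mulrA.
by apply: suppM => //; apply: supp_Tw.
Qed.

(** If w is block decreasing, each letter of s is either a strict descent, giving Q, or a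
    repeat, giving another Q through hform_Exi_word; this is the power Q ^+ size s. *)
Lemma hform_Exi_coset w s : level_asc f w ->
    (forall i, (i \in s) = (0 < i < n)%N && (g i.-1 == g i)) ->
    uniq s -> pairwise separated s ->
  hform (Tw w * Exi_prefix Q n f c z n) (\prod_(i <- s) T i * Tw w) =
  if block_decreasing f g w then Q ^+ size s * \prod_(1 <= q < n)
    (if inner_index c q then (if repeat_at f g w q then z (f q) else 1 + z (f q)) else
      1) else 0.
Proof.
move=> Aw Ms Us Ps; have [_ SE] := supp_E_label Q z f_mono start_spec (leqnn n).
rewrite -[Tw w in X in hform _ X]mulr1 hform_word //; last 2 first.
- exact: supp1.
- by apply/allP=> i; rewrite Ms => /andP[].
have in_s a b : b = a.+1 :> nat -> (val b \in s) = (g a == g b).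
  move=> ab; have Eb : (val b).-1 = a by rewrite /= ab.
  by rewrite Ms ltn_ord Eb /= {1}ab.
have s_pair i : i \in s -> exists a b, [/\ b = a.+1 :> nat, i = b & g a = g b].
  move=> si; have := si; rewrite Ms => /andP[/ord_pair[a [b [ab Eb]]] _].
  by exists a, b; split=> //; apply/eqP; rewrite -(in_s a b ab) /= Eb.
have prE a b : b = a.+1 :> nat -> position w b.-1 = (w^-1)%g a.
  by move=> ->; rewrite positionE.
have -> : all (fun i => f (position w i) <= f (position w i.-1))%N s
  = block_decreasing f g w.
  apply/allP/block_decreasingP => [Ha a b ab E|Ho i /s_pair[a [b [ab -> gab]]]].
    by have := Ha b; rewrite (in_s a b ab) E eqxx (prE a b ab) positionE; apply.
  by rewrite (prE a b ab) positionE; apply: Ho.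
case: ifP => // Hok; rewrite mulr1.
pose e i := f (position w i) == f (position w i.-1).
pose s' := [seq position w i | i <- s & e i].
have -> : \prod_(i <- s | f (position w i) == f (position w i.-1)) T (position w i)
  = \prod_(q <- s') T q.
  by rewrite big_map big_filter.
have Ms' q : (q \in s') = repeat_at f g w q.
  apply/mapP/repeat_atP => [[i]|[a [b [ab gab letter_ab Eq]]]].
    rewrite mem_filter => /andP[Ei /s_pair[a [b [ab Ei' gab]]]] ->.
    exists a, b; rewrite Ei' positionE; split=> //.
    by apply/esym/eqP; move: Ei; rewrite /e Ei' (prE a b ab) positionE.
  exists (val b); last by rewrite positionE.
  by rewrite mem_filter (in_s a b ab) gab eqxx /e (prE a b ab) positionE andbT; apply/eqP.
have Us' : uniq s'.
  rewrite map_inj_in_uniq ?filter_uniq // => i j; rewrite !mem_filter !Ms.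
  move=> /and3P[_ /andP[_ Hi] _] /and3P[_ /andP[_ Hj] _].
  rewrite -[i]/(val (Ordinal Hi)) -[j]/(val (Ordinal Hj)) !positionE.
  by move/val_inj/perm_inj ->.
have rs' q : q \in s' -> (0 < q < n)%N.
  rewrite Ms' => /repeat_atP[a [b [ab gab letter_ab <-]]].
  by rewrite ltn_ord (level_asc_adj f_mono Aw ab letter_ab).
rewrite (hform_Exi_word Q z start_spec) //; last first.
  apply/allP=> q Hq; rewrite (rs' _ Hq) /=.
  by move: Hq; rewrite Ms'; apply: repeat_at_inner.
have -> : size s = (count (fun i =>
  f (position w i) < f (position w i.-1))%N s + size s')%N.
  rewrite size_map size_filter -[LHS](count_predC (fun i =>
    f (position w i) < f (position w i.-1))%N).
  congr (_ + _)%N; apply: eq_in_count => i /s_pair[a [b [ab -> gab]]].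
  by have /block_decreasingP/(_ a b ab gab) := Hok;
    rewrite /= /e (prE a b ab) positionE /letter; lia.
rewrite exprD -mulrA; congr (_ * _).
have -> : Q ^+ size s' = \prod_(1 <= q < n) (if repeat_at f g w q then Q else 1).
  rewrite -big_mkcond /= (eq_bigl (fun q => q \in s')) => [|q]; last by rewrite Ms'.
  rewrite big_const_seq iter_mulr_1; congr (_ ^+ _).
  rewrite -size_filter; apply: perm_size; apply: uniq_perm => //.
    by rewrite filter_uniq // iota_uniq.
  by move=> q; rewrite mem_filter mem_index_iota /=;
    case: (boolP (q \in s')) => // /rs' ->.
rewrite -big_split; apply: eq_bigr => q _ /=; rewrite Ms'.
case: (boolP (repeat_at f g w q)) => [/(repeat_at_inner Aw) ->|_]; first by rewrite mulrC.
by rewrite mul1r.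
Qed.

End Sums.

(** * The two pairings as sums over coset representatives *)

Definition start (J : seq nat) (q : nat) : nat := sumn (take (reshape_index J q) J).

Lemma start_label (J : seq nat) i q : (i <= q)%N -> (q < sumn J)%N ->
  (reshape_index J i == reshape_index J q) = (start J q <= i)%N.
Proof.
move=> iq Hq; apply/eqP/idP => [E|ci].
  rewrite -[X in (_ <= X)%N](reshape_indexK J i) /flatten_index E; exact: leq_addr.
have Hr := reshape_offsetP Hq; have Eq := reshape_indexK J q.
rewrite /flatten_index -/(start J q) in Eq.
have Ei : i = flatten_index J (reshape_index J q) (i - start J q).
  by rewrite /flatten_index -/(start J q) subnKC.
rewrite [in LHS]Ei flatten_indexKl //; apply: leq_ltn_trans Hr.
by rewrite /reshape_offset -/(start J q) leq_sub2r.
Qed.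

Lemma big_blocks (A : Type) (idx : A) (op : Monoid.law idx) (F : nat -> A)
    (J : seq nat) :
  \big[op/idx]_(0 <= q < sumn J) F q =
  \big[op/idx]_(a < size J) \big[op/idx]_(0 <= k < nth 0%N J a)
    F (sumn (take a J) + k)%N.
Proof.
elim: J F => [|k J IH] F; first by rewrite big_ord0 big_nil.
rewrite big_ord_recl /= (@big_cat_nat _ _ _ k) ?leq_addr //=.
congr (op _ _); rewrite -{1}[k]add0n big_addn addKn IH.
apply: eq_bigr => a _; apply: eq_bigr => i _; congr F.
by rewrite addnC addnA.
Qed.

Lemma start_flatten (J : seq nat) a k : (k < nth 0%N J a)%N ->
  start J (sumn (take a J) + k) = sumn (take a J) /\
    reshape_index J (sumn (take a J) + k) = a.
Proof. by move=> Hk; rewrite /start -/(flatten_index J a k) flatten_indexKl. Qed.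

Lemma prod_inner_blocks (A : nzRingType) (G : nat -> A) (n : nat) (J : seq nat) :
    sumn J = n -> (forall q, ~~ inner_index (start J) q -> G q = 1) ->
  \prod_(1 <= q < n) G q =
  \prod_(a < size J) \prod_(1 <= k < nth 0%N J a) G (sumn (take a J) + k)%N.
Proof.
move=> sJ G1; have -> : \prod_(1 <= q < n) G q = \prod_(0 <= q < n) G q.
  have [->|n0] := posnP n; first by rewrite !big_geq.
  by rewrite [RHS]big_ltn // G1 ?mul1r.
rewrite -sJ big_blocks /=; apply: eq_bigr => a _; have [->|k0] := posnP (nth 0%N J a).
  by rewrite !big_geq.
rewrite big_ltn // G1 ?mul1r // /inner_index; have [-> _] := start_flatten k0.
by rewrite addn0 ltnn.
Qed.

(** The indices of the generators of zeta_K, in the order in which they are multiplied and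
    shifted by o. *)
Fixpoint generator_word (o : nat) (K : seq nat) : seq nat :=
  if K is k :: K' then [seq (o + i)%N | i <- rev (iota 1 k.-1)] ++ generator_word (o +
    k) K'
  else [::].

Lemma mem_generator_word o K i : all (ltn 0) K -> (i \in generator_word o K) =
  (o < i < o + sumn K)%N && (reshape_index K (i.-1 - o) == reshape_index K (i - o)).
Proof.
elim: K o => [|k K IH] o /= => [_|/andP[k0 HK]]; first by rewrite in_nil; lia.
have -> : (i \in [seq (o + j)%N | j <- rev (iota 1 k.-1)] ++ generator_word (o + k) K)
    = (o < i < o + k)%N || (i \in generator_word (o + k) K).
  rewrite mem_cat; congr (_ || _); apply/mapP/idP => [[j]|Hi].
    by rewrite mem_rev mem_iota => Hj ->; lia.
  by exists (i - o)%N; rewrite ?mem_rev ?mem_iota; lia.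
rewrite IH // !reshape_index_cons -!subnDA addnA.
have [ik|ki] := ltnP (i - o) k.
  have -> : (i.-1 - o < k)%N by lia.
  by rewrite eqxx andbT; lia.
have [ik|ki'] := ltnP (i.-1 - o) k; last first.
  by rewrite eqSS; case: eqP => _; rewrite ?andbT ?andbF ?orbF; lia.
by rewrite andbF orbC; case: eqP => _; rewrite ?andbT ?andbF; lia.
Qed.

Lemma uniq_generator_word o K : all (ltn 0) K ->
  uniq (generator_word o K) && pairwise separated (generator_word o K).
Proof.
elim: K o => [|k K IH] o //= /andP[k0 HK].
have /andP[U P] := IH (o + k)%N HK.
set s := [seq (o + i)%N | i <- _].
have Ms i : (i \in s) = (o < i < o + k)%N.
  apply/mapP/idP => [[j]|Hi]; first by rewrite mem_rev mem_iota => Hj ->; lia.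
  by exists (i - o)%N; rewrite ?mem_rev ?mem_iota; lia.
have Us : uniq s by rewrite map_inj_uniq ?rev_uniq ?iota_uniq // => x y /addnI.
have Ps : pairwise separated s.
  have : pairwise (fun x y => y < x)%N s.
    rewrite -sorted_pairwise; last by move=> x y t xy yt; apply: ltn_trans yt xy.
    rewrite /s map_rev rev_sorted sorted_map.
    apply: (sub_sorted _ (iota_ltn_sorted 1 k.-1)) => x y.
    by rewrite /= ltn_add2l.
  apply: (@sub_in_pairwise _ (mem s)); last exact/allP.
  by move=> x y /=; rewrite !Ms /separated; lia.
rewrite cat_uniq pairwise_cat Us U Ps P !andbT /=; apply/andP; split.
  by apply/hasPn=> i; rewrite mem_generator_word // Ms; lia.
apply/allrelP=> i j; rewrite Ms mem_generator_word // /separated => Hi /andP[Hj _].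
by apply/andP; split; apply/eqP; lia.
Qed.

Lemma size_generator_word o K : all (ltn 0) K ->
  (size (generator_word o K) + size K = sumn K)%N.
Proof.
elim: K o => [|k K IH] o //= /andP[k0 HK].
by rewrite size_cat size_map size_rev size_iota; have := IH (o + k)%N HK; lia.
Qed.

Lemma size_composition n K : composition n K -> (size K <= n)%N.
Proof. by case/andP=> pK /eqP sK; have := size_generator_word 0 pK; rewrite sK; lia. Qed.

Section Instance.
Variables (R : comNzRingType) (Q : R) (n : nat) (J K : seq nat) (z : nat -> R).
Hypothesis HJ : composition n J.
Hypothesis HK : composition n K.
Local Notation H := (hecke Q n).
Local Notation T := (T Q n).
Local Notation Tw := (Tw Q).
Local Notation f := (reshape_index J).
Local Notation g := (reshape_index K).
Local Notation c := (start J).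

Let sJ : sumn J = n. Proof. by case/andP: HJ => _ /eqP. Qed.
Let sK : sumn K = n. Proof. by case/andP: HK => _ /eqP. Qed.
Let pK : all (ltn 0) K. Proof. by case/andP: HK. Qed.

Lemma start_labelJ i q : (i <= q)%N -> (q < n)%N -> (f i == f q) = (c q <= i)%N.
Proof. by move=> iq Hq; apply: start_label; rewrite ?sJ. Qed.

(** E_J and E^xi_J with scalars z in the place of the indeterminates. *)
Definition E_at : H :=
  dirprod T (fun (a : 'I_(size J)) t m => Epol t (z a)%:A m).

Definition Exi_at : H :=
  dirprod T (fun (a : 'I_(size J)) t m => Exi t (z a)%:A m).

Lemma E_atE : E_at = E_prefix Q n f c z n.
Proof.
rewrite /E_prefix (prod_inner_blocks sJ); last by move=> q;
  rewrite /E_factor => /negbTE ->.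
apply: eq_bigr => a _; rewrite /Epol; apply: eq_big_nat => k /andP[k0 Hk].
have [Ec Ef] := start_flatten Hk; rewrite /E_factor /inner_index Ec Ef.
have -> : (sumn (take a J) < sumn (take a J) + k)%N by lia.
by rewrite addKn mulr_algl /shifted_T Ec.
Qed.

Lemma Exi_atE : Exi_at = Exi_prefix Q n f c z n.
Proof.
rewrite /Exi_prefix (prod_inner_blocks sJ); last by move=> q;
  rewrite /Exi_factor => /negbTE ->.
apply: eq_bigr => a _; rewrite /Exi big_add1 /=; apply: eq_big_nat => k /andP[k0 Hk].
have [Ec Ef] := start_flatten Hk; rewrite /Exi_factor /inner_index Ec Ef.
have -> : (sumn (take a J) < sumn (take a J) + k)%N by lia.
by rewrite addKn mulr_algl /shifted_T Ec.
Qed.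

Lemma zetaJE : zetaJ Q n K = \prod_(i <- generator_word 0 K) T i.
Proof.
have E o L : \prod_(a < size L)
    zeta (fun i => T (o + (sumn (take a L) + i))) (nth 0%N L a)
      = \prod_(i <- generator_word o L) T i.
  elim: L o => [|k L IH] o /=; first by rewrite big_ord0 big_nil.
  rewrite big_ord_recl big_cat /= -IH; congr (_ * _); first by rewrite big_map.
  by apply: eq_bigr => a _; apply: eq_bigr => i _; rewrite !addnA.
by rewrite -E.
Qed.

Definition weight (w : 'S_n) : R := \prod_(1 <= q < n)
  (if inner_index c q then (if repeat_at f g w q then z (f q) else 1 + z (f q)) else 1).

Definition weight_sum : R := \sum_(w in min_reps n J | block_decreasing f g w) weight w.

Lemma LsumE u : Lsum Q n K u = (u \in max_reps n K)%:R.
Proof.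
rewrite /Lsum hsumE; case: (boolP (u \in _)) => Hu.
  rewrite (bigD1 u) //= ffunE eqxx big1 ?addr0 // => v /andP[_ Nv].
  by rewrite ffunE eq_sym (negbTE Nv).
rewrite big1 // => v Hv; rewrite ffunE; case: eqP => // E.
by rewrite E Hv in Hu.
Qed.

Lemma hform_coset_sum :
  hform (\sum_(w in min_reps n J) Tw w * E_at) (Lsum Q n K) = weight_sum.
Proof.
rewrite hform_suml /weight_sum big_mkcondr; apply: eq_bigr => w /min_repsE Aw.
rewrite E_atE (hform_E_coset (g := g) z (@reshape_index_mono J) start_labelJ Aw) //.
move=> v Hv; rewrite LsumE; congr (nat_of_bool _)%:R.
apply/idP/idP => [/max_repsE|/andP H].
  by move/(level_dsc_mul (@reshape_index_mono J) (@reshape_index_mono K) Aw Hv) => /andP.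
by apply/max_repsE; apply/(level_dsc_mul (@reshape_index_mono J) (@reshape_index_mono
  K) Aw Hv).
Qed.

Lemma hform_norm :
  hform (\sum_(w in min_reps n J) Tw w * Exi_at * Tw w^-1) (zetaJ Q n K)
  = Q ^+ (n - size K) * weight_sum.
Proof.
rewrite hform_suml /weight_sum big_mkcondr mulr_sumr; apply: eq_bigr => w /min_repsE Aw.
rewrite hform_Twmr invgK Exi_atE zetaJE.
have /andP[U P] := uniq_generator_word 0 pK.
rewrite (hform_Exi_coset (g := g) Q z (@reshape_index_mono J) start_labelJ Aw _ U P);
  last first.
  by move=> i; rewrite mem_generator_word // !subn0 sK.
have -> : (n - size K = size (generator_word 0 K))%N by have :=
  size_generator_word 0 pK; rewrite sK; lia.
by case: ifP => _; rewrite ?mulr0.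
Qed.

End Instance.

(** * Indeterminates as scalars *)

Section Morph.
Variables (A B : nzRingType) (phi : {rmorphism A -> B}) (t : nat -> A) (z : A).

Lemma tdown_morph m : phi (tdown t m) = tdown (phi \o t) m.
Proof. by rewrite /tdown rmorph_prod. Qed.

Lemma tup_morph m : phi (tup t m) = tup (phi \o t) m.
Proof. by rewrite /tup rmorph_prod. Qed.

Lemma Epol_morph m : phi (Epol t z m) = Epol (phi \o t) (phi z) m.
Proof.
rewrite /Epol rmorph_prod; apply: eq_bigr => k _.
by rewrite rmorphD rmorph1 rmorphM tdown_morph.
Qed.

Lemma Exi_morph m : phi (Exi t z m) = Exi (phi \o t) (phi z) m.
Proof.
rewrite /Exi rmorph_prod; apply: eq_bigr => k _.
by rewrite rmorphD rmorph1 rmorphM /xi rmorphM tdown_morph tup_morph.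
Qed.

End Morph.

Section BaseChange.
Variables (R : comNzRingType) (Q : R) (n r : nat).
Local Notation R' := {mpoly R[r]}.
Local Notation H := (hecke Q n).
Local Notation H' := (hecke (Q%:MP : R') n).
Implicit Types (h g : H) (w : 'S_n).

Definition embed h : H' := [ffun w => (h w)%:MP].

Lemma embed_additive : additive embed.
Proof. by move=> h g; apply/ffunP=> w; rewrite !ffunE mpolyCB. Qed.
HB.instance Definition _ := GRing.isAdditive.Build H H' embed embed_additive.

Lemma embedZ (a : R) h : embed (a *: h) = a%:MP *: embed h.
Proof. by apply/ffunP=> w; rewrite !ffunE mpolyCM. Qed.

Lemma embed_Tw w : embed (Tw Q w) = Tw _ w.
Proof. by apply/ffunP=> v; rewrite !ffunE; case: (v == w). Qed.

Lemma embed_lmul p h : embed (lmul p h) = lmul p (embed h).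
Proof.
apply/ffunP=> v; rewrite !ffunE mpolyCD; congr (_ + _).
by case: ifP => _; rewrite ?mpolyCM.
Qed.

Lemma embed_multiplicative : multiplicative embed.
Proof.
split=> [h g|]; last exact: embed_Tw.
rewrite -[h * g]/(hmul h g) -[RHS]/(hmul _ _) /hmul raddf_sum; apply: eq_bigr => w _.
rewrite [LHS]embedZ ffunE; congr (_ *: _).
by elim: (lword w) => //= p s IH; rewrite embed_lmul IH.
Qed.
HB.instance Definition _ := GRing.isMultiplicative.Build H H' embed embed_multiplicative.

(** A polynomial with coefficients in the Hecke algebra, as an element of the Hecke algebra
    with polynomial coefficients. *)
Definition base_change : {mpoly H[r]} -> H' := mmap embed (fun a => ('X_a)%:A).

HB.instance Definition _ := GRing.Additive.copy base_change (mmap embed (fun a =>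
  ('X_a)%:A)).

Lemma mmap1_scalar (m : 'X_{1..r}) :
  mmap1 (fun a => ('X_a)%:A : H') m = ('X_[m])%:A.
Proof.
rewrite /mmap1 mpolyXE_id -[RHS]/(in_alg _ _) rmorph_prod; apply: eq_bigr => i _.
by rewrite rmorphXn.
Qed.

Lemma base_change_multiplicative : multiplicative base_change.
Proof.
apply: commr_mmap_is_multiplicative => [i x|p m m'].
  by rewrite /GRing.comm mulr_algl mulr_algr.
by rewrite mmap1_scalar /GRing.comm mulr_algl mulr_algr.
Qed.
HB.instance Definition _ := GRing.isMultiplicative.Build _ _ base_change
  base_change_multiplicative.

Lemma base_change_T i : base_change (T Q n i)%:MP = T _ n i.
Proof. by rewrite [LHS]mmapC [LHS]embed_Tw. Qed.

Lemma base_change_Tw w : base_change (Tw Q w)%:MP = Tw _ w.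
Proof. by rewrite [LHS]mmapC [LHS]embed_Tw. Qed.

Lemma base_change_X a : base_change 'X_a = ('X_a)%:A.
Proof. by rewrite [LHS]mmapX mmap1U. Qed.

Lemma hform_embed h g : hform (embed h) (embed g) = (hform h g)%:MP.
Proof.
by rewrite /hform raddf_sum; apply: eq_bigr => w _; rewrite !ffunE -mpolyCM.
Qed.

Lemma hform_base_change (P : {mpoly H[r]}) g : hform (base_change P) (embed g)
  = hformz P g.
Proof.
rewrite /hformz /map_mpoly /base_change /mmap hform_suml; apply: eq_bigr => m _.
rewrite mmap1_scalar mmap1_id /= mulr_algr hform_scalel hform_embed mulrC.
by [].
Qed.

End BaseChange.

Section Indeterminates.
Variables (R : comNzRingType) (Q : R) (n : nat) (J K : seq nat).
Local Notation r := (size J).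
Local Notation R' := {mpoly R[r]}.

(** The z_a as a function of a natural number, because blocks are numbered by natural
    numbers. *)
Definition indet (a : nat) : R' := if insub a is Some b then 'X_(b : 'I_r) else 0.

Lemma indetE (a : 'I_r) : indet a = 'X_a.
Proof. by rewrite /indet valK. Qed.

Lemma base_change_EJ : base_change (EJ Q n J) = E_at (Q%:MP) n J indet.
Proof.
rewrite /EJ /E_at /dirprod rmorph_prod; apply: eq_bigr => a _ /=.
rewrite Epol_morph [X in Epol _ X _]base_change_X indetE /Epol; apply: eq_bigr => k _.
by congr (1 + _ * _); apply: eq_bigr => i _; apply: base_change_T.
Qed.

Lemma base_change_ExiJ : base_change (ExiJ Q n J) = Exi_at (Q%:MP) n J indet.
Proof.
rewrite /ExiJ /Exi_at /dirprod rmorph_prod; apply: eq_bigr => a _ /=.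
rewrite Exi_morph [X in Exi _ X _]base_change_X indetE /Exi; apply: eq_bigr => k _.
by congr (1 + _ * (_ * _)); apply: eq_bigr => i _; apply: base_change_T.
Qed.

Lemma embed_Lsum : embed r (Lsum Q n K) = Lsum (Q%:MP : R') n K.
Proof. by rewrite /Lsum raddf_sum; apply: eq_bigr => w _; apply: embed_Tw. Qed.

Lemma embed_zetaJ : embed r (zetaJ Q n K) = zetaJ (Q%:MP : R') n K.
Proof.
rewrite /zetaJ /dirprod rmorph_prod; apply: eq_bigr => a _ /=.
rewrite /zeta tdown_morph; apply: eq_bigr => i _; exact: embed_Tw.
Qed.

Hypothesis HJ : composition n J.
Hypothesis HK : composition n K.

Lemma hformz_coset_sum :
  hformz (coset_sum J (EJ Q n J)) (Lsum Q n K) = weight_sum n J K indet.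
Proof.
rewrite -hform_base_change embed_Lsum -(hform_coset_sum (Q%:MP) indet HJ HK)
  -base_change_EJ.
congr hform; rewrite raddf_sum; apply: eq_bigr => w _.
by rewrite -(base_change_Tw Q r) -rmorphM.
Qed.

Lemma hformz_norm :
  hformz (norm J (ExiJ Q n J)) (zetaJ Q n K)
    = Q ^+ (n - size K) *: weight_sum n J K indet.
Proof.
rewrite -hform_base_change embed_zetaJ -mul_mpolyC rmorphXn -(hform_norm (Q%:MP) indet
  HJ HK).
rewrite -base_change_ExiJ; congr hform; rewrite raddf_sum; apply: eq_bigr => w _.
by rewrite -!(base_change_Tw Q r) -!rmorphM.
Qed.

End Indeterminates.

(** * Coefficients of hook Schur functions *)

Definition nparts N (m : 'X_{1..N}) : nat := #|[set i | m i != 0%N]|.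

Section Hook.
Variables (R : comNzRingType) (N : nat).
Implicit Types (m : 'X_{1..N}) (p : {mpoly R[N]}).
Local Notation complete := (complete R).

Lemma mcoeff_complete k m : (complete k N)@_m = (mdeg m == k)%:R.
Proof.
rewrite raddf_sum /=; have [Em|Nm] := eqVneq (mdeg m) k.
  have Hm : (mdeg m < k.+1)%N by rewrite Em.
  rewrite (bigD1 (BMultinom Hm)) /= ?Em // mcoeffX eqxx big1 ?addr0 // => i.
  case/andP=> _; rewrite -(inj_eq val_inj) /= mcoeffX.
  by move=> /negbTE->.
rewrite big1 // => i /eqP Ei; rewrite mcoeffX; case: eqP => // E.
by rewrite -E Ei eqxx in Nm.
Qed.

Lemma mcoeffMX_le p k m :
  (p * 'X_[k])@_m = if (k <= m)%MM then p@_(m - k) else 0.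
Proof.
case: ifP => [km|/negP Nkm]; first by rewrite -{1}(submK km) addmC mcoeffMX.
rewrite mcoeffM big1 // => -[k1 k2] /= /eqP E; rewrite mcoeffX.
case: eqP => [Ek|_]; last by rewrite mulr0.
by case: Nkm; rewrite E Ek lem_addl.
Qed.

Lemma mesym1_le (h : {set 'I_N}) m :
  (mesym1 h <= m)%MM = (h \subset [set i | m i != 0%N]).
Proof.
apply/mnm_lepP/subsetP => [Hm i Hi|Hh i].
  by rewrite inE -lt0n; have := Hm i; rewrite mnmE Hi.
by rewrite mnmE; case: (boolP (i \in h)) => // /Hh; rewrite inE -lt0n.
Qed.

Lemma nparts_le m : (nparts m <= mdeg m)%N.
Proof.
rewrite /nparts -sum1_card mdegE [X in (_ <= X)%N](bigID (mem [set i | m i != 0%N])) /=.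
by rewrite (leq_trans _ (leq_addr _ _)) // leq_sum // => i; rewrite inE lt0n.
Qed.

Lemma nparts_gt0 m : (0 < mdeg m)%N -> (0 < nparts m)%N.
Proof.
rewrite lt0n; apply: contraNltn; rewrite leqn0 cards_eq0 => /eqP E.
rewrite mdegE big1 // => i _; apply/eqP/negPn/negP => Hi.
by have := in_set0 i; rewrite -E inE Hi.
Qed.

Lemma mechar_nparts k m : mechar k.+1 m = (mdeg m == k.+1) && (nparts m == k.+1).
Proof.
rewrite /mechar; case: eqP => //= Em; rewrite -Em.
rewrite mdegE /nparts -sum1_card [X in _ = (X == _)]big_mkcond /=.
apply/forallP/eqP => [H|E i].
  by apply: eq_bigr => i _; rewrite inE; have := H i; case: (m i) => [|[|]].
have le_i (j : 'I_N) : ((if j \in [set i | m i != 0%N] then 1 else 0) <= m j)%N.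
  by rewrite inE; case: (m j).
move: E; rewrite (bigD1 i) //= [RHS](bigD1 i) //= => E.
rewrite -(leq_add2r (\sum_(j < N | j != i) m j)) -E leq_add //; first by case: ifP.
by apply: leq_sum => j _; apply: le_i.
Qed.

(** The squarefree divisors of degree b of a monomial are given by the b-subsets of its
    support. *)
Lemma mcoeff_complete_mesym a b m :
  (complete a N * mesym N R b)@_m = ((mdeg m == a + b)%N * 'C(nparts m, b))%:R.
Proof.
rewrite mesymE mulr_sumr raddf_sum /=.
transitivity (\sum_(h : {set 'I_N} | (#|h| == b) && (h \subset [set i | m i != 0%N]))
   (mdeg m == a + b)%:R : R).
  rewrite big_mkcondr; apply: eq_bigr => h /eqP Hh.
  rewrite mcoeffMX_le mesym1_le; case: ifP => // Hs.
  have Hle : (mesym1 h <= m)%MM by rewrite mesym1_le.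
  rewrite mcoeff_complete -{2}(submK Hle) mdegD mdeg_mesym1 Hh.
  by rewrite eqn_add2r.
rewrite sumr_const natrM mulr_natr; congr (_ *+ _).
rewrite /nparts -cards_draws cardsE; apply: eq_card => h.
by rewrite [LHS]unfold_in [RHS]unfold_in andbC.
Qed.

(** The entries of the Jacobi-Trudi matrix of the hook (a, 1^b), for all b. *)
Definition hook_entry a i j : {mpoly R[N]} :=
  let l := if i is 0%N then a else 1%N in
  if (i <= l + j)%N then complete (l + j - i) N else 0.

Definition hookdet a b : {mpoly R[N]} :=
  \det (\matrix_(i < b.+1, j < b.+1) hook_entry a i j).

Lemma schur_hook a b : schur R (a :: nseq b 1%N) N = hookdet a b.
Proof.
rewrite /schur; have E : size (a :: nseq b 1%N) = b.+1 by rewrite /= size_nseq.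
have -> : hookdet a b = \det (\matrix_(i < size (a :: nseq b 1%N), j < size (a :: nseq
  b 1%N))
    hook_entry a i j) by rewrite /hookdet -E.
congr (\det _); apply/matrixP=> i j; rewrite !mxE /hook_entry.
case: i => -[|i] Hi //=; rewrite nth_nseq.
by have -> : (i < b)%N by move: Hi; rewrite E.
Qed.

Lemma hookdet0 a : hookdet a 0 = complete a N.
Proof. by rewrite /hookdet det_mx11 mxE /hook_entry /= addn0 subn0. Qed.

Lemma hook_entrySS a i j : hook_entry a i.+1 j.+1 = hook_entry 1 i j.
Proof.
by case: i => [|i].
Qed.

(** Expansion along the first column, whose only nonzero entries are h_a and h_0 = 1. *)
Lemma hookdetS a b : hookdet a b.+1 = complete a N * hookdet 1 b - hookdet a.+1 b.
Proof.
rewrite {1}/hookdet; set A := (X in \det X).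
have E0 : A ord0 ord0 = complete a N by rewrite mxE /hook_entry /= addn0 subn0.
have E1 : A (lift ord0 ord0) ord0 = 1.
  rewrite mxE /hook_entry /=; apply/mpolyP=> m.
  by rewrite mcoeff_complete mcoeff1 mdeg_eq0.
have E2 i : A (lift ord0 (lift ord0 i)) ord0 = 0 by rewrite mxE.
have C0 : cofactor A ord0 ord0 = hookdet 1 b.
  rewrite /cofactor expr0 mul1r; congr (\det _); apply/matrixP=> i j.
  by rewrite !mxE; apply: hook_entrySS.
have C1 : cofactor A (lift ord0 ord0) ord0 = - hookdet a.+1 b.
  rewrite /cofactor expr1 mulN1r; congr (- \det _); apply/matrixP=> i j.
  rewrite !mxE; case: i => -[|i] Hi; last exact: hook_entrySS.
  by rewrite /hook_entry /= /bump /= add1n addnS addSn.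
rewrite (expand_det_col _ ord0) 2!big_ord_recl big1 => [|i _]; last by rewrite E2 mul0r.
rewrite E0 E1 C0 C1; move: (hookdet 1 b) (hookdet _ b) (complete a N) => x y p.
by rewrite addr0 mul1r.
Qed.

(** Induction on b: the case a = 1 identifies hookdet 1 b with the elementary symmetric
    polynomial of degree b + 1, and hookdetS becomes Pascal's rule. *)
Lemma mcoeff_hookdet a b m : (0 < a)%N ->
  (hookdet a b)@_m = ((mdeg m == a + b)%N * 'C((nparts m).-1, b))%:R.
Proof.
elim: b a m => [|b IH] a m a0.
  by rewrite hookdet0 mcoeff_complete addn0 bin0 muln1.
have E : hookdet 1 b = mesym N R b.+1.
  apply/mpolyP=> k; rewrite IH // mcoeff_mesym mechar_nparts add1n.
  case: eqP => //= Ek; rewrite mul1n; congr _%:R.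
  have := nparts_le k; have := @nparts_gt0 k; rewrite Ek.
  move: (nparts k) => l /(_ isT) l0 lb; case: eqP => [->|Nl]; first by rewrite /= binn.
  by rewrite bin_small //; lia.
rewrite hookdetS E mcoeffB mcoeff_complete_mesym IH // addSnnS.
case: eqP => [Em|_]; last by rewrite !mul0n subr0.
have : (0 < nparts m)%N by apply: nparts_gt0; rewrite Em; lia.
case: (nparts m) => // l _; rewrite !mul1n binS /= natrD addrK.
by [].
Qed.

Lemma mcoeff_schur_hook a b m : (0 < a)%N ->
  (schur R (a :: nseq b 1%N) N)@_m = ((mdeg m == a + b)%N * 'C((nparts m).-1, b))%:R.
Proof. by move=> a0; rewrite schur_hook mcoeff_hookdet. Qed.

(** With l = nparts m, the coefficients z^i binomial(l-1, j-1-i) add up to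
    z^(j-l) (z+1)^(l-1). *)
Lemma mcoeff_hook_sum j (z : R) m : (0 < j)%N ->
  (\sum_(i < j) z ^+ i *: schur R (i.+1 :: nseq (j.-1 - i) 1%N) N)@_m =
  if mdeg m == j then z ^+ (j - nparts m) * (1 + z) ^+ (nparts m).-1 else 0.
Proof.
move=> j0; rewrite raddf_sum /=.
transitivity (\sum_(i < j) z ^+ i * ((mdeg m == j)%N * 'C((nparts m).-1, j.-1 - i))%:R).
  apply: eq_bigr => i _; rewrite mcoeffZ mcoeff_schur_hook //.
  by rewrite (_ : (i.+1 + (j.-1 - i) = j)%N) //; have := ltn_ord i; lia.
case: eqP => [Em|_]; last by rewrite big1 // => i _; rewrite mul0n mulr0.
have := nparts_le m; have := @nparts_gt0 m; rewrite Em j0 => /(_ isT).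
case: j j0 {Em} => // j _; move: (nparts m) => -[] // l _; rewrite ltnS => lj.
rewrite (reindex_inj rev_ord_inj) /= [1 + z]addrC exprDn subSS.
rewrite (big_ord_widen j.+1 (fun i => z ^+ (l - i) * 1 ^+ i *+ 'C(l, i))) //.
rewrite [in RHS]big_mkcond mulr_sumr; apply: eq_bigr => i _.
have ij : (i <= j)%N by rewrite -ltnS.
rewrite subSS subKn // mul1n; case: ifP => il; last first.
  by rewrite bin_small ?mulr0 // ltnNge -ltnS il.
rewrite expr1n mulr1 [in RHS]mulrnAr -exprD mulr_natr.
by congr (_ ^+ _ *+ _); move: il; lia.
Qed.

End Hook.

(** * Block decreasing words and matrices *)

Lemma card_label n (J : seq nat) a : sumn J = n -> (a < size J)%N ->
  #|[set k : 'I_n | reshape_index J k == a]| = nth 0%N J a.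
Proof.
move=> sJ aJ; rewrite -sum1dep_card big_mkcond /=.
rewrite -(big_mkord xpredT (fun k => if reshape_index J k == a then 1%N else 0%N)) -sJ.
rewrite big_blocks /= (bigD1 (Ordinal aJ)) //= [X in (_ + X)%N]big1 => [|i Ni];
  last first.
  apply: big1_seq => k /andP[_]; rewrite mem_index_iota => /andP[_ Hk].
  have [_ ->] := start_flatten Hk; case: eqP => // E.
  by case/eqP: Ni; apply: val_inj.
rewrite (eq_big_nat _ _ (F2 := fun=> 1%N)) => [|k /andP[_ Hk]].
  by rewrite sum_nat_const_nat subn0 muln1 addn0.
by have [_ ->] := start_flatten Hk; rewrite eqxx.
Qed.

Section Fibers.
Variable n : nat.

Lemma card_count (T : finType) (P : pred T) : #|[set k | P k]| = count P (enum T).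
Proof. by rewrite cardsE cardE [in RHS]enumT /enum_mem size_filter. Qed.

Lemma fiber_count (T : eqType) (u : 'I_n -> T) t :
  #|[set k | u k == t]| = count_mem t [seq u k | k <- enum 'I_n].
Proof. by rewrite card_count count_map. Qed.

(** Two words with the same content differ by a permutation of the positions. *)
Lemma fiber_perm (T : eqType) (u v : 'I_n -> T) :
  (forall t, #|[set k | u k == t]| = #|[set k | v k == t]|) ->
  exists p : 'S_n, forall k, u k = v (p k).
Proof.
move=> H; have /tuple_permP[p Ep] : perm_eq [tuple u k | k < n] [tuple v k | k < n].
  by apply/allP=> t _ /=; rewrite -!fiber_count H.
exists p => k; move/val_inj: Ep => /(congr1 (fun s => tnth s k)).
by rewrite !tnth_mktuple.
Qed.

Lemma fiber_exists (T : finType) (d : T -> nat) : (\sum_t d t = n)%N ->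
  exists L : 'I_n -> T, forall t, #|[set k | L k == t]| = d t.
Proof.
move=> Hd; pose s := flatten [seq nseq (d t) t | t <- enum T].
have size_s : size s == n.
  rewrite size_flatten /shape -map_comp sumnE big_map big_enum /= -Hd.
  by apply/eqP/eq_bigr => t _; rewrite /= size_nseq.
exists (tnth (Tuple size_s)) => t; rewrite fiber_count map_tnth_enum /=.
rewrite count_flatten -map_comp sumnE big_map big_enum (bigD1 t) //= big1 ?addn0.
  by rewrite count_nseq /= eqxx mul1n.
by move=> t' Nt; rewrite count_nseq /= (negbTE Nt).
Qed.

End Fibers.

Section Matrices.
Variables (n N : nat) (J K : seq nat).
Hypothesis sJ : sumn J = n.
Hypothesis sK : sumn K = n.
Hypothesis zK : size K = N.
Local Notation r := (size J).
Local Notation f := (reshape_index J).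
Local Notation g := (reshape_index K).
Implicit Types (v w : 'S_n) (i k : 'I_n).

Lemma label_bound i : (f i < r)%N.
Proof. by apply: reshape_indexP; rewrite sJ. Qed.

Lemma value_label_bound i : (g i < N)%N.
Proof. by rewrite -zK; apply: reshape_indexP; rewrite sK. Qed.

Definition cell w (a b : nat) : nat := #|[set k : 'I_n | (f k == a) && (g (w k) == b)]|.

Lemma cell_letter w a b : cell w a b = #|[set i | (letter f w i == a) && (g i == b)]|.
Proof.
rewrite /cell -(card_imset _ (@perm_inj _ w)); apply: eq_card => i.
rewrite -[i in LHS](permKV w) (mem_imset _ _ (@perm_inj _ w)) !inE permKV.
by [].
Qed.

Lemma cell_row w a : (a < r)%N -> (\sum_(b < N) cell w a b)%N = nth 0%N J a.
Proof.
move=> ar; rewrite -(card_label sJ ar) -sum1dep_card.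
rewrite (partition_big (fun k => Ordinal (value_label_bound (w k))) predT) //=.
by apply: eq_bigr => b _; rewrite /cell -sum1dep_card; apply: eq_bigl => k.
Qed.

Lemma cell_col w b : (b < N)%N -> (\sum_(a < r) cell w a b)%N = nth 0%N K b.
Proof.
rewrite -zK => bN; rewrite -(card_label sK bN) -(card_imset _ (@perm_inj _ w^-1))
  -sum1_card.
rewrite (partition_big (fun k => Ordinal (label_bound k)) predT) //=.
apply: eq_bigr => a _; rewrite /cell -sum1dep_card; apply: eq_bigl => k.
rewrite andbC; congr (_ && _); rewrite -{2}[k](permK w) (mem_imset _ _ (@perm_inj _
  w^-1)).
by rewrite inE.
Qed.

Lemma block_decreasing_chain w i i' : block_decreasing f g w -> g i = g i' ->
  (i < i')%N -> (letter f w i' <= letter f w i)%N.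
Proof.
move=> /block_decreasingP Ho gi ii'.
apply: (level_chain (f := g) (@reshape_index_mono K) (r := fun x y => (y <= x)%N)
  (w := letter f w)) => // x y t xy ty.
exact: leq_trans ty xy.
Qed.

(** In a block of g the values with letter at least c form an initial segment, whose
    cardinality is a sum of cells.  Two initial segments of the same cardinality
    coincide. *)
Lemma cell_inj w w' : block_decreasing f g w -> block_decreasing f g w' ->
  (forall a b, (a < r)%N -> (b < N)%N -> cell w a b = cell w' a b) ->
    letter f w =1 letter f w'.
Proof.
move=> Ho Ho' E.
pose U v (b c : nat) := [set i : 'I_n | (g i == b) && (c <= letter f v i)%N].
have cardU v b c : #|U v b c| = (\sum_(a < r | c <= a) cell v a b)%N.
  rewrite -sum1dep_card (partition_big (fun i => Ordinal (label_bound ((v^-1)%g i)))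
    (fun a : 'I_r => c <= a)%N) /=; last by move=> i /andP[].
  apply: eq_bigr => a ca; rewrite cell_letter -sum1dep_card; apply: eq_bigl => i.
  rewrite -(inj_eq val_inj) /= -/(letter f v i);
    have [->|_] := eqVneq (letter f v i) a; last by rewrite andbF.
  by rewrite ca !andbT.
have down v b c i i' : block_decreasing f g v -> (i <= i')%N -> g i = b ->
  i' \in U v b c -> i \in U v b c.
  move=> Hv ii' gi; rewrite !inE gi eqxx => /andP[/eqP gi' ci'].
  move: ii'; rewrite leq_eqVlt => /orP[/eqP/val_inj ->//|lt].
  by apply: leq_trans ci' _; apply: block_decreasing_chain => //; rewrite gi gi'.
(* One of two initial segments contains the other. *)
have UE b c : (b < N)%N -> U w b c = U w' b c.
  move=> bN; have EU : #|U w b c| = #|U w' b c|.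
    by rewrite !cardU; apply: eq_bigr => a _; apply: E.
  have [sub|/subsetPn[x xU xNU]] := boolP (U w b c \subset U w' b c).
    by apply/eqP; rewrite eqEcard sub EU leqnn.
  apply/esym/eqP; rewrite eqEcard EU leqnn andbT; apply/subsetP=> y yU'.
  have gx : g x = b by move: xU; rewrite inE => /andP[/eqP].
  have gy : g y = b by move: yU'; rewrite inE => /andP[/eqP].
  case: (leqP x y) => xy; first by case/negP: xNU; apply: (down w' b c x y).
  by apply: (down w b c y x) => //; apply: ltnW.
move=> i; have Hi c : (c <= letter f w i)%N = (c <= letter f w' i)%N.
  by have /setP/(_ i) := UE _ c (value_label_bound i); rewrite !inE eqxx.
by apply/eqP; rewrite eqn_leq -Hi leqnn Hi leqnn.
Qed.

Lemma letter_inj w w' : level_asc f w -> level_asc f w' ->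
  letter f w =1 letter f w' -> w = w'.
Proof.
move=> Aw Aw' E; apply: (level_asc_inj (@reshape_index_mono J)) => //;
  apply/parabolicP=> k.
by rewrite permM -/(letter f w' (w k)) -E /letter permK.
Qed.

Lemma letter_parabolic u w : u \in parabolic n f -> letter f (u * w) =1 letter f w.
Proof. by rewrite -parabolicV => /parabolicP Hu i; rewrite /letter invMg permM. Qed.

(** A permutation x with the prescribed cells exists, because a list of n pairs (a, b)
    with multiplicities d a b can be matched with the positions by its first components
    and with the values by its second ones.  Making x^-1 decreasing on the blocks of g
    and then x increasing on the blocks of f does not change the cells. *)
Lemma cell_exists (d : 'I_r -> 'I_N -> nat) :
    (forall a, \sum_b d a b = nth 0 J a)%N -> (forall b, \sum_a d a b = nth 0 K b)%N ->
  exists w, [/\ level_asc f w, block_decreasing f g w & forall (a : 'I_r) (b : 'I_N),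
    cell w a b = d a b].
Proof.
move=> drow dcol.
have [|L HL] := @fiber_exists n _ (fun p => d p.1 p.2).
  rewrite -(pair_bigA _ (fun a b => d a b)) /= -sJ sumnE (big_nth 0%N) big_mkord.
  by apply: eq_bigr => a _.
have [p Hp] : exists p : 'S_n, forall k, Ordinal (label_bound k) = (L (p k)).1.
  apply: (fiber_perm (v := fun k => (L k).1)) => a.
  transitivity (nth 0%N J a); first by rewrite -(card_label sJ (ltn_ord a));
    apply: eq_card => k; rewrite !inE.
  rewrite -drow -sum1dep_card (partition_big (fun k => (L k).2) predT) //=.
  apply: eq_bigr => b _; rewrite -(HL (a, b)) -sum1dep_card; apply: eq_bigl => k.
  by rewrite -pair_eqE.
have [s Hs] : exists s : 'S_n, forall k, Ordinal (value_label_bound k) = (L (s k)).2.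
  apply: (fiber_perm (v := fun k => (L k).2)) => b.
  have bK : (b < size K)%N by rewrite zK.
  transitivity (nth 0%N K b); first by rewrite -(card_label sK bK);
    apply: eq_card => k; rewrite !inE.
  rewrite -dcol -sum1dep_card (partition_big (fun k => (L k).1) predT) //=.
  apply: eq_bigr => a _; rewrite -(HL (a, b)) -sum1dep_card; apply: eq_bigl => k.
  by rewrite andbC -pair_eqE.
pose x := (p * s^-1)%g.
have [y Hy ymax] := arg_maxnP (fun y => plen (y * x^-1)%g) (parabolic1 n g).
have Dy : level_dsc g (y * x^-1)%g.
  apply: (plen_max_dsc (@reshape_index_mono K)) => u Hu; rewrite mulgA; apply: ymax.
  exact: parabolicM.
pose t := (y * x^-1)^-1%g.
have [u Hu Au] := level_asc_rep (@reshape_index_mono J) t.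
exists (u * t)%g; split=> //.
  apply/block_decreasingP=> a b ab gab; rewrite !letter_parabolic // /letter invgK.
  by apply: reshape_index_mono; apply: ltnW; apply: Dy; rewrite // ab.
move=> a b; rewrite cell_letter.
transitivity #|[set i | (letter f x i == a) && (g i == b)]|.
  rewrite -[RHS](card_imset _ (@perm_inj _ y^-1)); apply: eq_card => i.
  rewrite -[i in RHS](permK y) (mem_imset _ _ (@perm_inj _ y^-1)) !inE letter_parabolic
    //.
  rewrite /letter /t invgK permM.
  by have /parabolicP -> := Hy.
rewrite -cell_letter /cell -(HL (a, b)) -(card_imset _ (@perm_inj _ p)).
apply: eq_card => k; rewrite -[k in LHS](permKV p) (mem_imset _ _ (@perm_inj _ p)) !inE.
set k' := (p^-1)%g k; have := congr1 val (Hp k'); rewrite /= permKV => ->.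
have := congr1 val (Hs (x k')); rewrite /= /x permM permKV permKV => ->.
by rewrite -pair_eqE.
Qed.

End Matrices.

Section Weights.
Variables (n N : nat) (J K : seq nat).
Hypothesis sJ : sumn J = n.
Hypothesis pJ : all (ltn 0) J.
Hypothesis sK : sumn K = n.
Hypothesis zK : size K = N.
Local Notation r := (size J).
Local Notation f := (reshape_index J).
Local Notation g := (reshape_index K).
Implicit Types (v w : 'S_n) (i k : 'I_n).

Let HJ : composition n J. Proof. by rewrite /composition pJ sJ eqxx. Qed.

Definition row_parts w (a : nat) : nat := #|[set b : 'I_N | cell J K w a b != 0%N]|.

Lemma repeat_at_pred w k : level_asc f w -> repeat_at f g w k -> exists k' : 'I_n,
  [/\ k = k'.+1 :> nat, f k' = f k & g (w k') = g (w k)].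
Proof.
move=> Aw /repeat_atP[a [b [ab gab letter_ab Eb]]];
  have Ek : (w^-1)%g b = k by apply: val_inj.
exists ((w^-1)%g a); rewrite !permKV -Ek permKV; split=> //.
exact: level_asc_adj (@reshape_index_mono J) _ _ _ Aw ab letter_ab.
Qed.

(** The letters weakly decrease from the value w k' to the value w k, and they agree at
    both ends; so they agree at the value preceding w k. *)
Lemma repeat_atI w k k' : level_asc f w -> block_decreasing f g w -> (k' < k)%N ->
  f k' = f k ->
  g (w k') = g (w k) -> repeat_at f g w k.
Proof.
move=> Aw Ho lt fk gk; have w_lt : (w k' < w k)%N by apply: Aw.
have Hb : ((w k).-1 < n)%N by have := ltn_ord (w k); lia.
pose a := Ordinal Hb; have ab : w k = a.+1 :> nat by rewrite /= prednK //; lia.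
have ga : g a = g (w k).
  apply/eqP; rewrite eqn_leq reshape_index_mono /= ?leq_pred //.
  by rewrite -gk reshape_index_mono //=; lia.
have letter_k : letter f w (w k) = f k by rewrite /letter permK.
have letter_k' : letter f w (w k') = f k' by rewrite /letter permK.
apply/repeat_atP; exists a, (w k); split=> //; last by rewrite permK.
apply/eqP; rewrite eqn_leq; apply/andP; split; last first.
  by have /block_decreasingP := Ho; apply.
rewrite letter_k -fk -letter_k'; have [->//|Na] := eqVneq a (w k').
have lt' : (w k' < a)%N.
  by rewrite ltn_neqAle eq_sym (inj_eq val_inj) Na /=; lia.
by apply: (block_decreasing_chain Ho) => //; rewrite gk ga.
Qed.

(** Sending k to the block of g that contains w k is a bijection from the positions without
    repeat in the block a to the nonzero entries of row a: the values of one block of g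
    in the block a stand in consecutive positions, all but the first being repeats. *)
Lemma card_no_repeat w (a : 'I_r) : level_asc f w -> block_decreasing f g w ->
  #|[set k : 'I_n | (f k == a) && ~~ repeat_at f g w k]| = row_parts w a.
Proof.
move=> Aw Ho; pose h k := Ordinal (value_label_bound sK zK (w k)).
rewrite /row_parts -(card_in_imset (f := h)).
  apply: eq_card => b; rewrite !inE; apply/imsetP/idP => [[k]|Hb].
    rewrite inE => /andP[/eqP fk _] ->; rewrite -lt0n card_gt0; apply/set0Pn; exists k.
    by rewrite inE fk !eqxx.
  have [k0 Hk0] : exists k0 : 'I_n, (f k0 == a) && (g (w k0) == b).
    by move: Hb; rewrite cards_eq0 => /set0Pn[k]; rewrite inE => Hk; exists k.
  case: (@arg_minnP _ k0 (fun k =>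
    (f k == a) && (g (w k) == b)) (@nat_of_ord n) Hk0) => k /andP[/eqP fk /eqP gk] kmin.
  exists k; last by apply: val_inj => /=.
  rewrite inE fk eqxx /=; apply/negP=> /(repeat_at_pred Aw)[k' [Ek fk' gk']].
  by have := kmin k'; rewrite fk' fk gk' gk !eqxx Ek ltnn => /(_ isT).
suff H k k' : f k = a -> f k' = a -> ~~ repeat_at f g w k' -> g (w k) = g (w k') ->
  ~~ (k < k')%N.
  move=> k k'; rewrite !inE => /andP[/eqP fk Nk] /andP[/eqP fk' Nk'] /(congr1 val) /= E.
  have := H k k' fk fk' Nk' E; have := H k' k fk' fk Nk (esym E).
  by rewrite -!leqNgt => A B; apply/val_inj/eqP; rewrite eqn_leq /= A B.
move=> fk fk' Nk' E; apply: contra Nk' => lt.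
by apply: repeat_atI lt _ E => //; rewrite fk fk'.
Qed.

Lemma J_gt0 (a : 'I_r) : (0 < nth 0%N J a)%N.
Proof. by have /allP := pJ; apply; apply: mem_nth. Qed.

Lemma card_inner_no_repeat w (a : 'I_r) : level_asc f w -> block_decreasing f g w ->
  #|[set k : 'I_n | [&& inner_index (start J) k, f k == a & ~~ repeat_at f g w k]]|
    = (row_parts w a).-1.
Proof.
move=> Aw Ho; rewrite -(card_no_repeat a Aw Ho).
have k0P : (sumn (take a J) < n)%N.
  by rewrite -sJ -[X in (X < _)%N]addn0; apply: flatten_indexP; apply: J_gt0.
have [c0 f0] := start_flatten (J_gt0 a); rewrite addn0 in c0 f0.
have inE' k : f k = a -> inner_index (start J) k = (k != Ordinal k0P).
  move=> fk; have ck : start J k = sumn (take a J) by rewrite /start fk.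
  rewrite /inner_index ck -(inj_eq val_inj) /= ltn_neqAle eq_sym.
  by rewrite -ck -(start_label (leqnn k)) ?eqxx ?andbT // sJ.
have N0 : ~~ repeat_at f g w (Ordinal k0P).
  by apply/negP=> /(repeat_at_inner (@reshape_index_mono J) (start_labelJ HJ) Aw);
    rewrite inE' ?eqxx.
rewrite [in RHS](cardsD1 (Ordinal k0P)) inE /= f0 eqxx N0 /=; apply: eq_card => k.
rewrite !inE; have [fk|] := eqVneq (f k) a; last by rewrite !andbF.
by rewrite inE' //= andbT andbC.
Qed.

Lemma weight_cells (R : comNzRingType) (z : nat -> R) w : level_asc f w ->
  block_decreasing f g w ->
  weight J K z w = \prod_(a < r)
    (z a ^+ (nth 0%N J a - row_parts w a) * (1 + z a) ^+ (row_parts w a).-1).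
Proof.
move=> Aw Ho; pose F q := if inner_index (start J) q then (if repeat_at f g w q then z
  (f q) else 1 + z (f q)) else 1.
rewrite -[weight J K z w]/(\prod_(1 <= q < n) F q).
have -> : \prod_(1 <= q < n) F q = \prod_(0 <= q < n) F q.
  have [->|n0] := posnP n; first by rewrite !big_geq.
  by rewrite [RHS]big_ltn // {2}/F /inner_index ltn0 mul1r.
rewrite big_mkord -big_mkcond /=.
rewrite (partition_big (fun k => Ordinal (label_bound sJ k)) predT) //=.
apply: eq_bigr => a _; rewrite (bigID (fun k : 'I_n => repeat_at f g w k)) /=;
  congr (_ * _).
  rewrite (eq_bigr (fun=> z a)) => [|k /andP[/andP[_ /eqP E] ->]]; last by rewrite -E.
  rewrite prodr_const; congr (_ ^+ _).
  rewrite -(card_no_repeat a Aw Ho) -(card_label sJ (ltn_ord a)).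
  rewrite -(cardsID [set k : 'I_n | repeat_at f g w k] [set k : 'I_n | f k == a]).
  rewrite (_ : _ :\: _ = [set k : 'I_n | (f k == a) && ~~ repeat_at f g w k]); last first.
    by apply/setP=> k; rewrite !inE andbC.
  rewrite addnK; apply: eq_card => k;
    rewrite [in RHS]inE /= !inE unfold_in -(inj_eq val_inj) /=.
  case: (boolP (repeat_at f g w k)) => [S|_]; last by rewrite !andbF.
  by rewrite (repeat_at_inner (@reshape_index_mono J) (start_labelJ HJ) Aw S) andbT.
rewrite (eq_bigr (fun=> 1 + z a)) => [|k /andP[/andP[_ /eqP E] /negbTE ->]];
  last by rewrite -E.
rewrite prodr_const -(card_inner_no_repeat a Aw Ho); congr (_ ^+ _).
by apply: eq_card => k; rewrite [in RHS]inE unfold_in -(inj_eq val_inj) /= andbA.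
Qed.

End Weights.

(** * Monomial expansion of the product of hook functions *)

Section Coefficients.
Variables (S : comNzRingType) (n : nat) (J : seq nat) (z : nat -> S).
Hypothesis HJ : composition n J.
Local Notation r := (size J).

Let sJ : sumn J = n. Proof. by case/andP: HJ => _ /eqP. Qed.
Let pJ : all (ltn 0) J. Proof. by case/andP: HJ. Qed.

Definition hook_prod (N : nat) : {mpoly S[N]} := \prod_(a < r)
  \sum_(i < nth 0%N J a) z a ^+ i *: schur S (i.+1 :: nseq ((nth 0%N J a).-1 - i) 1%N) N.

Definition hook_weight N (a : nat) (m : 'X_{1..N}) : S :=
  z a ^+ (nth 0%N J a - nparts m) * (1 + z a) ^+ (nparts m).-1.

Lemma nth_le_n (a : 'I_r) : (nth 0%N J a <= n)%N.
Proof. by rewrite -sJ sumnE (big_nth 0%N) big_mkord (bigD1 a) //= leq_addr. Qed.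

Definition is_row_family N (m : 'X_{1..N}) (p : {ffun 'I_r -> 'X_{1..N < n.+1}}) : bool :=
  [forall a : 'I_r, mdeg (p a) == nth 0%N J a] && ((\sum_a (p a : 'X_{1..N}))%MM == m).

Lemma mcoeff_hook_prod_rows N (m : 'X_{1..N}) :
  (hook_prod N)@_m = \sum_(p | is_row_family m p) \prod_(a < r) hook_weight a (p a).
Proof.
pose Q (a : 'I_r) (k : 'X_{1..N < n.+1}) := mdeg k == nth 0%N J a.
rewrite /hook_prod (eq_bigr (fun a : 'I_r => \sum_(k | Q a k) hook_weight a k *: 'X_[k])).
  rewrite bigA_distr_big_dep raddf_sum /= big_mkcond [RHS]big_mkcond /=.
  apply: eq_bigr => p _; rewrite /is_row_family.
  have -> : (p \in family Q) = [forall a : 'I_r, mdeg (p a) == nth 0%N J a] by [].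
  case: ifP => // _; rewrite scaler_prod mprodXE mcoeffZ mcoeffX /=.
  by case: eqP; rewrite ?mulr1 ?mulr0.
move=> a _; apply/mpolyP=> k; rewrite mcoeff_hook_sum ?(J_gt0 pJ) // raddf_sum /=.
case: eqP => [Ek|Nk].
  have Hk : (mdeg k < n.+1)%N by rewrite Ek ltnS nth_le_n.
  rewrite (bigD1 (BMultinom Hk)) /=; last by rewrite /Q /= Ek.
  rewrite mcoeffZ mcoeffX eqxx mulr1 big1 ?addr0 // => k' /andP[_ Nk'].
  by rewrite mcoeffZ mcoeffX -[X in X == _]/(bmnm k') (inj_eq val_inj _ (BMultinom Hk))
    (negbTE Nk') mulr0.
rewrite big1 // => k' /eqP Qk'; rewrite mcoeffZ mcoeffX; case: eqP => [E|_];
  last by rewrite mulr0.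
by case: Nk; rewrite -E.
Qed.

Section Fixed.
Variables (N : nat) (m : 'X_{1..N}).
Hypothesis dm : mdeg m = n.
Local Notation K := (multinom_val m : seq nat).
Local Notation f := (reshape_index J).
Local Notation g := (reshape_index K).

Let sK : sumn K = n.
Proof. by rewrite -dm /mdeg sumnE. Qed.
Let zK : size K = N. Proof. by rewrite size_tuple. Qed.

Lemma nth_mnm (b : 'I_N) : nth 0%N K b = m b.
Proof. by rewrite [RHS]/fun_of_multinom (tnth_nth 0%N). Qed.

Definition row_mnm (w : 'S_n) (a : nat) : 'X_{1..N} := [multinom cell J K w a b | b < N].

Lemma mdeg_row_mnm w (a : 'I_r) : mdeg (row_mnm w a) = nth 0%N J a.
Proof.
rewrite mdegE -(cell_row sJ sK zK w (ltn_ord a)).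
by apply: eq_bigr => b _; rewrite mnmE.
Qed.

Lemma row_mnm_bound w (a : 'I_r) : (mdeg (row_mnm w a) < n.+1)%N.
Proof. by rewrite mdeg_row_mnm ltnS nth_le_n. Qed.

Definition rows (w : 'S_n) : {ffun 'I_r -> 'X_{1..N < n.+1}} :=
  [ffun a => BMultinom (row_mnm_bound w a)].

Lemma nparts_row_mnm w a : nparts (row_mnm w a) = row_parts N J K w a.
Proof. by apply: eq_card => b; rewrite !inE mnmE. Qed.

(** The map rows is a bijection from the block decreasing minimal representatives to the
    families of monomials of degrees J with product m. *)
Lemma mcoeff_hook_prod : (hook_prod N)@_m = weight_sum n J K z.
Proof.
rewrite mcoeff_hook_prod_rows /weight_sum.
pose W := [set w in min_reps n J | block_decreasing f g w].
have WP w : w \in W -> level_asc f w /\ block_decreasing f g w.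
  by rewrite inE => /andP[/min_repsE].
have injW : {in W &, injective rows}.
  move=> w w' /WP[Aw Ow] /WP[Aw' Ow'] E; apply: (letter_inj Aw Aw').
  apply: (cell_inj sJ sK zK Ow Ow') => a b aJ bN.
  have := congr1 (fun p : {ffun 'I_r -> 'X_{1..N < n.+1}} =>
    (bmnm (p (Ordinal aJ))) (Ordinal bN)) E.
  by rewrite !ffunE /= !mnmE.
transitivity (\sum_(p in rows @: W) \prod_(a < r) hook_weight a (p a)); last first.
  rewrite big_imset // big_mkcond [RHS]big_mkcond /=; apply: eq_bigr => w _.
  rewrite inE; case: ifP => // /andP[/min_repsE Aw Ow].
  rewrite (weight_cells sJ pJ sK zK z Aw Ow); apply: eq_bigr => a _.
  by rewrite /hook_weight ffunE /= nparts_row_mnm.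
apply: eq_bigl => p; apply/andP/imsetP => [[/forallP Hrow /eqP Hcol]|[w /WP[Aw Ow] ->]].
  have [||w [Aw Ow Ew]] := @cell_exists n N J K sJ sK zK (fun a b => (p a : 'X_{1..N}) b).
  - by move=> a; rewrite -(eqP (Hrow a)) mdegE.
  - by move=> b; rewrite nth_mnm -Hcol mnm_sumE.
  exists w; first by rewrite inE Ow andbT; apply/min_repsE.
  apply/ffunP=> a; apply: val_inj; rewrite ffunE /=; apply/mnmP=> b.
  by rewrite mnmE Ew.
split; first by apply/forallP=> a; rewrite ffunE /= mdeg_row_mnm.
apply/eqP/mnmP=> b; rewrite mnm_sumE -nth_mnm -(cell_col sJ sK zK w (ltn_ord b)).
by apply: eq_bigr => a _; rewrite ffunE /= mnmE.
Qed.

End Fixed.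

Lemma mcoeff_hook_prod0 N (m : 'X_{1..N}) : mdeg m != n -> (hook_prod N)@_m = 0.
Proof.
move=> Nm; rewrite mcoeff_hook_prod_rows big1 // => p /andP[/forallP Hrow /eqP Em].
case/eqP: Nm; rewrite -Em mdeg_sum -[RHS]sJ sumnE (big_nth 0%N) big_mkord.
by apply: eq_bigr => a _; apply/eqP.
Qed.

Lemma nparts_mperm N (m : 'X_{1..N}) (s : 'S_N) :
  nparts [multinom m (s i) | i < N] = nparts m.
Proof.
rewrite /nparts -(card_imset _ (@perm_inj _ s)); apply: eq_card => i.
by rewrite -[i](permKV s) (mem_imset _ _ (@perm_inj _ s)) !inE mnmE permKV.
Qed.

Lemma hook_prod_sym N : hook_prod N \is symmetric.
Proof.
apply: rpred_prod => a _; apply/issymP=> s; apply/mpolyP=> m.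
by rewrite mcoeff_sym !mcoeff_hook_sum ?(J_gt0 pJ) // nparts_mperm mdeg_mperm.
Qed.

(** Empty blocks shift the numbering of the blocks without changing the blocks. *)
Lemma reshape_index_nz K i j : (i < sumn K)%N -> (j < sumn K)%N ->
  (reshape_index [seq k <- K | k != 0%N] i == reshape_index [seq k <- K | k != 0%N] j)
  = (reshape_index K i == reshape_index K j).
Proof.
elim: K i j => [|k K IH] i j //= Hi Hj; case: (posnP k) => [k0|k_gt0].
  by rewrite k0 /= !reshape_index_cons !ltn0 !subn0 eqSS IH //; move: Hi Hj; rewrite k0.
rewrite /= !reshape_index_cons; case: (ltnP i k) => ik; case: (ltnP j k) => jk //.
by rewrite eqSS IH // ltn_subLR.
Qed.

Lemma weight_sum_nz K : sumn K = n ->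
  weight_sum n J K z = weight_sum n J [seq k <- K | k != 0%N] z.
Proof.
move=> sK; have gE (a b : 'I_n) : (reshape_index [seq k <- K | k != 0%N] a
    == reshape_index [seq k <- K | k != 0%N] b)
      = (reshape_index K a == reshape_index K b).
  by apply: reshape_index_nz; rewrite sK.
have okE (w : 'S_n) : block_decreasing (reshape_index J) (reshape_index [seq k <- K | k
  != 0%N]) w
    = block_decreasing (reshape_index J) (reshape_index K) w.
  apply/block_decreasingP/block_decreasingP => H a b ab /eqP E; apply: H => //;
    apply/eqP; first by rewrite gE.
  by rewrite -gE.
have repE (w : 'S_n) q : repeat_at (reshape_index J) (reshape_index [seq k <- K | k !=
  0%N]) w q
    = repeat_at (reshape_index J) (reshape_index K) w q.
  apply/repeat_atP/repeat_atP => -[a [b [ab /eqP E letter_ab Eq]]]; exists a, b;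
    split=> //; apply/eqP.
    by rewrite -gE.
  by rewrite gE.
rewrite /weight_sum; apply: eq_big => [w|w _]; first by rewrite okE.
by apply: eq_bigr => q _; rewrite repE.
Qed.

Let geq_total : total geq. Proof. by move=> a b; apply: leq_total. Qed.
Let geq_trans : transitive geq. Proof. by move=> a b d /= ab bd;
  apply: leq_trans bd ab. Qed.

Definition parts N (m : 'X_{1..N}) : seq nat :=
  sort geq [seq k <- multinom_val m | k != 0%N].

(** By symmetry the exponents may be sorted, and empty parts may be dropped. *)
Lemma mcoeff_hook_parts N (m : 'X_{1..N}) : mdeg m = n ->
  (hook_prod N)@_m = weight_sum n J (parts m) z.
Proof.
move=> dm; have St : size (sort geq (multinom_val m)) == N by rewrite size_sort
  size_tuple.
pose m' : 'X_{1..N} := Multinom (Tuple St).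
have /tuple_permP[s Es] : perm_eq (multinom_val m') (multinom_val m).
  by rewrite /= perm_sort.
have E : m' = [multinom m (s i) | i < N].
  apply/mnmP=> i; rewrite mnmE; move/val_inj: Es => /(congr1 (fun t => tnth t i)).
  by rewrite tnth_mktuple.
have dm' : mdeg m' = n by rewrite E mdeg_mperm.
rewrite -(msym_coeff m s (hook_prod_sym N)) -E mcoeff_hook_prod // weight_sum_nz.
  by rewrite /= filter_sort.
by rewrite -dm' /mdeg sumnE.
Qed.

Lemma mcoeff_monomial l N (m : 'X_{1..N}) : partition_seq l ->
  (monomial S l N)@_m = (parts m == l)%:R.
Proof.
move=> /andP[Sl Pl]; have -> : (parts m == l)
    = perm_eq [seq k <- multinom_val m | k != 0%N] l.
  apply/eqP/idP => [<-|KL]; first by rewrite perm_sym perm_sort.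
  apply: (sorted_eq geq_trans) => //.
  - by move=> a b /= /andP[ab ba]; apply/eqP; rewrite eqn_leq; apply/andP.
  - exact: sort_sorted.
  by rewrite perm_sort.
rewrite raddf_sum /=; case: (boolP (perm_eq _ l)) => KL.
  have Hm : (mdeg m < (sumn l).+1)%N.
    rewrite ltnS /mdeg -(perm_sumn KL) sumnE [X in (X <= _)%N](bigID (fun k =>
      k != 0%N)) /=.
    rewrite big_filter [X in (_ + X <= _)%N]big1 ?addn0 // => k.
    by rewrite negbK => /eqP.
  rewrite (bigD1 (BMultinom Hm)) //= mcoeffX eqxx big1 ?addr0 // => k /andP[_].
  by rewrite -(inj_eq val_inj) /= mcoeffX => /negbTE ->.
rewrite big1 // => k Hk; rewrite mcoeffX; case: eqP => // E.
by rewrite -E Hk in KL.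
Qed.

(** All the partitions of n: such a partition has at most n parts, so it comes from a
    monomial of degree n in n variables. *)
Definition partitions : seq (seq nat) :=
  undup [seq parts (bmnm m) | m <- enum {: 'X_{1..n < n.+1}} & mdeg (bmnm m) == n].

Lemma parts_partition N (m : 'X_{1..N}) : partition_seq (parts m).
Proof.
rewrite /partition_seq sort_sorted //= all_sort; apply/allP=> k.
by rewrite mem_filter -lt0n => /andP[].
Qed.

Lemma sumn_parts N (m : 'X_{1..N}) : sumn (parts m) = mdeg m.
Proof.
rewrite /parts (perm_sumn (s2 :=
  [seq k <- multinom_val m | k != 0%N])) ?perm_sort ?perm_refl //.
rewrite /mdeg !sumnE big_filter [RHS](bigID (fun k => k != 0%N)) /=.
by rewrite [X in (_ + X)%N]big1 ?addn0 // => k; rewrite negbK => /eqP.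
Qed.

Lemma mem_partitions l : partition_seq l -> sumn l = n -> l \in partitions.
Proof.
move=> /andP[Sl Pl] sl; rewrite mem_undup.
have le_l : (size l <= n)%N.
  rewrite -sl sumnE -sum1_size big_seq [X in (_ <= X)%N]big_seq.
  by apply: leq_sum => k kl; apply: (allP Pl).
have size_m : size (l ++ nseq (n - size l) 0%N) == n by rewrite size_cat size_nseq subnKC.
pose m : 'X_{1..n} := Multinom (Tuple size_m).
have pm : parts m = l.
  rewrite /parts /= filter_cat (all_filterP _) /=; last first.
    by apply: sub_all Pl => k; rewrite /= lt0n.
  rewrite (eq_in_filter (a2 := pred0)) ?filter_pred0 ?cats0; last first.
    by move=> k; rewrite mem_nseq => /andP[_ /eqP ->].
  by apply: sorted_sort => // ? ? ?; apply: geq_trans.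
have dm : mdeg m = n by rewrite -sumn_parts pm.
have Hm : (mdeg m < n.+1)%N by rewrite dm.
apply/mapP; exists (BMultinom Hm); last by rewrite /= pm.
by rewrite mem_filter /= dm eqxx mem_enum.
Qed.

Lemma hook_prod_monomial K : composition n K ->
  is_monomial_coef hook_prod K (weight_sum n J K z).
Proof.
case/andP=> pK /eqP sK.
exists partitions, (fun l => if l \in partitions then weight_sum n J l z else 0).
split.
- rewrite undup_uniq /=; apply/allP=> l; rewrite mem_undup => /mapP[m _ ->].
  exact: parts_partition.
- by move=> l /negbTE ->.
- move=> N; apply/mpolyP=> m; rewrite raddf_sum /=.
  rewrite (eq_big_seq (fun l => if l == parts m then weight_sum n J l z else 0));
    last first.
    move=> l Hl; rewrite Hl mcoeffZ mcoeff_monomial; last first.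
      by move: Hl; rewrite mem_undup => /mapP[m' _ ->]; apply: parts_partition.
    by rewrite eq_sym; case: eqP => _; rewrite ?mulr1 ?mulr0.
  have [dm|Nm] := eqVneq (mdeg m) n.
    rewrite (bigD1_seq (parts m)) ?undup_uniq //=; last first.
      by apply: mem_partitions; rewrite ?parts_partition ?sumn_parts.
    rewrite eqxx mcoeff_hook_parts // big1 ?addr0 // => l /negbTE ->.
    by [].
  rewrite mcoeff_hook_prod0 // -big_mkcond /= big1_seq // => l /andP[/eqP ->].
  rewrite mem_undup => /mapP[m']; rewrite mem_filter => /andP[/eqP dm' _] E.
  by case/eqP: Nm; rewrite -sumn_parts E sumn_parts.
have size_K : size K == size K by [].
pose m : 'X_{1..size K} := Multinom (Tuple size_K).
have dm : mdeg m = n by rewrite /mdeg /= -sumnE.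
have pm : parts m = sort geq K.
  by rewrite /parts /= (all_filterP _) //; apply: sub_all pK => -[].
rewrite -pm mem_partitions ?parts_partition ?sumn_parts //.
by rewrite -mcoeff_hook_parts // mcoeff_hook_prod.
Qed.

End Coefficients.

Theorem theorem9 (R : comUnitRingType) (q : R) (n : nat) (J K : seq nat)
    (Q := q - q^-1) :
  q \is a GRing.unit -> Q \is a GRing.unit ->
  composition n J -> composition n K ->
  hformz (coset_sum J (EJ Q n J)) (Lsum Q n K)
    = (Q ^ ((size K)%:Z - n%:Z)) *: hformz (norm J (ExiJ Q n J)) (zetaJ Q n K)
  /\ is_monomial_coef
       (fun N => \prod_(a < size J) \sum_(i < nth 0%N J a)
          ('X_a : {mpoly R[size J]}) ^+ i
            *: schur _ (i.+1 :: nseq ((nth 0%N J a).-1 - i) 1%N) N)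
       K (hformz (coset_sum J (EJ Q n J)) (Lsum Q n K)).
Proof.
move=> _ Qu HJ HK; rewrite (hformz_coset_sum Q HJ HK) (hformz_norm Q HJ HK); split.
  have le_K := size_composition HK.
  rewrite scalerA -[(size K)%:Z - n%:Z]opprB subzn // -exprnN mulVr ?scale1r // unitrX //.
have [s [c [us c0 fE xE]]] := hook_prod_monomial (indet R J) HJ HK.
exists s, c; split=> // N; rewrite -fE /hook_prod; apply: eq_bigr => a _.
by apply: eq_bigr => i _; rewrite indetE.
Qed.
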